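(* Let $2\leq n<\infty$, let $\alpha$ be Artin's representation of the braid group $B_n$ on the free group $\mathbb{F}_n=\langle x_1,\dotsc,x_n\rangle$, let $\varphi\in Z^1(B_n,\operatorname{Hom}(\mathbb{F}_n,\mathbb{T}))$, let $\alpha^\varphi$ denote the associated $\varphi$-deformed actions of $B_n$ on $C^*_r(\mathbb{F}_n)$ and on $W^*(\mathbb{F}_n)$, and let \[ \mu^\varphi=\prod_{\substack{1\leq j\leq n-1\\ 1\leq k\leq n}}\varphi(s_j,x_k)\in\mathbb{T}. \] Then the following are equivalent: (i) $\mu^\varphi$ is nontorsion; (ii) the reduced crossed product $C^*_r(\mathbb{F}_n)\rtimes^r_{\alpha^\varphi}B_n$ is simple; (iii) $C^*_r(\mathbb{F}_n)\rtimes^r_{\alpha^\varphi}B_n$ has a unique tracial state; (iv) the von Neumann algebra crossed product $W^*(\mathbb{F}_n)\rtimes_{\alpha^\varphi}B_n$ is a factor.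
   Context: The braid group $B_n$ is generated by $s_1,\dotsc,s_{n-1}$ with relations $s_is_{i+1}s_i=s_{i+1}s_is_{i+1}$ for $1\leq i\leq n-2$ and $s_is_j=s_js_i$ when $|i-j|\geq 2$. Artin's representation is the injective homomorphism $\alpha\colon B_n\to\operatorname{Aut}\mathbb{F}_n$ given by $\alpha(s_i)(x_i)=x_{i+1}$, $\alpha(s_i)(x_{i+1})=x_{i+1}^{-1}x_ix_{i+1}$, and $\alpha(s_i)(x_j)=x_j$ for $j\notin\{i,i+1\}$; write $\alpha_a=\alpha(a)$. $\mathbb{T}$ is the unit circle in $\mathbb{C}$. $Z^1(B_n,\operatorname{Hom}(\mathbb{F}_n,\mathbb{T}))$ is the set of functions $\varphi\colon B_n\times\mathbb{F}_n\to\mathbb{T}$ with $\varphi(ab,x)=\varphi(a,\alpha_b(x))\varphi(b,x)$ and $\varphi(a,xy)=\varphi(a,x)\varphi(a,y)$ for all $a,b\in B_n$, $x,y\in\mathbb{F}_n$. $\lambda$ is the left regular representation of $\mathbb{F}_n$ on $\ell^2(\mathbb{F}_n)$; $C^*_r(\mathbb{F}_n)$ and $W^*(\mathbb{F}_n)$ are the $C^*$-algebra and von Neumann algebra generated by $\lambda(\mathbb{F}_n)$. The action $\alpha^\varphi$ of $B_n$ on $C^*_r(\mathbb{F}_n)$ (resp. $W^*(\mathbb{F}_n)$) is determined by $\alpha^\varphi_a(\lambda(x))=\varphi(a,x)\lambda(\alpha_a(x))$ for $a\in B_n$, $x\in\mathbb{F}_n$. An element $w\in\mathbb{T}$ is nontorsion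 if $w^m\neq 1$ for all $m\in\mathbb{Z}\setminus\{0\}$. A $C^*$-algebra is simple if it has no nontrivial proper closed two-sided ideals; a tracial state is a state $\phi$ with $\phi(ST)=\phi(TS)$ for all $S,T$; a von Neumann algebra is a factor if its center is trivial. *)

(* Defs.v *)
From HB Require Import structures.
From mathcomp Require Import all_boot all_order all_algebra.
From mathcomp Require Import zify ring lra complex.
From mathcomp Require Import boolp classical_sets functions cardinality fsbigop reals ereal.
From mathcomp Require Import sequences normedtype esum.

Set Implicit Arguments.
Unset Strict Implicit.
Unset Printing Implicit Defensive.

Import Order.TTheory GRing.Theory Num.Theory.
Import ComplexField.Normc.

Local Open Scope classical_set_scope.
Local Open Scope ring_scope.

(* The letter (i, true) is the i-th generator, (i, false) is its inverse. *)
Definition word (I : choiceType) := seq (I * bool).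

Section Presentation.
Variables (I : choiceType) (rels : word I -> word I -> Prop).
Implicit Types u v w r s : word I.

Inductive pres_cong : word I -> word I -> Prop :=
| pres_refl w : pres_cong w w
| pres_sym v w : pres_cong v w -> pres_cong w v
| pres_trans u v w : pres_cong u v -> pres_cong v w -> pres_cong u w
| pres_cancel u v i b : pres_cong (u ++ [:: (i, b); (i, ~~ b)] ++ v) (u ++ v)
| pres_base u v r s : rels r s -> pres_cong (u ++ r ++ v) (u ++ s ++ v).

Definition pres_eqv : rel (word I) := fun v w => `[< pres_cong v w >].

Lemma pres_eqv_refl : reflexive pres_eqv.
Proof. by move=> w; apply/asboolP; exact: pres_refl. Qed.

Lemma pres_eqv_sym : symmetric pres_eqv.
Proof. by move=> v w; apply/asboolP/asboolP; exact: pres_sym. Qed.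

Lemma pres_eqv_trans : transitive pres_eqv.
Proof.
by move=> v u w /asboolP uv /asboolP vw; apply/asboolP; exact: pres_trans uv vw.
Qed.

Canonical pres_equiv :=
  EquivRel pres_eqv pres_eqv_refl pres_eqv_sym pres_eqv_trans.

Definition presented := {eq_quot pres_equiv}%qT.
HB.instance Definition _ := Choice.on presented.
HB.instance Definition _ := Quotient.on presented.

Definition pres_class w : presented := (\pi_presented w)%qT.

Lemma pres_classP v w : pres_class v = pres_class w <-> pres_cong v w.
Proof.
split; first by move=> /(@eqmodP _ pres_equiv) /asboolP.
by move=> vw; apply/(@eqmodP _ pres_equiv)/asboolP.
Qed.

Lemma pres_classK (x : presented) : pres_class (repr x) = x.
Proof. exact: reprK. Qed.

Definition word_inv w : word I := rev [seq (l.1, ~~ l.2) | l <- w].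

Lemma word_inv_cons i b w : word_inv ((i, b) :: w) = word_inv w ++ [:: (i, ~~ b)].
Proof. by rewrite /word_inv /= rev_cons cats1. Qed.

Lemma pres_cong_catl u v w : pres_cong v w -> pres_cong (u ++ v) (u ++ w).
Proof.
elim=> {v w}.
- by move=> w; exact: pres_refl.
- by move=> v w _; exact: pres_sym.
- by move=> x y z _ xy _; exact: pres_trans xy.
- by move=> x y i b; rewrite catA [u ++ (x ++ y)]catA; exact: pres_cancel.
- by move=> x y r s rs; rewrite catA [u ++ (x ++ (s ++ y))]catA; exact: pres_base.
Qed.

Lemma pres_cong_catr u v w : pres_cong v w -> pres_cong (v ++ u) (w ++ u).
Proof.
elim=> {v w}.
- by move=> w; exact: pres_refl.
- by move=> v w _; exact: pres_sym.
- by move=> x y z _ xy _; exact: pres_trans xy.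
- by move=> x y i b; rewrite -!catA; exact: pres_cancel.
- by move=> x y r s rs; rewrite -!catA; exact: pres_base.
Qed.

Lemma pres_cong_cat u u' v v' :
  pres_cong u u' -> pres_cong v v' -> pres_cong (u ++ v) (u' ++ v').
Proof.
by move=> uu' vv'; apply: pres_trans (pres_cong_catl _ vv'); exact: pres_cong_catr.
Qed.

Lemma pres_cong_mulVw w : pres_cong (word_inv w ++ w) [::].
Proof.
elim: w => [|[i b] w IHw]; first exact: pres_refl.
rewrite word_inv_cons -catA; apply: pres_trans IHw.
by have := pres_cancel (word_inv w) w i (~~ b); rewrite negbK.
Qed.

Lemma word_invK w : word_inv (word_inv w) = w.
Proof.
rewrite /word_inv -map_rev revK -map_comp -[RHS]map_id.
by apply: eq_map => -[i b] /=; rewrite negbK.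
Qed.

Lemma pres_cong_mulwV w : pres_cong (w ++ word_inv w) [::].
Proof. by rewrite -{1}[w]word_invK; exact: pres_cong_mulVw. Qed.

Lemma pres_cong_inv v w : pres_cong v w -> pres_cong (word_inv v) (word_inv w).
Proof.
move=> vw; apply: (@pres_trans _ (word_inv v ++ (w ++ word_inv w))).
  rewrite -{1}[word_inv v]cats0; apply: pres_cong_catl.
  exact/pres_sym/pres_cong_mulwV.
rewrite catA -[X in pres_cong _ X]cat0s; apply: pres_cong_catr.
apply: pres_trans (pres_cong_mulVw v).
exact/pres_cong_catl/pres_sym.
Qed.

Definition pres_one : presented := pres_class [::].
Definition pres_mul (x y : presented) := pres_class (repr x ++ repr y).
Definition pres_inv (x : presented) := pres_class (word_inv (repr x)).

Lemma pres_repr w : pres_cong (repr (pres_class w)) w.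
Proof. by apply/pres_classP; rewrite pres_classK. Qed.

Lemma pres_mulE v w : pres_mul (pres_class v) (pres_class w) = pres_class (v ++ w).
Proof. by apply/pres_classP/pres_cong_cat; exact: pres_repr. Qed.

Lemma pres_invE w : pres_inv (pres_class w) = pres_class (word_inv w).
Proof. by apply/pres_classP/pres_cong_inv/pres_repr. Qed.

Lemma pres_mulA : associative pres_mul.
Proof.
move=> x y z; rewrite -[x]pres_classK -[y]pres_classK -[z]pres_classK.
by rewrite !pres_mulE catA.
Qed.

Lemma pres_mul1 : left_id pres_one pres_mul.
Proof. by move=> x; rewrite -[x]pres_classK pres_mulE. Qed.

Lemma pres_mulx1 : right_id pres_one pres_mul.
Proof. by move=> x; rewrite -[x]pres_classK pres_mulE cats0. Qed.

Lemma pres_mulV : left_inverse pres_one pres_inv pres_mul.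
Proof.
move=> x; rewrite -[x]pres_classK pres_invE pres_mulE.
exact/pres_classP/pres_cong_mulVw.
Qed.

Lemma pres_mulxV : right_inverse pres_one pres_inv pres_mul.
Proof.
move=> x; rewrite -[x]pres_classK pres_invE pres_mulE.
exact/pres_classP/pres_cong_mulwV.
Qed.

HB.instance Definition _ := isGroup.Build presented
  pres_mulA pres_mul1 pres_mulx1 pres_mulV pres_mulxV.

Definition pres_gen (i : I) : presented := pres_class [:: (i, true)].

Definition word_eval (H : groupType) (g : I -> H) (w : word I) : H :=
  foldr (fun l h => ((if l.2 then g l.1 else (g l.1)^-1) * h)%g) 1%g w.

Definition pres_lift (H : groupType) (g : I -> H) (x : presented) : H :=
  word_eval g (repr x).

Section Lift.
Variables (H : groupType) (g : I -> H).
Hypothesis gP : forall r s, rels r s -> word_eval g r = word_eval g s.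

Lemma word_eval_cat v w :
  word_eval g (v ++ w) = (word_eval g v * word_eval g w)%g.
Proof. by elim: v => [|l v IHv] /=; rewrite ?mul1g // IHv mulgA. Qed.

Lemma word_eval_cong v w : pres_cong v w -> word_eval g v = word_eval g w.
Proof.
elim=> {v w} //.
- by move=> u v w _ -> _ ->.
- move=> u v i b; rewrite !word_eval_cat /=; congr (_ * _)%g.
  by case: b => /=; rewrite mulg1 ?mulgV ?mulVg mul1g.
- by move=> u v r s /gP rs; rewrite !word_eval_cat rs.
Qed.

Lemma pres_liftE w : pres_lift g (pres_class w) = word_eval g w.
Proof. exact/word_eval_cong/pres_repr. Qed.

Lemma pres_lift_gen i : pres_lift g (pres_gen i) = g i.
Proof. by rewrite pres_liftE /= mulg1. Qed.

Lemma pres_liftM x y : pres_lift g (x * y)%g = (pres_lift g x * pres_lift g y)%g.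
Proof.
rewrite -[x]pres_classK -[y]pres_classK [(_ * _)%g]pres_mulE !pres_liftE.
exact: word_eval_cat.
Qed.

End Lift.

End Presentation.

Definition multiplicative_map (G H : groupType) (f : G -> H) : Prop :=
  {morph f : x y / (x * y)%g}.

(* Generators are indexed from 0: x_j and s_j of the usual numbering are      *)
(* fg_gen and br_gen of index j - 1.                                          *)
Definition free_group (n : nat) := @presented 'I_n (fun _ _ => False).
HB.instance Definition _ n := Group.on (free_group n).

Definition fg_gen n (j : 'I_n) : free_group n := pres_gen _ j.

Definition fg_lift n (H : groupType) (g : 'I_n -> H) : free_group n -> H :=
  @pres_lift _ _ H g.

Inductive braid_rel (n : nat) : word 'I_n.-1 -> word 'I_n.-1 -> Prop :=
| braid_rel3 (i j : 'I_n.-1) : j = i.+1 :> nat ->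
    braid_rel [:: (i, true); (j, true); (i, true)]
              [:: (j, true); (i, true); (j, true)]
| braid_rel_far (i j : 'I_n.-1) : (i.+1 < j)%N || (j.+1 < i)%N ->
    braid_rel [:: (i, true); (j, true)] [:: (j, true); (i, true)].

Definition braid_group (n : nat) := presented (@braid_rel n).
HB.instance Definition _ n := Group.on (braid_group n).

Definition br_gen n (i : 'I_n.-1) : braid_group n := pres_gen _ i.

Section Artin.
Variable n : nat.

Lemma ord_hi_subproof (i : 'I_n.-1) : (i.+1 < n)%N.
Proof. by case: n i => [|m] [k ltk] //=. Qed.

Definition ord_lo (i : 'I_n.-1) : 'I_n := widen_ord (leq_pred n) i.
Definition ord_hi (i : 'I_n.-1) : 'I_n := Ordinal (ord_hi_subproof i).

Local Notation lo i := (fg_gen (ord_lo i)).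
Local Notation hi i := (fg_gen (ord_hi i)).

Definition artin_gen (i : 'I_n.-1) : free_group n -> free_group n :=
  fg_lift (fun j => if j == ord_lo i then hi i
                    else if j == ord_hi i then ((hi i)^-1 * lo i * hi i)%g
                    else fg_gen j).

(* The inverse of artin_gen i, see artin_genK and artin_gen_invK.             *)
Definition artin_gen_inv (i : 'I_n.-1) : free_group n -> free_group n :=
  fg_lift (fun j => if j == ord_lo i then (lo i * hi i * (lo i)^-1)%g
                    else if j == ord_hi i then lo i
                    else fg_gen j).

Definition artin_word (w : word 'I_n.-1) : free_group n -> free_group n :=
  foldr (fun l f => (if l.2 then artin_gen l.1 else artin_gen_inv l.1) \o f) id w.

Definition artin (a : braid_group n) : free_group n -> free_group n :=
  artin_word (repr a).

Lemma multiplicative1 (G H : groupType) (f : G -> H) :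
  multiplicative_map f -> f 1%g = 1%g.
Proof.
by move=> fM; apply: (@mulgI _ (f 1%g)); rewrite -fM !mulg1.
Qed.

Lemma multiplicativeV (G H : groupType) (f : G -> H) :
  multiplicative_map f -> {morph f : x / (x^-1)%g}.
Proof.
move=> fM x; apply: (@mulgI _ (f x)).
by rewrite -fM !mulgV multiplicative1.
Qed.

Lemma fg_liftM (H : groupType) (g : 'I_n -> H) : multiplicative_map (fg_lift g).
Proof. exact: pres_liftM. Qed.

Lemma fg_lift_gen (H : groupType) (g : 'I_n -> H) j : fg_lift g (fg_gen j) = g j.
Proof. exact: pres_lift_gen. Qed.

Lemma fg_hom_ext (H : groupType) (f g : free_group n -> H) :
    multiplicative_map f -> multiplicative_map g ->
  (forall j, f (fg_gen j) = g (fg_gen j)) -> f =1 g.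
Proof.
move=> fM gM fg x; rewrite -[x](pres_classK (rels := fun _ _ => False)).
elim: (repr x) => [|[j b] w IHw].
  by rewrite (multiplicative1 fM) (multiplicative1 gM).
have -> : pres_class (fun _ _ => False) ((j, b) :: w) =
    ((if b then fg_gen j else (fg_gen j)^-1) * pres_class _ w)%g :> free_group n.
  by case: b; rewrite ?[((fg_gen j)^-1)%g]pres_invE [RHS]pres_mulE.
rewrite fM gM IHw; congr (_ * _)%g; case: b; first exact: fg.
by rewrite (multiplicativeV fM) (multiplicativeV gM) fg.
Qed.

Lemma artin_genM i : multiplicative_map (artin_gen i).
Proof. exact: fg_liftM. Qed.

Lemma artin_gen_invM i : multiplicative_map (artin_gen_inv i).
Proof. exact: fg_liftM. Qed.

Lemma ord_hi_lo i : (ord_hi i == ord_lo i) = false.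
Proof. by rewrite -val_eqE /= gtn_eqF. Qed.

Lemma artin_gen_lo i : artin_gen i (lo i) = hi i.
Proof. by rewrite /artin_gen fg_lift_gen eqxx. Qed.

Lemma artin_gen_hi i : artin_gen i (hi i) = ((hi i)^-1 * lo i * hi i)%g.
Proof. by rewrite /artin_gen fg_lift_gen ord_hi_lo eqxx. Qed.

Lemma artin_gen_id i j : j != ord_lo i -> j != ord_hi i ->
  artin_gen i (fg_gen j) = fg_gen j.
Proof. by move=> jl jh; rewrite /artin_gen fg_lift_gen (negPf jl) (negPf jh). Qed.

Lemma artin_gen_inv_lo i : artin_gen_inv i (lo i) = (lo i * hi i * (lo i)^-1)%g.
Proof. by rewrite /artin_gen_inv fg_lift_gen eqxx. Qed.

Lemma artin_gen_inv_hi i : artin_gen_inv i (hi i) = lo i.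
Proof. by rewrite /artin_gen_inv fg_lift_gen ord_hi_lo eqxx. Qed.

Lemma artin_gen_inv_id i j : j != ord_lo i -> j != ord_hi i ->
  artin_gen_inv i (fg_gen j) = fg_gen j.
Proof.
by move=> jl jh; rewrite /artin_gen_inv fg_lift_gen (negPf jl) (negPf jh).
Qed.

Lemma multiplicative_comp (G H K : groupType) (f : H -> K) (g : G -> H) :
  multiplicative_map f -> multiplicative_map g -> multiplicative_map (f \o g).
Proof. by move=> fM gM x y /=; rewrite gM fM. Qed.

Lemma artin_genK i : cancel (artin_gen i) (artin_gen_inv i).
Proof.
apply: fg_hom_ext => [||j] //=.
  exact: multiplicative_comp (@artin_gen_invM i) (@artin_genM i).
have [->|jl] := eqVneq j (ord_lo i).
  by rewrite artin_gen_lo artin_gen_inv_hi.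
have [->|jh] := eqVneq j (ord_hi i).
  rewrite artin_gen_hi !artin_gen_invM (multiplicativeV (@artin_gen_invM i)).
  by rewrite artin_gen_inv_hi artin_gen_inv_lo !mulgA mulVg mul1g mulgVK.
by rewrite artin_gen_id // artin_gen_inv_id.
Qed.

Lemma artin_gen_invK i : cancel (artin_gen_inv i) (artin_gen i).
Proof.
apply: fg_hom_ext => [||j] //=.
  exact: multiplicative_comp (@artin_genM i) (@artin_gen_invM i).
have [->|jl] := eqVneq j (ord_lo i).
  rewrite artin_gen_inv_lo !artin_genM (multiplicativeV (@artin_genM i)).
  by rewrite artin_gen_hi artin_gen_lo !mulgA mulgV mul1g mulgK.
have [->|jh] := eqVneq j (ord_hi i).
  by rewrite artin_gen_inv_hi artin_gen_lo.
by rewrite artin_gen_inv_id // artin_gen_id.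
Qed.

Lemma artin_wordM w : multiplicative_map (artin_word w).
Proof.
elim: w => [|[i b] w IHw] //=; apply: multiplicative_comp => //.
by case: b; [exact: artin_genM|exact: artin_gen_invM].
Qed.

Lemma artin_word_cat v w : artin_word (v ++ w) = artin_word v \o artin_word w.
Proof. by elim: v => [|l v IHv] //=; rewrite IHv. Qed.

Lemma artin_braid3 (i j : 'I_n.-1) : j = i.+1 :> nat ->
  artin_gen i \o (artin_gen j \o artin_gen i) =1
  artin_gen j \o (artin_gen i \o artin_gen j).
Proof.
move=> ji; have lj : ord_lo j = ord_hi i by apply: val_inj.
pose z := fg_gen (ord_hi j).
have E : lo j = hi i by rewrite lj.
have il : artin_gen j (lo i) = lo i.
  by apply: artin_gen_id; rewrite -val_eqE /= ji; elim: (i : nat).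
have ih : artin_gen i (hi j) = hi j.
  by apply: artin_gen_id; rewrite -val_eqE /= ji; elim: (i : nat).
have jl := artin_gen_lo j; have jh := artin_gen_hi j; rewrite E in jl jh.
have il' := artin_gen_lo i; have ih' := artin_gen_hi i.
have MV k := multiplicativeV (@artin_genM k).
apply: fg_hom_ext => [||k].
- by do 2?apply: multiplicative_comp; exact: artin_genM.
- by do 2?apply: multiplicative_comp; exact: artin_genM.
rewrite /comp.
have actE := (artin_genM, MV, il, ih, jl, jh, il', ih').
have [->|k1] := eqVneq k (ord_lo i); first by rewrite -/(lo i) !actE.
have [->|k2] := eqVneq k (ord_hi i); first by rewrite -/(hi i) !actE.
have [->|k3] := eqVneq k (ord_hi j).
  by rewrite -/(hi j) !actE !invgM !invgK !mulgA !mulgK.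
have k2' : k != ord_lo j by rewrite lj.
by rewrite !(artin_gen_id k1 k2, artin_gen_id k2' k3).
Qed.

Lemma artin_braid_far (i j : 'I_n.-1) : (i.+1 < j)%N || (j.+1 < i)%N ->
  artin_gen i \o artin_gen j =1 artin_gen j \o artin_gen i.
Proof.
move=> ij.
have D : [/\ ord_lo i != ord_lo j, ord_lo i != ord_hi j,
             ord_hi i != ord_lo j & ord_hi i != ord_hi j].
  by rewrite -!val_eqE /= !neq_ltn /= !ltnS; split; apply/orP;
    case/orP: ij => ij; [left|right|left|right|left|right|left|right]; lia.
case: D => D1 D2 D3 D4.
have MV k := multiplicativeV (@artin_genM k).
have il := artin_gen_lo i; have ih := artin_gen_hi i.
have jl := artin_gen_lo j; have jh := artin_gen_hi j.
have jil : artin_gen j (lo i) = lo i by exact: artin_gen_id.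
have jih : artin_gen j (hi i) = hi i by exact: artin_gen_id.
have ijl : artin_gen i (lo j) = lo j by apply: artin_gen_id; rewrite eq_sym.
have ijh : artin_gen i (hi j) = hi j by apply: artin_gen_id; rewrite eq_sym.
apply: fg_hom_ext => [||k].
- by apply: multiplicative_comp; exact: artin_genM.
- by apply: multiplicative_comp; exact: artin_genM.
rewrite /comp.
have actE := (artin_genM, MV, il, ih, jl, jh, jil, jih, ijl, ijh).
have [->|k1] := eqVneq k (ord_lo i); first by rewrite -/(lo i) !actE.
have [->|k2] := eqVneq k (ord_hi i); first by rewrite -/(hi i) !actE.
have [->|k3] := eqVneq k (ord_lo j); first by rewrite -/(lo j) !actE.
have [->|k4] := eqVneq k (ord_hi j); first by rewrite -/(hi j) !actE.
by rewrite !(artin_gen_id k1 k2, artin_gen_id k3 k4).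
Qed.

Lemma artin_word_cong v w :
  pres_cong (@braid_rel n) v w -> artin_word v =1 artin_word w.
Proof.
elim=> {v w} //.
- by move=> v w _ vw x; rewrite vw.
- by move=> u v w _ uv _ vw x; rewrite uv vw.
- move=> u v i b x; rewrite !artin_word_cat /=; congr (artin_word u _).
  by case: b => /=; rewrite (artin_genK, artin_gen_invK).
- move=> u v r s rs x; rewrite !artin_word_cat /=; congr (artin_word u _).
  by case: rs => i j /= ij; [exact: artin_braid3|exact: artin_braid_far].
Qed.

Lemma artin_classE w : artin (pres_class (@braid_rel n) w) =1 artin_word w.
Proof. exact/artin_word_cong/pres_repr. Qed.

Lemma artinM (a b : braid_group n) : artin (a * b)%g =1 artin a \o artin b.
Proof.
move=> x; rewrite -[a](pres_classK (rels := @braid_rel n)).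
rewrite -[b](pres_classK (rels := @braid_rel n)) [(_ * _)%g]pres_mulE /=.
by rewrite !artin_classE artin_word_cat.
Qed.

Lemma artin1 : artin (1%g : braid_group n) =1 id.
Proof. exact: artin_classE. Qed.

Lemma artin_multiplicative (a : braid_group n) : multiplicative_map (artin a).
Proof. exact: artin_wordM. Qed.

Lemma artin_br_gen (i : 'I_n.-1) :
  [/\ artin (br_gen i) (fg_gen (ord_lo i)) = fg_gen (ord_hi i),
      artin (br_gen i) (fg_gen (ord_hi i)) =
        ((fg_gen (ord_hi i))^-1 * fg_gen (ord_lo i) * fg_gen (ord_hi i))%g
    & forall j, j != ord_lo i -> j != ord_hi i ->
        artin (br_gen i) (fg_gen j) = fg_gen j].
Proof.
split=> [||j jl jh]; rewrite artin_classE /=.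
- exact: artin_gen_lo.
- exact: artin_gen_hi.
- exact: artin_gen_id.
Qed.

End Artin.

Section Ell2.
Variables (R : realType) (X : choiceType).
Local Notation C := R[i].

Definition sqnorm (f : X -> C) : \bar R :=
  (\esum_(x in [set: X]) (normc (f x) ^+ 2)%:E)%E.

Definition sq_summable : {pred X -> C} := fun f => (sqnorm f < +oo)%E.

Lemma sqnorm_ge0 f : (0 <= sqnorm f)%E.
Proof. by apply: esum_ge0 => x _; rewrite lee_fin sqr_ge0. Qed.

Lemma normc_sqE (z : C) : normc z ^+ 2 = complex.Re z ^+ 2 + complex.Im z ^+ 2.
Proof. by case: z => a b /=; rewrite sqr_sqrtr ?addr_ge0 ?sqr_ge0. Qed.

Lemma normc_sqD_le (z w : C) :
  normc (z + w) ^+ 2 <= 2 * (normc z ^+ 2 + normc w ^+ 2).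
Proof.
rewrite !normc_sqE; case: z w => a b [c d] /=.
by have := sqr_ge0 (a - c); have := sqr_ge0 (b - d); lra.
Qed.

Lemma esum_scale_le (c : R) (f : X -> \bar R) :
  0 <= c -> (forall x, 0 <= f x)%E ->
  (\esum_(x in [set: X]) (c%:E * f x) <= c%:E * \esum_(x in [set: X]) f x)%E.
Proof.
move=> c0 f0; apply: ge_ereal_sup => /= _ [A [finA _] <-].
rewrite -ge0_mule_fsumr //; apply: lee_wpmul2l; rewrite ?lee_fin //.
by apply: ereal_sup_ubound; exists A.
Qed.

Lemma sqnormZ_le a f : (sqnorm (a *: f)%R <= (normc a ^+ 2)%:E * sqnorm f)%E.
Proof.
apply: le_trans (esum_scale_le _ _); rewrite ?sqr_ge0 //; last first.
  by move=> x; rewrite lee_fin sqr_ge0.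
by apply: le_esum => x _; rewrite -EFinM lee_fin -exprMn -normcM.
Qed.

Lemma sqnormD_le f g : (sqnorm (f + g)%R <= 2%:E * (sqnorm f + sqnorm g))%E.
Proof.
rewrite /sqnorm -esumD => [|x _|x _]; try by rewrite lee_fin sqr_ge0.
apply: le_trans (esum_scale_le _ _) => // [|x]; last first.
  by rewrite -EFinD lee_fin addr_ge0 ?sqr_ge0.
apply: le_esum => x _; rewrite -EFinD -EFinM lee_fin.
exact: normc_sqD_le.
Qed.

Lemma sqnorm0 : sqnorm 0 = 0%E.
Proof. by apply: esum1 => x _; rewrite (_ : normc _ = 0) ?expr0n // normc0. Qed.

Lemma sq_summable_submod : submod_closed sq_summable.
Proof.
split=> [|a f g]; rewrite !unfold_in ?sqnorm0 // => ff gg.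
apply: le_lt_trans (sqnormD_le _ _) _; apply: lte_mul_pinfty => //.
apply: lte_add_pinfty => //; apply: le_lt_trans (sqnormZ_le _ _) _.
by apply: lte_mul_pinfty => //; rewrite lee_fin sqr_ge0.
Qed.

HB.instance Definition _ :=
  GRing.isSubmodClosed.Build C (X -> C) sq_summable sq_summable_submod.

Record ell2 := Ell2 { ell2_fun :> X -> C ; _ : ell2_fun \in sq_summable }.

HB.instance Definition _ := [isSub for ell2_fun].
HB.instance Definition _ := [Choice of ell2 by <:].
HB.instance Definition _ := [SubChoice_isSubLmodule of ell2 by <:].

(* The default value 0 is never used below for families that matter: see      *)
(* lregE, transE, sliceE, deform_unitaryE and covE.                           *)
Definition to_ell2 (f : X -> C) : ell2 := insubd 0 f.

Lemma to_ell2E f : f \in sq_summable -> to_ell2 f = f :> (X -> C).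
Proof. by move=> ff; rewrite /to_ell2 insubdK. Qed.

Lemma ell2P (xi eta : ell2) : xi =1 eta -> xi = eta.
Proof. by move=> xieta; apply: val_inj; exact/funext. Qed.

Definition l2norm (xi : ell2) : R := Num.sqrt (fine (sqnorm xi)).

(* Unordered sum of an absolutely summable family, as the difference of the   *)
(* sums of its positive and negative parts.                                   *)
Definition real_sum (f : X -> R) : R :=
  fine (\esum_(x in [set: X]) (Num.max (f x) 0)%:E)%E
  - fine (\esum_(x in [set: X]) (Num.max (- f x) 0)%:E)%E.

Definition complex_sum (f : X -> C) : C :=
  Complex (real_sum (fun x => complex.Re (f x)))
          (real_sum (fun x => complex.Im (f x))).

Definition inner (xi eta : ell2) : C := complex_sum (fun x => xi x * (eta x)^*%C).

End Ell2.

Section Operators.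
Variables (R : realType) (X : choiceType).
Local Notation H := (ell2 R X).
Local Notation op := (ell2 R X -> ell2 R X).
Implicit Types (A J M : set op) (S T U : op).

Definition bounded_op T : Prop :=
  linear T /\ exists c : R, forall xi : H, l2norm (T xi) <= c * l2norm xi.

(* The infimum is the operator norm as soon as T is bounded.                  *)
Definition opnorm T : R :=
  inf [set c : R | 0 <= c /\ forall xi : H, l2norm (T xi) <= c * l2norm xi].

Definition is_adjoint T S : Prop :=
  forall xi eta : H, inner (T xi) eta = inner xi (S eta).

Definition norm_closed A : Prop :=
  forall T, bounded_op T ->
    (forall e : R, 0 < e -> exists2 S, A S & opnorm (T - S) < e) -> A T.

Record cstar_algebra A : Prop := {
  cstar_bounded : A `<=` bounded_op ;
  cstar_zero : A 0 ;
  cstar_lin : forall (a : R[i]) S T, A S -> A T -> A (a *: S + T) ;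
  cstar_mul : forall S T, A S -> A T -> A (S \o T) ;
  cstar_adj : forall S T, A S -> bounded_op T -> is_adjoint S T -> A T ;
  cstar_closed : norm_closed A }.

Definition cstar_generated (G : set op) : set op := smallest cstar_algebra G.

Record closed_ideal A J : Prop := {
  ideal_sub : J `<=` A ;
  ideal_zero : J 0 ;
  ideal_lin : forall (a : R[i]) S T, J S -> J T -> J (a *: S + T) ;
  ideal_mull : forall S T, A S -> J T -> J (S \o T) ;
  ideal_mulr : forall S T, J S -> A T -> J (S \o T) ;
  ideal_closed : norm_closed J }.

Definition simple_cstar A : Prop :=
  forall J, closed_ideal A J -> J = [set 0] \/ J = A.

(* Only the restriction of phi to A is meaningful. All algebras considered    *)
(* contain the identity, so that a state is a positive functional with value  *)
(* 1 there.                                                                   *)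
Record tracial_state A (phi : op -> R[i]) : Prop := {
  state_lin : forall (a : R[i]) S T, A S -> A T ->
    phi (a *: S + T) = a * phi S + phi T ;
  state_pos : forall S T, A S -> A T -> is_adjoint S T -> 0 <= phi (T \o S) ;
  state_unit : phi idfun = 1 ;
  state_trace : forall S T, A S -> A T -> phi (S \o T) = phi (T \o S) }.

Definition unique_tracial_state A : Prop :=
  exists2 phi, tracial_state A phi &
    forall psi, tracial_state A psi -> forall T, A T -> psi T = phi T.

Definition commutant (G : set op) : set op :=
  [set T | bounded_op T /\ forall S, G S -> T \o S = S \o T].

Definition adjoints (G : set op) : set op :=
  [set T | bounded_op T /\ exists2 S, G S & is_adjoint S T].

(* A von Neumann algebra is a self-adjoint algebra equal to its bicommutant,  *)
(* and the one generated by G is the bicommutant of the *-closure of G.       *)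
Definition vn_generated (G : set op) : set op :=
  commutant (commutant (G `|` adjoints G)).

Definition factor M : Prop :=
  forall T, M T -> commutant M T -> exists c : R[i], T = c *: (idfun : op).

End Operators.

Section Regular.
Variables (R : realType) (F : groupType).

Definition lreg (x : F) (xi : ell2 R F) : ell2 R F :=
  to_ell2 (fun y => xi (x^-1 * y)%g).

Definition cstar_reduced : set (ell2 R F -> ell2 R F) :=
  cstar_generated (range lreg).

Definition vn_group : set (ell2 R F -> ell2 R F) := vn_generated (range lreg).

End Regular.

Arguments cstar_reduced : clear implicits.
Arguments vn_group : clear implicits.

Section CrossedProduct.
Variables (R : realType) (X : choiceType) (G : groupType).
Local Notation op := (ell2 R X -> ell2 R X).
Variable theta : G -> op -> op.

Definition slice (xi : ell2 R (G * X)%type) (g : G) : ell2 R X :=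
  to_ell2 (fun x => xi (g, x)).

(* The covariant pair on l^2(G, l^2(X)) = l^2(G x X):                         *)
(* (cov T xi)(g) = theta_(g^-1)(T) xi(g) and (trans g xi)(h) = xi(g^-1 h).    *)
Definition cov (T : op) (xi : ell2 R (G * X)%type) : ell2 R (G * X)%type :=
  to_ell2 (fun p => theta (p.1^-1)%g T (slice xi p.1) p.2).

Definition trans (g : G) (xi : ell2 R (G * X)%type) : ell2 R (G * X)%type :=
  to_ell2 (fun p => xi ((g^-1 * p.1)%g, p.2)).

Definition reduced_crossed_product (A : set op) :=
  cstar_generated (cov @` A `|` range trans).

Definition vn_crossed_product (M : set op) :=
  vn_generated (cov @` M `|` range trans).

End CrossedProduct.

Section Deformation.
Variables (R : realType) (G F : groupType) (act : G -> F -> F).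
Local Notation op := (ell2 R F -> ell2 R F).

Record cocycle (phi : G -> F -> R[i]) : Prop := {
  cocycle_circle : forall a x, `|phi a x| = 1 ;
  cocycle_mul : forall a b x, phi (a * b)%g x = phi a (act b x) * phi b x ;
  cocycle_hom : forall a x y, phi a (x * y)%g = phi a x * phi a y }.

Variable phi : G -> F -> R[i].

(* The unitary mapping the basis vector at x to phi a x times the one at      *)
(* act a x; these form a representation when phi is a cocycle. Conjugation by *)
(* it is the *-automorphism of all bounded operators which maps lreg x to     *)
(* phi a x *: lreg (act a x), see deformed_action_lreg; hence its             *)
(* restrictions to cstar_reduced and vn_group are the deformed actions.       *)
Definition deform_unitary (a : G) (xi : ell2 R F) : ell2 R F :=
  to_ell2 (fun x => phi a (act (a^-1)%g x) * xi (act (a^-1)%g x)).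

Definition deformed_action (a : G) (T : op) : op :=
  deform_unitary a \o T \o deform_unitary (a^-1)%g.

End Deformation.

Definition nontorsion (R : realType) (w : R[i]) : Prop :=
  forall m : int, m != 0 -> w ^ m != 1.

Section Formulas.
Variables (R : realType).
Local Notation C := R[i].

Lemma normc_norm (z : C) : `|z| = 1 -> normc z = 1.
Proof. by rewrite normc_def => -[]; case: z. Qed.

Lemma sqnorm_reindex (X Y : choiceType) (p : X -> Y) (w : X -> C) (f : Y -> C) :
    bijective p -> (forall x, normc (w x) = 1) ->
  sqnorm (fun x => w x * f (p x)) = sqnorm f.
Proof.
move=> pbij w1; rewrite /sqnorm [RHS](@reindex_esum _ _ _ setT setT p).
  by apply: eq_esum => x _; rewrite normcM w1 mul1r.
by rewrite setTT_bijective.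
Qed.

Lemma sq_summable_reindex (X Y : choiceType) (p : X -> Y) (w : X -> C)
    (xi : ell2 R Y) : bijective p -> (forall x, normc (w x) = 1) ->
  (fun x => w x * xi (p x)) \in @sq_summable R X.
Proof.
by move=> pbij w1; rewrite unfold_in /= sqnorm_reindex //; exact: valP xi.
Qed.

Lemma sq_summable_reindex1 (X Y : choiceType) (p : X -> Y) (xi : ell2 R Y) :
  bijective p -> (fun x => xi (p x)) \in @sq_summable R X.
Proof.
move=> pbij; have := sq_summable_reindex xi pbij (fun=> normc1 R).
by under eq_fun do rewrite mul1r.
Qed.

Lemma mulg_bij (G : groupType) (x : G) : bijective (fun y => x * y)%g.
Proof. by exists (fun y => x^-1 * y)%g => y; rewrite ?mulKg ?mulVKg. Qed.

Lemma lregE (F : groupType) (x : F) (xi : ell2 R F) y :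
  lreg x xi y = xi (x^-1 * y)%g.
Proof. by rewrite to_ell2E //; exact/sq_summable_reindex1/mulg_bij. Qed.

Lemma transE (X : choiceType) (G : groupType) (g : G) (xi : ell2 R (G * X)%type) p :
  trans g xi p = xi ((g^-1 * p.1)%g, p.2).
Proof.
rewrite to_ell2E //.
apply: (@sq_summable_reindex1 _ _ (fun p : G * X => ((g^-1 * p.1)%g, p.2))).
exists (fun p : G * X => ((g * p.1)%g, p.2)) => -[h x] /=.
  by rewrite mulVKg.
by rewrite mulKg.
Qed.

Lemma sqnormE (X : choiceType) (xi : ell2 R X) : sqnorm xi = (l2norm xi ^+ 2)%:E.
Proof.
have xi_fin : sqnorm xi \is a fin_num.
  by rewrite ge0_fin_numE ?sqnorm_ge0 //; exact: valP xi.
by rewrite sqr_sqrtr ?fine_ge0 ?sqnorm_ge0 // fineK.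
Qed.

Lemma sqnorm_pair (G X : choiceType) (f : G * X -> C) :
  sqnorm f = (\esum_(g in [set: G]) sqnorm (fun x => f (g, x)))%E.
Proof.
rewrite [RHS]esum_esum => [|g x _ _]; last by rewrite lee_fin sqr_ge0.
rewrite /sqnorm (_ : _ `*`` _ = setT); last by apply/seteqP; split.
by apply: eq_esum => -[].
Qed.

Lemma sliceE (X : choiceType) (G : groupType) (xi : ell2 R (G * X)%type) g x :
  slice xi g x = xi (g, x).
Proof.
rewrite to_ell2E // unfold_in.
apply: le_lt_trans (valP xi : (sqnorm xi < +oo)%E); rewrite sqnorm_pair.
apply: esum_ge; exists [set g]; first by split => //; exact: finite_set1.
by rewrite fsbig_set1.
Qed.

Section DeformedFormulas.
Variables (G F : groupType) (act : G -> F -> F) (phi : G -> F -> C).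
Hypothesis actM : forall a b x, act (a * b)%g x = act a (act b x).
Hypothesis act1 : forall x, act 1%g x = x.
Hypothesis act_mul : forall a x y, act a (x * y)%g = (act a x * act a y)%g.
Hypothesis phiP : cocycle act phi.

Lemma actKV a : cancel (act a^-1%g) (act a).
Proof. by move=> x; rewrite -actM mulgV act1. Qed.

Lemma actVK a : cancel (act a) (act a^-1%g).
Proof. by move=> x; rewrite -actM mulVg act1. Qed.

Lemma act_bij a : bijective (act a).
Proof. by exists (act a^-1%g); [exact: actVK|exact: actKV]. Qed.

Lemma cocycle_neq0 a x : phi a x != 0.
Proof. by rewrite -normr_eq0 (cocycle_circle phiP) oner_eq0. Qed.

Lemma cocycle1 x : phi 1%g x = 1.
Proof.
apply: (mulfI (cocycle_neq0 1%g x)); rewrite mulr1 -[in RHS](mulg1 1%g).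
by rewrite (cocycle_mul phiP) act1.
Qed.

Lemma cocycleV a x : phi (a^-1)%g (act a x) * phi a x = 1.
Proof. by rewrite -(cocycle_mul phiP) mulVg cocycle1. Qed.

Lemma cocycleV_conj a x : ((phi (a^-1)%g (act a x))^*)%C = phi a x.
Proof.
apply: (mulfI (cocycle_neq0 (a^-1)%g (act a x))); rewrite cocycleV.
by rewrite -sqr_normc (cocycle_circle phiP) expr1n.
Qed.

Lemma deform_unitaryE a xi x :
  deform_unitary act phi a xi x = phi a (act a^-1%g x) * xi (act a^-1%g x).
Proof.
rewrite to_ell2E //.
apply: (sq_summable_reindex _ (act_bij _)) => {}x.
exact/normc_norm/(cocycle_circle phiP).
Qed.

Lemma deform_unitaryM a b :
  deform_unitary act phi (a * b)%g =
  deform_unitary act phi a \o deform_unitary act phi b.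
Proof.
apply/funext => xi; apply: ell2P => x; rewrite /= !deform_unitaryE.
by rewrite (cocycle_mul phiP) invgM !actM actKV mulrA.
Qed.

Lemma deform_unitary1 : deform_unitary act phi 1%g = idfun.
Proof.
apply/funext => xi; apply: ell2P => x; rewrite /= deform_unitaryE.
by rewrite cocycle1 invg1 act1 mul1r.
Qed.

Lemma deform_unitary_sqnorm a xi :
  sqnorm (deform_unitary act phi a xi) = sqnorm xi.
Proof.
rewrite -(sqnorm_reindex (p := act a^-1%g)
  (w := fun x => phi a (act a^-1%g x)) xi (act_bij _)); last first.
  by move=> x; exact/normc_norm/(cocycle_circle phiP).
by congr sqnorm; apply/funext => x; exact: deform_unitaryE.
Qed.

Lemma real_sum_reindex (X Y : choiceType) (p : X -> Y) (f : Y -> R) :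
  bijective p -> real_sum (f \o p) = real_sum f.
Proof.
rewrite -setTT_bijective => pbij; rewrite /real_sum; congr (fine _ - fine _).
- by rewrite [RHS](@reindex_esum _ _ _ setT setT p).
- by rewrite [RHS](@reindex_esum _ _ _ setT setT p).
Qed.

Lemma complex_sum_reindex (X Y : choiceType) (p : X -> Y) (f : Y -> C) :
  bijective p -> complex_sum (f \o p) = complex_sum f.
Proof.
by move=> pbij; congr Complex; exact: (real_sum_reindex _ pbij).
Qed.

Lemma deform_unitary_adjoint a :
  is_adjoint (deform_unitary act phi a) (deform_unitary act phi (a^-1)%g).
Proof.
move=> xi eta; rewrite /inner -(complex_sum_reindex _ (act_bij a)).
congr complex_sum; apply/funext => x /=.
rewrite !deform_unitaryE actVK invgK -cocycleV_conj rmorphM /=.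
by rewrite [RHS]mulrA [xi x * _]mulrC.
Qed.

Lemma act_mulV a x : act a (x^-1)%g = (act a x)^-1%g.
Proof. exact: (multiplicativeV (act_mul a)). Qed.

Lemma deformed_action_lreg a x :
  deformed_action act phi a (lreg x) = phi a x *: lreg (act a x).
Proof.
apply/funext => xi; apply: ell2P => y.
rewrite /deformed_action /= deform_unitaryE lregE deform_unitaryE invgK.
transitivity (phi a x * lreg (act a x) xi y); last by [].
set z := act a^-1%g y; have -> : y = act a z by rewrite actKV.
have -> : phi a z = phi a x * phi a (x^-1 * z)%g.
  by rewrite -(cocycle_hom phiP) mulgA mulgV mul1g.
rewrite lregE -act_mulV -act_mul -mulrA; congr (_ * _).
by rewrite mulrA [X in X * _]mulrC cocycleV mul1r.
Qed.

Lemma covE (T : ell2 R F -> ell2 R F) (xi : ell2 R (G * F)%type) g x :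
  bounded_op T ->
  cov (deformed_action act phi) T xi (g, x) =
  deformed_action act phi g^-1%g T (slice xi g) x.
Proof.
case=> _ [c Tc]; rewrite to_ell2E //= unfold_in.
have sqT eta : (sqnorm (T eta) <= (c ^+ 2)%:E * sqnorm eta)%E.
  rewrite !sqnormE -EFinM lee_fin -exprMn lerXn2r ?nnegrE ?sqrtr_ge0 //.
  exact: le_trans (sqrtr_ge0 _) (Tc _).
apply: (@le_lt_trans _ _ ((c ^+ 2)%:E * sqnorm xi)%E); last first.
  apply: lte_mul_pinfty; rewrite ?lee_fin ?sqr_ge0 //; exact: valP xi.
rewrite !sqnorm_pair.
apply: le_trans (esum_scale_le _ _); rewrite ?sqr_ge0 //; last first.
  by move=> h; exact: sqnorm_ge0.
apply: le_esum => h _ /=.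
rewrite -(_ : sqnorm (slice xi h) = sqnorm (fun y => xi (h, y))); last first.
  by congr sqnorm; apply/funext => y; exact: sliceE.
apply: le_trans (_ : (sqnorm (deformed_action act phi h^-1%g T (slice xi h)) <= _)%E).
  by [].
by rewrite /deformed_action /= deform_unitary_sqnorm (le_trans (sqT _)) //
  deform_unitary_sqnorm.
Qed.

End DeformedFormulas.

End Formulas.

(* Main.v *)
(* Both crossed products act on l^2(B_n * F_n) and are generated by monomial  *)
(* unitaries W(x, b) that multiply like F_n x| B_n up to scalars. Since       *)
(* Artin's representation is faithful, the centralizer of F_n in F_n x| B_n   *)
(* is generated by the boundary word x_1 ... x_n times the full twist; the    *)
(* unitary of some nonzero power is central exactly when mu is torsion.       *)
(*   If mu is nontorsion, averaging over conjugates by powers of x_1, ..., x_n *)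
(* (Powers' argument: distinct conjugates of generators are in ping-pong      *)
(* position, so a sum of N such unitaries has norm O(sqrt N)) and then by     *)
(* powers of s_1 (a geometric sum) kills every coefficient but that of the    *)
(* identity; simplicity, uniqueness of the trace and factoriality follow.     *)
(*   If mu is torsion, a central unitary U of infinite order yields the ideal *)
(* (U - 1)A, the trace T |-> tau(T (1 + (U + U^-1) / 2)) besides the canonical *)
(* trace tau, and a nonscalar element of the center.                          *)

From mathcomp Require Import all_boot all_order all_algebra.
From mathcomp Require Import zify ring lra finmap.
From mathcomp Require Import complex boolp classical_sets functions cardinality.
From mathcomp Require Import fsbigop reals ereal esum.
Require Import Defs.

Set Implicit Arguments.
Unset Strict Implicit.
Unset Printing Implicit Defensive.

Import Order.TTheory GRing.Theory Num.Theory.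
Import ComplexField.Normc.

Local Open Scope classical_set_scope.
Local Open Scope ring_scope.

(** * Reduced words in free groups *)

(** Write x_1, ..., x_n for the free generators, w = x_1 ... x_n for the boundary word and tau for
    the coefficient at the identity. Both crossed products are generated by unitaries [W (y, b)]
    that multiply like the semidirect product of F_n by B_n up to scalars ([W_M]). Both lie in the
    commutant [rcomm] of right translations, so an operator in either is determined by its value at
    one basis vector ([rcomm_ext]). Everything depends on whether some nontrivial [W (y, b)] is
    central.

    On the group side, (y, b) centralizes F_n when b acts as x -> y^-1 x y. Every braid fixes w, so
    y commutes with w and is a power of it, because w belongs to a basis. By faithfulness of Artin's
    representation ([artin_faithful], by induction on the number of strands through
    [braid_combing]), b is then central in B_n, and b = 1 when y = 1 ([inner_artin]). The full twist
    realizes conjugation by w ([artin_full_twist]). The map a -> phi(a, w) is a character of B_n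
    with one value nu on all s_i, and mu = nu^(n-1) ([muE]). Hence conjugation by s_1 multiplies the
    unitary of a centralizing pair by a nonzero power of nu, and this factor is never 1 when mu is
    nontorsion ([nontorsion_center]); when mu is torsion, some power of w with the same power of the
    full twist stays central after the deformation ([torsion_center]).

    If mu is nontorsion, finite combinations of the [W q] with q not the identity can be averaged to
    zero in norm ([kill_offdiag]). Averaging over conjugates by powers of x_j makes [W q] small
    unless q commutes with x_j: the unitaries that appear are in ping-pong position ([lead_conj]),
    and a sum of N of them has norm O(sqrt N) ([powers_estimate]). What survives for all j is
    removed by averaging over powers of s_1, a geometric sum. Hence averages of any T in the reduced
    crossed product approach tau(T) 1 ([dixmier]). Ideals and tracial states respect averages, which
    gives simplicity and uniqueness of the trace; a central element of the von Neumann algebra is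
    fixed by them, which gives factoriality.

    If mu is torsion, the central unitary U has infinite order. The closure of (U - 1)A is a proper
    nonzero ideal, tau weighted by 1 + (U + U^-1)/2 is a second trace, and U is a nonscalar central
    element ([not_simple], [not_unique_trace], [not_factor]). *)

Section ReducedWords.
Variable n : nat.
Local Notation F := (free_group n).
Local Notation letter := ('I_n * bool)%type.
Local Notation cls := (@pres_class 'I_n (fun _ _ => False)).
Implicit Types (l : letter) (s t : seq letter) (x y u v : F) (j k : 'I_n).

Definition linv l : letter := (l.1, ~~ l.2).

Lemma linvK : involutive linv.
Proof. by move=> [i b]; rewrite /linv /= negbK. Qed.

Definition push l s : seq letter :=
  if s is l' :: s' then if l' == linv l then s' else l :: s else [:: l].

Definition reduce s := foldr push [::] s.

Definition reduced s := sorted (fun l l' => l' != linv l) s.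

Lemma reduced_behead l s : reduced (l :: s) -> reduced s.
Proof. by case: s => [|l' s] //= /andP[]. Qed.

Lemma push_reduced l s : reduced s -> reduced (push l s).
Proof.
case: s => [|l' s] // rs; rewrite /push; case: eqP => [_|/eqP ne].
  exact: reduced_behead rs.
by rewrite /reduced /= ne.
Qed.

(** Van der Waerden's argument: on reduced words each letter acts by a permutation inverted by the
    inverse letter, so [reduce] respects free cancellation and yields a normal form. *)
Lemma pushK l s : reduced s -> push l (push (linv l) s) = s.
Proof.
case: s => [|l' s] rs /=; first by rewrite eqxx.
rewrite linvK; case: eqP => [e|_]; last by rewrite /= eqxx.
case: s rs => [|l'' s] /=; first by rewrite e.
by case/andP; rewrite e => /negPf ->.
Qed.

Lemma reduce_reduced s : reduced (reduce s).
Proof. by elim: s => //= l s; apply: push_reduced. Qed.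

Lemma reduce_cat s t : reduce (s ++ t) = foldr push (reduce t) s.
Proof. exact: foldr_cat. Qed.

Lemma reduce_id s : reduced s -> reduce s = s.
Proof.
elim: s => //= l s IHs rs; rewrite IHs ?(reduced_behead rs) //.
by case: s rs {IHs} => //= l' s /andP[/negPf ->].
Qed.

Lemma reduce_cong s t : pres_cong (fun _ _ : word _ => False) s t ->
  reduce s = reduce t.
Proof.
elim=> {s t} // [s t u _ -> _ -> // | u v i b].
rewrite !reduce_cat; congr foldr; apply: (@pushK (i, b)).
exact: reduce_reduced.
Qed.

Definition nf x := reduce (repr x).

Lemma nfE s : nf (cls s) = reduce s.
Proof. by apply: reduce_cong; apply: pres_repr. Qed.

Lemma push_cong l s : pres_cong (fun _ _ : word _ => False) (push l s) (l :: s).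
Proof.
case: s => [|l' s] /=; first exact: pres_refl.
case: eqP => [->|_]; last exact: pres_refl.
by apply: pres_sym; case: l => i b; apply: (pres_cancel _ [::]).
Qed.

Lemma reduce_class s : cls (reduce s) = cls s.
Proof.
elim: s => //= l s /pres_classP IHs; apply/pres_classP.
exact: pres_trans (push_cong _ _) (pres_cong_catl [:: l] IHs).
Qed.

Lemma nfK x : cls (nf x) = x.
Proof. by rewrite /nf reduce_class pres_classK. Qed.

Lemma nf_reduced x : reduced (nf x).
Proof. exact: reduce_reduced. Qed.

Definition lgen l : F := if l.2 then fg_gen l.1 else ((fg_gen l.1)^-1)%g.

Lemma class_cons l s : cls (l :: s) = (lgen l * cls s)%g.
Proof.
case: l => i b; rewrite /lgen /=.
by case: b; rewrite ?[((fg_gen i)^-1)%g]pres_invE [RHS]pres_mulE.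
Qed.

Lemma class_nil : cls [::] = 1%g. Proof. by []. Qed.

Lemma class_cat s t : cls (s ++ t) = (cls s * cls t)%g.
Proof. by rewrite [RHS]pres_mulE. Qed.

Lemma class_rcons s l : cls (rcons s l) = (cls s * lgen l)%g.
Proof. by rewrite -cats1 class_cat class_cons class_nil mulg1. Qed.

Lemma nf_lgen_mul l v : nf (lgen l * v)%g = push l (nf v).
Proof.
by rewrite -{1}[v]nfK -class_cons nfE /= reduce_id // nf_reduced.
Qed.

Lemma nf_class_mul s v : reduced (s ++ nf v) -> nf (cls s * v)%g = s ++ nf v.
Proof. by move=> r; rewrite -{1}[v]nfK -class_cat nfE reduce_id. Qed.

Lemma reduced_rcons_cat s l t : reduced (rcons s l) ->
  (if t is l' :: _ then l' != linv l else true) -> reduced t ->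
  reduced (rcons s l ++ t).
Proof.
move=> rs; case: t => [|l' t] lt rt; first by rewrite cats0.
rewrite /reduced; case: s rs => [|l0 s] /=; first by rewrite lt.
by rewrite /reduced /= cat_path => ->; rewrite /= last_rcons lt.
Qed.

(** On a reduced word the initial letters of index [j] all have the same sign, so this is the
    exponent of the power of the j-th generator with which the word starts. *)
Fixpoint run j s : int :=
  if s is l :: s' then
    if l.1 == j then (if l.2 then 1 else -1) + run j s' else 0
  else 0.

Definition lead j x := run j (nf x).

Lemma lead_lgen b j v :
  lead j (lgen (j, b) * v)%g = (if b then 1 else -1) + lead j v.
Proof.
rewrite /lead nf_lgen_mul; case: (nf v) => [|[i c] s] /=; first by rewrite eqxx.
have [|ne] /= := eqVneq; last by rewrite eqxx.
by case=> -> ->; rewrite eqxx; case: b; rewrite /= ?addKr // addNKr.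
Qed.

Lemma lead_neq0 j v : lead j v != 0 -> exists b s, nf v = (j, b) :: s.
Proof.
rewrite /lead; case: (nf v) => [|[i b] s] //=.
by case: (i =P j) => [->|_]; [exists b, s|rewrite eqxx].
Qed.

Lemma run_cat j s t : ~~ all (fun l => l.1 == j) s -> run j (s ++ t) = run j s.
Proof. by elim: s => //= l s IHs; case: eqP => //= _ /IHs ->. Qed.

Lemma run_cat0 j s l t : l.1 != j -> run j (s ++ l :: t) = run j s.
Proof.
by move=> lj; elim: s => //= [|l' s ->] //; rewrite (negPf lj).
Qed.

(* Ping-pong: distinct conjugates of generators have axes that meet in a      *)
(* bounded set, so translating by u a word that starts with a nonzero power   *)
(* of the k-th generator determines how it leaves the axis of the j-th one.   *)
Lemma lead_conj j k u : (u * fg_gen k * u^-1)%g <> fg_gen j ->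
  exists s m : int, forall v, lead k v != s -> lead j (u * v)%g = m.
Proof.
have [s -> {u}] : exists2 s, u = cls s & reduced s.
  by exists (nf u); rewrite ?nfK ?nf_reduced.
elim/last_ind: s => [|s [a b] IHs] rs ne.
  exists 0, 0 => v /lead_neq0[b [t vE]].
  rewrite class_nil mul1g /lead vE /=.
  by case: eqP => // kj; case: ne; rewrite class_nil mul1g invg1 mulg1 kj.
(* A last letter of index [k] does not affect the conjugate of the k-th generator and only shifts
   [s], so it is stripped. *)
have [ak|ak] := eqVneq a k.
  have [] := IHs.
  - move: rs; rewrite /reduced; case: s {IHs ne} => //= l s.
    by rewrite rcons_path => /andP[].
  - move=> e; apply: ne; rewrite class_rcons -e ak /lgen /=.
    by case: b {rs}; rewrite !(invgM, mulgA, invgK, mulgV, mulVg, mulgK, mulgVK).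
  move=> s0 [m E]; exists (s0 - (if b then 1 else -1)), m => v lv.
  rewrite class_rcons -mulgA E // ak lead_lgen.
  by apply: contra_neq lv => <-; rewrite addrC addKr.
(* The word now ends in another letter, so nothing cancels against a [v] that starts with the k-th
   generator. The run of [j] stops at the last letter of the word or at the first letter of [v],
   hence depends on the word alone. *)
exists 0, (run j (rcons s (a, b))) => v /lead_neq0[c [t vE]].
rewrite /lead nf_class_mul vE; last first.
  apply: reduced_rcons_cat => //; last by rewrite -vE nf_reduced.
  by apply/eqP => -[/eqP]; rewrite eq_sym (negPf ak).
have [kj|kj] := eqVneq k j; last exact: run_cat0.
by apply: run_cat; rewrite all_rcons /= -kj (negPf ak).
Qed.

(** Trailing letters of index [j] are stripped from [v]. If a last letter of another index remains,
    it stops the leading run, so [lead j] does not change from [v] to [v * fg_gen j] but grows by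
    one from [v] to [fg_gen j * v]. *)
Lemma commute_gen j v : (v * fg_gen j = fg_gen j * v)%g ->
  exists m : nat, (v = fg_gen j ^+ m)%g \/ (v * fg_gen j ^+ m = 1)%g.
Proof.
have [s -> {v}] : exists2 s, v = cls s & reduced s.
  by exists (nf v); rewrite ?nfK ?nf_reduced.
elim/last_ind: s => [|s [a b] IHs] rs; first by exists 0%N; left.
have [->|aj] := eqVneq a j.
  move=> c; have [] := IHs.
  - move: rs; rewrite /reduced; case: s {IHs c} => //= l s.
    by rewrite rcons_path => /andP[].
  - have cb : (lgen (j, b) * fg_gen j = fg_gen j * lgen (j, b))%g.
      by rewrite /lgen /=; case: b {rs c}; rewrite // mulgV mulVg.
    apply: (@mulIg _ (lgen (j, b))); move: c; rewrite class_rcons => c.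
    by rewrite -[RHS]mulgA -c -!mulgA -cb.
  rewrite class_rcons {1 2}/lgen /=; case: b {rs c} => m [->|E].
  - by exists m.+1; left; rewrite expgSr.
  - case: m E => [|m] E; first by exists 1%N; left; move: E; rewrite mulg1 => ->; rewrite mul1g.
    by exists m; right; rewrite -mulgA -expgS.
  - case: m => [|m]; first by exists 1%N; right; rewrite mul1g mulVg.
    by exists m; left; rewrite expgSr mulgK.
  - by exists m.+1; right; rewrite expgS mulgA mulgVK.
move=> c; exfalso; have := congr1 (lead j) c.
rewrite -[X in _ = lead j (X * _)%g]/(lgen (j, true)) lead_lgen.
have s0 : ~~ all (fun l => l.1 == j) (rcons s (a, b)) by rewrite all_rcons /= (negPf aj).
rewrite /lead; have nx : nf (fg_gen j) = [:: (j, true)] by exact: nfE.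
rewrite nf_class_mul nx; last first.
  by apply: reduced_rcons_cat => //=; apply/eqP => -[/eqP]; rewrite eq_sym (negPf aj).
rewrite run_cat // nfE reduce_id // => /eqP.
by rewrite -subr_eq subrr eq_sym oner_eq0.
Qed.

End ReducedWords.

(** * Faithfulness of Artin's representation *)

Lemma pres_class_cons (I : choiceType) (rels : word I -> word I -> Prop) i b w :
  pres_class rels ((i, b) :: w) =
  ((if b then pres_gen rels i else (pres_gen rels i)^-1) * pres_class rels w)%g.
Proof.
by case: b; rewrite ?[((pres_gen rels i)^-1)%g]pres_invE [RHS]pres_mulE.
Qed.

Lemma pres_ind (I : choiceType) (rels : word I -> word I -> Prop)
    (P : presented rels -> Prop) :
  P 1%g -> (forall i x, P x -> P (pres_gen rels i * x)%g) ->
  (forall i x, P x -> P ((pres_gen rels i)^-1 * x)%g) -> forall x, P x.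
Proof.
move=> P1 Pg PV x; rewrite -[x]pres_classK.
elim: (repr x) => [|[i b] w IHw] //.
rewrite pres_class_cons.
by case: b; [exact: Pg|exact: PV].
Qed.

Section NatIndexed.
Variable n : nat.
Local Notation B := (braid_group n).
Local Notation F := (free_group n).

(** Indices out of range give 1, so that index arithmetic stays in the natural numbers and far
    commutation holds without an upper bound. *)
Definition sg k : B := if insub k is Some i then br_gen i else 1%g.
Definition xg k : F := if insub k is Some j then fg_gen j else 1%g.

Lemma sg_ord (i : 'I_n.-1) : sg i = br_gen i.
Proof. by rewrite /sg valK. Qed.

Lemma xg_ord (j : 'I_n) : xg j = fg_gen j.
Proof. by rewrite /xg valK. Qed.

Lemma sgE k (lt : (k < n.-1)%N) : sg k = br_gen (Ordinal lt).
Proof. by rewrite -sg_ord. Qed.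

Lemma sg_out k : (n.-1 <= k)%N -> sg k = 1%g.
Proof. by move=> nk; rewrite /sg insubF // ltnNge nk. Qed.

Lemma xg_out k : (n <= k)%N -> xg k = 1%g.
Proof. by move=> nk; rewrite /xg insubF // ltnNge nk. Qed.

Lemma sg_braid k : (k.+1 < n.-1)%N ->
  (sg k * sg k.+1 * sg k = sg k.+1 * sg k * sg k.+1)%g.
Proof.
move=> lt; have lt' := ltnW lt; rewrite !sgE.
have E a b c : (br_gen a * br_gen b * br_gen c)%g =
    pres_class (@braid_rel n) [:: (a, true); (b, true); (c, true)].
  by rewrite !pres_class_cons mulg1 mulgA.
rewrite !E; apply/pres_classP.
have := @braid_rel3 n (Ordinal lt') (Ordinal lt) erefl.
exact: (pres_base [::] [::]).
Qed.

Lemma sg_far i j : (i.+1 < j)%N -> (sg i * sg j = sg j * sg i)%g.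
Proof.
move=> ij; have [jn|/sg_out ->] := ltnP j n.-1; last by rewrite mulg1 mul1g.
have iN : (i < n.-1)%N by rewrite (ltn_trans _ jn) // (ltn_trans _ ij).
have E a b : (br_gen a * br_gen b)%g =
    pres_class (@braid_rel n) [:: (a, true); (b, true)].
  by rewrite !pres_class_cons mulg1.
rewrite !sgE !E; apply/pres_classP.
have : braid_rel [:: (Ordinal iN, true); (Ordinal jn, true)]
                 [:: (Ordinal jn, true); (Ordinal iN, true)].
  by apply: braid_rel_far; rewrite /= ij.
exact: (pres_base [::] [::]).
Qed.

Lemma artin_inj (a : B) : injective (artin a).
Proof. by move=> x y e; rewrite -[x](artin1 x) -[y](artin1 y) -(mulVg a) !artinM /= e. Qed.

Lemma artin1e (a : B) : artin a 1%g = 1%g.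
Proof. exact: multiplicative1 (@artin_multiplicative n a). Qed.

Lemma artinV (a : B) x : artin a x^-1%g = (artin a x)^-1%g.
Proof. exact: multiplicativeV (@artin_multiplicative n a) x. Qed.

Lemma artinMg (a : B) x y : artin a (x * y)%g = (artin a x * artin a y)%g.
Proof. exact: artin_multiplicative. Qed.

Lemma artinVK (a : B) x : artin a^-1%g (artin a x) = x.
Proof. by have := artinM a^-1%g a x; rewrite mulVg artin1 /= => <-. Qed.

Lemma artinKV (a : B) x : artin a (artin a^-1%g x) = x.
Proof. by have := artinM a a^-1%g x; rewrite mulgV artin1 /= => <-. Qed.

Lemma artin_sg_lo k : (k < n.-1)%N -> artin (sg k) (xg k) = xg k.+1.
Proof.
move=> lt; have [+ _ _] := artin_br_gen (Ordinal lt).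
by rewrite -sg_ord -!xg_ord.
Qed.

Lemma artin_sg_hi k : (k < n.-1)%N ->
  artin (sg k) (xg k.+1) = ((xg k.+1)^-1 * xg k * xg k.+1)%g.
Proof.
move=> lt; have [_ + _] := artin_br_gen (Ordinal lt).
by rewrite -sg_ord -!xg_ord.
Qed.

Lemma artin_sg_id k j : j != k -> j != k.+1 -> artin (sg k) (xg j) = xg j.
Proof.
move=> jk jk1; have [kn|/sg_out ->] := ltnP k n.-1; last by rewrite artin1.
have [jn|/xg_out ->] := ltnP j n; last by rewrite artin1e.
have [_ _ H] := artin_br_gen (Ordinal kn).
by rewrite sgE (_ : xg j = fg_gen (Ordinal jn)) ?H // -xg_ord.
Qed.

End NatIndexed.

(** * Combing: braids on one strand fewer, combs and coset representatives *)

Section BraidCombing.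
Variable p : nat.
Local Notation B := (braid_group p.+2).
Local Notation B' := (braid_group p.+1).
Local Notation F := (free_group p.+2).
Local Notation F' := (free_group p.+1).
Local Notation S := (@sg p.+2).
Local Notation X := (@xg p.+2).

Fixpoint strand_rec d : B :=
  if d is d'.+1 then (strand_rec d' * S (p - d'))%g else 1%g.

(* s_p ... s_k, moving the k-th strand to the last position. *)
Definition strand k := strand_rec (p.+1 - k).

Lemma strand_last : strand p.+1 = 1%g.
Proof. by rewrite /strand subnn. Qed.

Lemma strandS k : (k <= p)%N -> strand k = (strand k.+1 * S k)%g.
Proof. by move=> kp; rewrite /strand subSn // subSS /= subKn. Qed.

Lemma strand_ind (P : nat -> Prop) :
  P p.+1 -> (forall k, (k <= p)%N -> P k.+1 -> P k) ->
  forall k, (k <= p.+1)%N -> P k.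
Proof.
move=> P0 PS k; rewrite -(subKn (leqnSn p)) => kp.
have [d] : exists d, d = (p.+1 - k)%N by eexists.
elim: d k kp => [|d IHd] k kp dk; first by have -> : k = p.+1 by lia.
by apply: PS; [lia|apply: IHd; lia].
Qed.

Lemma sg_strand_low i k : (k <= p.+1)%N -> (i.+1 < k)%N ->
  (S i * strand k = strand k * S i)%g.
Proof.
move=> kp; move: k kp; apply: strand_ind => [|k kp IHk] ik.
  by rewrite strand_last mulg1 mul1g.
rewrite strandS // mulgA IHk; last by lia.
by rewrite -!mulgA sg_far.
Qed.

(** Once the k-th strand has been moved to the end, the strands above it have dropped one position;
    the shift of index comes from a single braid relation at [k = i]. *)
Lemma sg_strand_high i k : (i < p)%N -> (k <= i)%N ->
  (S i * strand k = strand k * S i.+1)%g.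
Proof.
move=> ip ki; have kp : (k <= p.+1)%N by lia.
move: k kp ki; apply: strand_ind => [|k kp IHk] ki; first by lia.
have [ik|ik] := eqVneq k i.
  rewrite ik (@strandS i) ?(@strandS i.+1) //; last by lia.
  rewrite !mulgA sg_strand_low // -!mulgA; congr (_ * _)%g.
  by rewrite !mulgA sg_braid.
rewrite strandS // mulgA IHk; last by lia.
by rewrite -!mulgA [in RHS]sg_far //; lia.
Qed.

(** The standard pure braid linking strand [k] with the last strand. Braids on the other strands
    conjugate the combs as Artin's representation moves free generators, see [sg_comb_hom]. *)
Definition comb k : B :=
  (strand k.+1 * (S k * S k) * (strand k.+1)^-1)%g.

Lemma comb_strand k : (k <= p)%N ->
  (comb k * strand k.+1 = strand k * S k)%g.
Proof. by move=> kp; rewrite /comb mulgVK (strandS kp) !mulgA. Qed.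

Lemma commute_conj (G : groupType) (s t x : G) : (s * t = t * s)%g ->
  (s * (t * x * t^-1) = t * (s * x) * t^-1)%g.
Proof. by move=> st; rewrite !mulgA st. Qed.

Lemma commute_conjr (G : groupType) (s t x : G) : (s * t = t * s)%g ->
  (t * x * t^-1 * s = t * (x * s) * t^-1)%g.
Proof.
by move=> st; apply: (canRL (mulgK _)); rewrite -!mulgA st mulKg.
Qed.

Lemma sg_comb_far i k : (k <= p)%N -> (i.+1 < k)%N ->
  (S i * comb k = comb k * S i)%g.
Proof.
move=> kp ik; have st : (S i * strand k.+1 = strand k.+1 * S i)%g.
  by apply: sg_strand_low; lia.
rewrite /comb commute_conj // commute_conjr //; congr (_ * _ * _)%g.
by rewrite mulgA sg_far // -!mulgA sg_far.
Qed.

Lemma sg_comb_near i k : (i < p)%N -> (k < i)%N ->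
  (S i * comb k = comb k * S i)%g.
Proof.
move=> ip ki; have st := sg_strand_high ip ki.
have st' : ((strand k.+1)^-1 * S i = S i.+1 * (strand k.+1)^-1)%g.
  by apply: (mulgI (strand k.+1)); rewrite mulVKg mulgA -st mulgK.
have c : (S k * S i.+1 = S i.+1 * S k)%g by apply: sg_far; lia.
rewrite /comb -[RHS]mulgA st' !mulgA st; congr (_ * _)%g.
by rewrite -!mulgA; congr (_ * _)%g; rewrite mulgA -c -mulgA -c.
Qed.

Section Adjacent.
Variable i : nat.
Hypothesis ip : (i < p)%N.
Let t := strand i.+2.

Lemma combE0 : comb i = (t * (S i.+1 * S i * S i * (S i.+1)^-1) * t^-1)%g.
Proof. by rewrite /comb strandS // invgM !mulgA. Qed.

Lemma sg_comb_lo : (S i * comb i = comb i.+1 * S i)%g.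
Proof.
have st : (S i * t = t * S i)%g by apply: sg_strand_low; lia.
have br : (S i * S i.+1 * S i = S i.+1 * S i * S i.+1)%g by apply: sg_braid; lia.
rewrite combE0 /comb -/t commute_conj // commute_conjr //.
congr (_ * _ * _)%g; rewrite !mulgA; apply: (mulIg (S i.+1)).
by rewrite mulgVK br -!mulgA; congr (_ * _)%g; rewrite !mulgA br.
Qed.

Lemma sg_comb_hi :
  (S i * comb i.+1 = (comb i.+1)^-1 * comb i * comb i.+1 * S i)%g.
Proof.
have st : (S i * t = t * S i)%g by apply: sg_strand_low; lia.
have br : (S i * S i.+1 * S i = S i.+1 * S i * S i.+1)%g by apply: sg_braid; lia.
have tM x y : (t * x * t^-1 * (t * y * t^-1) = t * (x * y) * t^-1)%g.
  by rewrite !mulgA mulgVK.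
have SE : S i = (t * S i * t^-1)%g by rewrite -st mulgK.
have E (c b s : B) : (c * (s * c) = b * (c * s) -> s * c = c^-1 * b * c * s)%g.
  by move=> e; apply: (mulgI c); rewrite e -!mulgA mulVKg.
apply: E; rewrite {1 2}SE combE0 /comb -/t !tM.
congr (_ * _ * _)%g; rewrite !mulgA mulgVK -!mulgA; congr (_ * _)%g.
by rewrite !mulgA -br -!mulgA; congr (_ * _)%g; rewrite !mulgA br.
Qed.

End Adjacent.

Local Notation S' := (@sg p.+1).
Local Notation X' := (@xg p.+1).

Definition comb_hom : F' -> B := fg_lift (fun j : 'I_p.+1 => comb j).

Lemma comb_homM : multiplicative_map comb_hom.
Proof. exact: fg_liftM. Qed.

Lemma comb_hom_gen j : (j <= p)%N -> comb_hom (X' j) = comb j.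
Proof.
by move=> jp; rewrite -[j]/(val (Ordinal (jp : (j < p.+1)%N))) xg_ord [LHS]fg_lift_gen.
Qed.

Definition braid_incl : B' -> B := pres_lift (fun i : 'I_p.+1.-1 => S i).

Lemma braid_incl_rel (r s : word 'I_p.+1.-1) : braid_rel r s ->
  word_eval (fun i : 'I_p.+1.-1 => S i) r = word_eval (fun i : 'I_p.+1.-1 => S i) s.
Proof.
case=> [i j ji|i j ij] /=; rewrite !mulg1.
  rewrite ji !mulgA sg_braid //=.
  by rewrite -ji; exact: leq_trans (ltn_ord j) (leqnSn _).
by case/orP: ij => /sg_far ->.
Qed.

Lemma braid_inclM : multiplicative_map braid_incl.
Proof. exact: (pres_liftM braid_incl_rel). Qed.

Lemma braid_incl_gen i : (i < p)%N -> braid_incl (S' i) = S i.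
Proof.
by move=> ip; rewrite (@sgE p.+1 _ ip); apply: (pres_lift_gen braid_incl_rel).
Qed.

Lemma sg_comb_hom i x : (i < p)%N ->
  (S i * comb_hom x = comb_hom (artin (S' i) x) * S i)%g.
Proof.
move=> ip; apply: (canRL (mulgVK _)); move: x; apply: fg_hom_ext.
- by move=> x y; rewrite comb_homM !mulgA mulgVK.
- by move=> x y /=; rewrite artinMg comb_homM.
move=> j; apply: (canLR (mulgK _)); rewrite -xg_ord.
have jp : (j <= p)%N by rewrite -ltnS ltn_ord.
have [->|ji] := eqVneq (j : nat) i.
  by rewrite artin_sg_lo ?comb_hom_gen ?sg_comb_lo //; lia.
have [->|ji1] := eqVneq (j : nat) i.+1.
  rewrite artin_sg_hi // !comb_homM (multiplicativeV comb_homM).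
  by rewrite !comb_hom_gen ?sg_comb_hi //; lia.
rewrite artin_sg_id // comb_hom_gen //.
by have [ij|ij] := ltnP i j; [rewrite sg_comb_far //; lia|rewrite sg_comb_near //; lia].
Qed.

Lemma braid_incl_comb a x :
  (braid_incl a * comb_hom x = comb_hom (artin a x) * braid_incl a)%g.
Proof.
move: x; move: a; apply: pres_ind => [|i a IHa|i a IHa] x.
- by rewrite artin1 (multiplicative1 braid_inclM) mul1g mulg1.
- rewrite -/(br_gen i) -sg_ord braid_inclM artinM /= -mulgA IHa.
  by rewrite braid_incl_gen // !mulgA sg_comb_hom.
- rewrite -/(br_gen i) -sg_ord braid_inclM artinM /= -mulgA IHa mulgA.
  rewrite (multiplicativeV braid_inclM) braid_incl_gen //.
  set y := artin a x; rewrite -{1}[y](artinKV (S' i)).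
  rewrite !mulgA; congr (_ * _)%g; apply: (mulgI (S i)).
  by rewrite mulVKg [RHS]mulgA sg_comb_hom // mulgK.
Qed.

Lemma strand_sg_cancel k : (k <= p)%N ->
  (strand k * (S k)^-1 = strand k.+1)%g.
Proof. by move=> kp; rewrite strandS // mulgK. Qed.

Lemma strand_sgV k : (k <= p)%N ->
  (strand k.+1 * (S k)^-1 = (comb k)^-1 * strand k)%g.
Proof.
move=> kp; apply: (canLR (mulgK _)); rewrite -mulgA -comb_strand //.
by rewrite mulKg.
Qed.

(** The products of this form contain 1 and are stable under right multiplication by generators and
    their inverses. A generator either slides through the strand factor to become one of the smaller
    braid group, or changes the index [k], possibly at the cost of a comb that is absorbed into
    [x]. *)
Lemma braid_combing (b : B) : exists x a k,
  (k <= p.+1)%N /\ b = (comb_hom x * braid_incl a * strand k)%g.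
Proof.
have mulS x a k i : (k <= p.+1)%N -> (i < p.+1)%N -> forall c : bool,
    exists x' a' k', (k' <= p.+1)%N /\
    (comb_hom x * braid_incl a * strand k * (if c then S i else (S i)^-1) =
     comb_hom x' * braid_incl a' * strand k')%g.
  move=> kp ip c.
  have commE j : (j < p)%N -> (S j * strand k = strand k * S i)%g ->
    exists x' a' k', (k' <= p.+1)%N /\
    (comb_hom x * braid_incl a * strand k * (if c then S i else (S i)^-1) =
     comb_hom x' * braid_incl a' * strand k')%g.
    move=> jp e; exists x, (a * (if c then S' j else (S' j)^-1))%g, k; split=> //.
    rewrite braid_inclM -!mulgA; congr (_ * (_ * _))%g.
    case: c; rewrite ?(multiplicativeV braid_inclM) braid_incl_gen //.
    by apply: (mulgI (S j)); rewrite mulVKg mulgA e mulgK.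
  have absE h : exists x' a', forall y,
     (comb_hom x * braid_incl a * (comb_hom h * y) =
      comb_hom x' * braid_incl a' * y)%g.
    exists (x * artin a h)%g, a => y.
    by rewrite comb_homM -!mulgA; congr (_ * _)%g; rewrite !mulgA braid_incl_comb.
  have [ik|ki] := ltnP i.+1 k.
    by apply: (commE i); rewrite ?sg_strand_low //; lia.
  have [ki'|ik] := ltnP k i.
    by case: i ip ki ki' commE => // i ip ki ki' commE; apply: (commE i); rewrite ?sg_strand_high //; lia.
  have [->|ne] := eqVneq k i.
    case: c {commE}.
      have [x' [a' E]] := absE (X' i).
      exists x', a', i.+1; split=> //.
      by rewrite -mulgA -comb_strand // -(comb_hom_gen (j := i)).
    exists x, a, i.+1; split=> //.
    by rewrite -mulgA strand_sg_cancel.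
  have -> : k = i.+1 by lia.
  case: c {commE}; last first.
    have [x' [a' E]] := absE (X' i)^-1%g.
    exists x', a', i; split; first by lia.
    by rewrite -mulgA strand_sgV // -E (multiplicativeV comb_homM) comb_hom_gen.
  by exists x, a, i; split; [lia|rewrite -mulgA -strandS].
(* The induction principle multiplies by generators on the left, so it is applied to the inverse of
   [b]. *)
have : exists x a k, (k <= p.+1)%N /\ (b^-1)^-1%g = (comb_hom x * braid_incl a * strand k)%g.
  move: (b^-1)%g; apply: pres_ind => [|i y|i y].
  - exists 1%g, 1%g, p.+1; split=> //.
    by rewrite strand_last invg1 (multiplicative1 comb_homM) (multiplicative1 braid_inclM) !mulg1.
  - move=> [x [a [k [kp E]]]].
    have [x' [a' [k' [kp' E']]]] := mulS x a k i kp (ltn_ord i) false.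
    exists x', a', k'; split=> //.
    by rewrite -E' -E -/(br_gen i) -sg_ord invgM.
  - move=> [x [a [k [kp E]]]].
    have [x' [a' [k' [kp' E']]]] := mulS x a k i kp (ltn_ord i) true.
    exists x', a', k'; split=> //.
    by rewrite -E' -E -/(br_gen i) -sg_ord invgM invgK.
by rewrite invgK.
Qed.

Local Notation last := (X p.+1).

Lemma artin_strand_first k : (k <= p.+1)%N -> artin (strand k) (X k) = last.
Proof.
move: k; apply: strand_ind => [|k kp IHk]; first by rewrite strand_last artin1.
by rewrite strandS // artinM /= artin_sg_lo.
Qed.

Lemma artin_strand_low k i : (k <= p.+1)%N -> (i < k)%N ->
  artin (strand k) (X i) = X i.
Proof.
move=> kp; move: k kp; apply: strand_ind => [|k kp IHk] ik.
  by rewrite strand_last artin1.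
by rewrite strandS // artinM /= artin_sg_id ?IHk //; lia.
Qed.

Definition drop_last : F -> F' := fg_lift (fun j : 'I_p.+2 => X' j).

Lemma drop_lastM : multiplicative_map drop_last.
Proof. exact: fg_liftM. Qed.

Lemma drop_last_gen j : (j <= p.+1)%N -> drop_last (X j) = X' j.
Proof.
by move=> jp; rewrite -[j]/(val (Ordinal (jp : (j < p.+2)%N))) xg_ord [LHS]fg_lift_gen.
Qed.

Lemma drop_last_last : drop_last last = 1%g.
Proof. by rewrite drop_last_gen // xg_out. Qed.

(** The action of [b] remembers [x] as the conjugator of the last generator, read after that
    generator is killed. The relation is compatible with products and inverses, so it passes from
    the combs to [comb_hom x]. *)
Definition pushes_last (b : B) (x : F') :=
  (forall y, drop_last (artin b y) = drop_last y) /\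
  exists2 y, artin b last = (y^-1 * last * y)%g & drop_last y = x.

Lemma pushes_lastM b c x y : pushes_last b x -> pushes_last c y ->
  pushes_last (b * c)%g (x * y)%g.
Proof.
move=> [qb [u bu <-]] [qc [v cv <-]]; split=> [z|].
  by rewrite artinM /= qb qc.
exists (u * artin b v)%g; last by rewrite drop_lastM qb.
by rewrite artinM /= cv !artinMg artinV bu invgM !mulgA.
Qed.

Lemma pushes_lastV b x : pushes_last b x -> pushes_last b^-1%g x^-1%g.
Proof.
move=> [qb [u bu <-]].
have qV z : drop_last (artin b^-1%g z) = drop_last z.
  by rewrite -[in RHS](artinKV b z) qb.
split=> //; exists (artin b^-1%g u^-1%g).
  apply: (@artin_inj _ b); rewrite !artinMg !artinV !artinKV bu.
  by rewrite !mulgA invgK mulgV mul1g mulgK.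
by rewrite qV (multiplicativeV drop_lastM).
Qed.

Lemma pushes_last_comb k : (k <= p)%N -> pushes_last (comb k) (X' k).
Proof.
move=> kp; have kp1 : (k.+1 <= p.+1)%N by [].
have SS1 : artin (S k * S k)%g (X k.+1) =
    ((X k * X k.+1)^-1 * X k.+1 * (X k * X k.+1))%g.
  rewrite artinM /= artin_sg_hi // !artinMg artinV artin_sg_lo // artin_sg_hi //.
  by rewrite !invgM !invgK !mulgA mulgK.
have SS0 : artin (S k * S k)%g (X k) = ((X k.+1)^-1 * X k * X k.+1)%g.
  by rewrite artinM /= artin_sg_lo // artin_sg_hi.
split; last first.
  exists (X k * last)%g; last by rewrite drop_lastM drop_last_last mulg1 drop_last_gen //; lia.
  rewrite /comb artinM /= artinM /= -{1}(artin_strand_first kp1) artinVK SS1.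
  by rewrite !artinMg artinV !artinMg artin_strand_first // artin_strand_low.
pose q y := drop_last (artin (strand k.+1) y).
have qM : multiplicative_map q.
  by move=> y z; rewrite /q artinMg drop_lastM.
have q0 : q (X k.+1) = 1%g by rewrite /q artin_strand_first // drop_last_last.
have qSS : q \o artin (S k * S k)%g =1 q.
  apply: fg_hom_ext => //; first by move=> y z; rewrite [LHS]/= artinMg qM.
  move=> j; rewrite -xg_ord /=.
  have [->|jk] := eqVneq (j : nat) k.
    by rewrite SS0 !qM (multiplicativeV qM) q0 invg1 mul1g mulg1.
  have [->|jk1] := eqVneq (j : nat) k.+1.
    by rewrite SS1 !qM (multiplicativeV qM) !qM q0 !mulg1 mulVg.
  by rewrite artinM /= !artin_sg_id.
move=> y; rewrite /comb artinM /= artinM /=.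
by rewrite -/(q _) [LHS]qSS /q artinKV.
Qed.

Lemma pushes_last_comb_hom x : pushes_last (comb_hom x) x.
Proof.
have gP (i : 'I_p.+1) : pushes_last (comb_hom (fg_gen i)) (fg_gen i).
  rewrite -xg_ord comb_hom_gen; last by rewrite -ltnS ltn_ord.
  by apply: pushes_last_comb; rewrite -ltnS ltn_ord.
move: x; apply: pres_ind => [|i x IHx|i x IHx].
- rewrite (multiplicative1 comb_homM); split=> [y|]; first by rewrite artin1.
  by exists 1%g; rewrite ?(multiplicative1 drop_lastM) // artin1 invg1 mul1g mulg1.
- by have := pushes_lastM (gP i) IHx; rewrite -comb_homM.
- have := pushes_lastM (pushes_lastV (gP i)) IHx.
  by rewrite -(multiplicativeV comb_homM) -comb_homM.
Qed.

Definition free_incl : F' -> F := fg_lift (fun j : 'I_p.+1 => X j).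

Lemma free_inclM : multiplicative_map free_incl.
Proof. exact: fg_liftM. Qed.

Lemma free_incl_gen j : (j <= p)%N -> free_incl (X' j) = X j.
Proof.
by move=> jp; rewrite -[j]/(val (Ordinal (jp : (j < p.+1)%N))) xg_ord [LHS]fg_lift_gen.
Qed.

Lemma free_inclK : cancel free_incl drop_last.
Proof.
apply: fg_hom_ext => // [x y|j] /=; first by rewrite free_inclM drop_lastM.
have jp : (j <= p)%N by rewrite -ltnS ltn_ord.
by rewrite -xg_ord free_incl_gen // drop_last_gen // leqW.
Qed.

Lemma artin_braid_incl a x : artin (braid_incl a) (free_incl x) = free_incl (artin a x).
Proof.
have gP (i : 'I_p) x0 : artin (S i) (free_incl x0) = free_incl (artin (S' i) x0).
  move: x0; have ip := ltn_ord i; apply: fg_hom_ext => [x0 y0|x0 y0|j] /=.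
  - by rewrite free_inclM artinMg.
  - by rewrite artinMg free_inclM.
  have jp : (j <= p)%N by rewrite -ltnS ltn_ord.
  rewrite -xg_ord free_incl_gen //.
  have [->|ji] := eqVneq (j : nat) i.
    by rewrite !artin_sg_lo ?free_incl_gen //=; lia.
  have [->|ji1] := eqVneq (j : nat) i.+1.
    rewrite !artin_sg_hi //=; last by lia.
    by rewrite !free_inclM (multiplicativeV free_inclM) !free_incl_gen //; lia.
  by rewrite !artin_sg_id // free_incl_gen.
move: x; move: a; apply: pres_ind => [|i a IHa|i a IHa] x.
- by rewrite (multiplicative1 braid_inclM) !artin1.
- rewrite -/(br_gen i) -sg_ord braid_inclM !artinM /= IHa.
  by rewrite braid_incl_gen // gP.
- rewrite -/(br_gen i) -sg_ord braid_inclM !artinM /= IHa (multiplicativeV braid_inclM).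
  by rewrite braid_incl_gen //; apply: (@artin_inj _ (S i)); rewrite artinKV gP artinKV.
Qed.

Lemma artin_braid_incl_last a : artin (braid_incl a) last = last.
Proof.
have gP (i : 'I_p) : artin (S i) last = last.
  by have ip := ltn_ord i; rewrite artin_sg_id //; lia.
move: a; apply: pres_ind => [|i a IHa|i a IHa].
- by rewrite (multiplicative1 braid_inclM) artin1.
- by rewrite -/(br_gen i) -sg_ord braid_inclM artinM /= IHa braid_incl_gen // gP.
- rewrite -/(br_gen i) -sg_ord braid_inclM artinM /= IHa (multiplicativeV braid_inclM).
  by rewrite braid_incl_gen // -[in LHS](gP i) artinVK.
Qed.

Lemma xg_neq1 j : (j <= p)%N -> X' j <> 1%g.
Proof.
move=> jp; rewrite -[j]/(val (Ordinal (jp : (j < p.+1)%N))) xg_ord.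
by move/(congr1 (@nf _)); rewrite -class_nil !nfE.
Qed.

(** Comb a braid that acts trivially. It sends the k-th generator to a conjugate of the last one,
    and killing the last generator forces the strand factor to be trivial. The conjugator then
    commutes with the last generator, hence is a power of it, so [x] is trivial. What remains is a
    braid on one strand fewer that acts trivially. *)
Lemma artin_faithful_step : (forall a : B', artin a =1 id -> a = 1%g) ->
  forall b : B, artin b =1 id -> b = 1%g.
Proof.
move=> IH b; have [x [a [k [kp ->]]]] := braid_combing b => b1.
have [qx [y xy yx]] := pushes_last_comb_hom x.
have := b1 (X k); rewrite artinM /= artin_strand_first // artinM /=.
rewrite artin_braid_incl_last xy => E.
have kE : k = p.+1.
  apply/eqP; rewrite eqn_leq kp leqNgt /=; apply/negP => kp'.
  apply: (xg_neq1 (j := k)) => //; rewrite -drop_last_gen // -E.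
  by rewrite !drop_lastM drop_last_last mulg1 (multiplicativeV drop_lastM) mulVg.
have x1 : x = 1%g.
  have := @commute_gen _ (@ord_max p.+1) y.
  move: E; rewrite kE -xg_ord /= => E; case.
    by rewrite -{1}E !mulgA mulgV mul1g.
  move=> m []; first by move=> yE; rewrite -yx yE; elim: m {yE} => [|m IHm];
     rewrite ?(multiplicative1 drop_lastM) // expgS drop_lastM drop_last_last mul1g.
  move/(congr1 drop_last); rewrite drop_lastM yx (multiplicative1 drop_lastM).
  by elim: m => [|m IHm]; rewrite ?(multiplicative1 drop_lastM) ?mulg1 // expgS drop_lastM drop_last_last mul1g.
move: b1; rewrite x1 kE strand_last (multiplicative1 comb_homM) mul1g mulg1 => b1.
rewrite (IH a) ?(multiplicative1 braid_inclM) // => z.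
by rewrite -[LHS]free_inclK -artin_braid_incl b1 free_inclK.
Qed.

End BraidCombing.

Lemma artin_faithful n (a : braid_group n) : artin a =1 id -> a = 1%g.
Proof.
case: n a => [|p] a; first by move=> _; move: a; apply: pres_ind => // -[].
elim: p a => [|p IHp] a; first by move=> _; move: a; apply: pres_ind => // -[].
exact: artin_faithful_step.
Qed.

(** * The full twist and the deformation parameter *)

Section FullTwist.
Variable n : nat.
Hypothesis n2 : (2 <= n)%N.
Local Notation B := (braid_group n).
Local Notation F := (free_group n).
Local Notation S := (@sg n).
Local Notation X := (@xg n).

Definition xprod m : F := \big[*%g/1%g]_(0 <= k < m) X k.
Definition boundary : F := xprod n.

Lemma xprod0 : xprod 0 = 1%g. Proof. by rewrite /xprod big_nil. Qed.

Lemma xprodS m : xprod m.+1 = (xprod m * X m)%g.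
Proof. by rewrite /xprod big_nat_recr. Qed.

Lemma artin_sg_boundary i : (i < n.-1)%N -> artin (S i) boundary = boundary.
Proof.
move=> ilt.
have low m : (m <= i)%N -> artin (S i) (xprod m) = xprod m.
  elim: m => [|m IHm] mi; first by rewrite xprod0 artin1e.
  by rewrite xprodS artinMg IHm ?artin_sg_id //; lia.
have high d : artin (S i) (xprod (i.+2 + d)) = xprod (i.+2 + d).
  elim: d => [|d IHd]; last by rewrite addnS xprodS artinMg IHd artin_sg_id //; lia.
  rewrite addn0 !xprodS !artinMg low // artin_sg_lo // artin_sg_hi //.
  by rewrite !mulgA mulgK.
by have := high (n - i.+2)%N; rewrite subnKC //; lia.
Qed.

Lemma artin_boundary (b : B) : artin b boundary = boundary.
Proof.
move: b; apply: pres_ind => [|i b IHb|i b IHb]; first by rewrite artin1.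
  by rewrite artinM /= IHb -/(br_gen i) -sg_ord artin_sg_boundary.
rewrite artinM /= IHb -/(br_gen i) -sg_ord.
by rewrite -[in LHS](@artin_sg_boundary i) // artinVK.
Qed.

Lemma multiplicativeX (G H : groupType) (f : G -> H) : multiplicative_map f ->
  forall x m, f (x ^+ m)%g = (f x ^+ m)%g.
Proof.
move=> fM x; elim=> [|m IHm]; first exact: multiplicative1.
by rewrite !expgS fM IHm.
Qed.

Lemma artinX (b : B) x m : artin b (x ^+ m)%g = (artin b x ^+ m)%g.
Proof. exact: multiplicativeX (@artin_multiplicative n b) x m. Qed.

Lemma free_lift_xg (H : groupType) (g : nat -> H) j : (j < n)%N ->
  fg_lift (fun j : 'I_n => g j) (X j) = g j.
Proof.
by move=> jn; rewrite -[j]/(val (Ordinal jn)) xg_ord [LHS]fg_lift_gen.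
Qed.

(* The boundary word belongs to a basis: replace the first generator by it.   *)
Lemma commute_boundary v : (v * boundary = boundary * v)%g ->
  exists m : nat, (v = boundary ^+ m)%g \/ (v * boundary ^+ m = 1)%g.
Proof.
pose tl m : F := \big[*%g/1%g]_(1 <= k < m) X k.
have wE m : (0 < m)%N -> xprod m = (X 0 * tl m)%g.
  by move=> m0; rewrite /xprod big_ltn.
(* The map [f] sends the first generator to the boundary word, and its right inverse [g] sends the
   boundary word back; this reduces the claim to [commute_gen]. *)
pose f : F -> F := fg_lift (fun j : 'I_n => if (j : nat) == 0%N then boundary else X j).
pose g : F -> F := fg_lift (fun j : 'I_n => if (j : nat) == 0%N then (X 0 * (tl n)^-1)%g else X j).
have fM : multiplicative_map f by exact: fg_liftM.
have gM : multiplicative_map g by exact: fg_liftM.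
have fX j : (j < n)%N -> f (X j) = if j == 0%N then boundary else X j.
  exact: (free_lift_xg (fun j => if j == 0%N then boundary else X j)).
have gX j : (j < n)%N -> g (X j) = if j == 0%N then (X 0 * (tl n)^-1)%g else X j.
  exact: (free_lift_xg (fun j => if j == 0%N then (X 0 * (tl n)^-1)%g else X j)).
have tlfix (h : F -> F) : multiplicative_map h ->
    (forall j, (0 < j < n)%N -> h (X j) = X j) -> h (tl n) = tl n.
  move=> hM hX; rewrite /tl (big_morph h hM (multiplicative1 hM)).
  by apply: eq_big_nat.
have ftl : f (tl n) = tl n by apply: tlfix => // j /andP[j0 jn]; rewrite fX // gtn_eqF.
have gtl : g (tl n) = tl n by apply: tlfix => // j /andP[j0 jn]; rewrite gX // gtn_eqF.
have n0 : (0 < n)%N by lia.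
have fgK : f \o g =1 id.
  apply: fg_hom_ext => // [x y|j] /=; first by rewrite gM fM.
  rewrite -xg_ord gX //; case: eqP => [j0|/eqP j0]; last by rewrite fX // (negPf j0).
  by rewrite fM (multiplicativeV fM) ftl fX //= /boundary wE // mulgK j0.
have gw : g boundary = X 0 by rewrite /boundary wE // gM gtl gX //= mulgVK.
move=> c; have := @commute_gen n (Ordinal n0) (g v).
rewrite -xg_ord /= -gw -!gM c => /(_ erefl)[m E]; exists m.
case: E => E; [left|right].
  rewrite -[LHS]fgK /= E (multiplicativeX fM); congr (_ ^+ _)%g; exact: fgK.
by rewrite -[LHS]fgK /= gM (multiplicativeX gM) E (multiplicative1 fM).
Qed.

Definition sprod m : B := \big[*%g/1%g]_(0 <= k < m) S k.

Lemma sprodS m : sprod m.+1 = (sprod m * S m)%g.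
Proof. by rewrite /sprod big_nat_recr. Qed.

Lemma artin_sprod_high m i : (m < i)%N -> artin (sprod m) (X i) = X i.
Proof.
elim: m => [|m IHm] mi; first by rewrite /sprod big_nil artin1.
by rewrite sprodS artinM /= artin_sg_id ?IHm //; lia.
Qed.

Lemma artin_sprod_low m i : (m <= n.-1)%N -> (i < m)%N -> artin (sprod m) (X i) = X i.+1.
Proof.
elim: m => [|m IHm] // mn im; rewrite sprodS artinM /=.
have [->|ne] := eqVneq i m; first by rewrite artin_sg_lo // artin_sprod_high.
by rewrite artin_sg_id ?IHm //; lia.
Qed.

Lemma artin_sprod_eq m : (m <= n.-1)%N ->
  artin (sprod m) (X m) = ((xprod m.+1)^-1 * X 0 * xprod m.+1)%g.
Proof.
elim: m => [|m IHm] mn.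
  by rewrite /sprod big_nil artin1 xprodS xprod0 mul1g mulVg mul1g.
rewrite sprodS artinM /= artin_sg_hi // !artinMg artinV artin_sprod_high // IHm; last by lia.
by rewrite [xprod m.+2]xprodS invgM !mulgA.
Qed.

Definition rotation : B := sprod n.-1.
Definition full_twist : B := (rotation ^+ n)%g.

Lemma artin_rotation_pow i : (i < n)%N -> artin (rotation ^+ i)%g (X 0) = X i.
Proof.
elim: i => [|i IHi] ilt; first by rewrite artin1.
by rewrite expgS artinM /= IHi ?artin_sprod_low //; lia.
Qed.

(** Powers of the rotation carry the first generator to all the others and commute with the full
    twist, so one value suffices: after [n.-1] rotations the first generator has become the last
    one, and one more brings it back conjugated by the boundary word. *)
Lemma artin_full_twist x :
  artin full_twist x = (boundary^-1 * x * boundary)%g.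
Proof.
move: x; apply: fg_hom_ext => [x y|x y|j] /=; first exact: artinMg.
  by rewrite !mulgA mulgK.
rewrite -xg_ord -artin_rotation_pow // -[LHS]artinM.
have c : (full_twist * rotation ^+ j = rotation ^+ j * full_twist)%g.
  by rewrite /full_twist -!expgnDr addnC.
have tE : full_twist = (rotation * rotation ^+ n.-1)%g.
  by rewrite -expgS prednK // ltnW.
rewrite c artinM /= tE artinM /=.
rewrite artin_rotation_pow; last by lia.
rewrite artin_sprod_eq // (prednK (ltnW n2)) -/boundary.
by rewrite !artinMg artinV artin_boundary.
Qed.

Lemma artin_full_twistX m x :
  artin (full_twist ^+ m)%g x = ((boundary ^+ m)^-1 * x * boundary ^+ m)%g.
Proof.
elim: m x => [|m IHm] x; first by rewrite artin1 invg1 mul1g mulg1.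
rewrite expgSr artinM /= artin_full_twist IHm (expgS boundary) invgM.
by rewrite !mulgA.
Qed.

Lemma artin_ext (a b : B) : artin a =1 artin b -> a = b.
Proof.
move=> ab; apply: (mulgI (b^-1)%g); rewrite mulVg; apply: artin_faithful => x.
by rewrite artinM /= ab artinVK.
Qed.

(* The centralizer of the free group in the semidirect product is cyclic.     *)
Lemma inner_artin (y : F) (a : B) :
    (forall j, y * artin a (X j) * y^-1 = X j)%g ->
  [/\ exists m : nat, (y = boundary ^+ m)%g \/ (y * boundary ^+ m = 1)%g,
      forall b : B, (b * a = a * b)%g & y = 1%g -> a = 1%g].
Proof.
move=> H.
have H' x : artin a x = (y^-1 * x * y)%g.
  move: x; apply: fg_hom_ext => [x x'|x x'|j]; first exact: artinMg.
    by rewrite !mulgA mulgK.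
  by rewrite -xg_ord -{2}H !mulgA mulVg mul1g mulgVK.
have yw : (y * boundary = boundary * y)%g.
  by have := H' boundary; rewrite artin_boundary => {1}->; rewrite !mulgA mulgV mul1g.
have [m ym] := commute_boundary yw; split; first by exists m.
  move=> b; have by_ : artin b y = y.
    case: ym => [->|ym]; first by rewrite artinX artin_boundary.
    apply: (mulIg (boundary ^+ m)%g).
    by rewrite -{1}[boundary](artin_boundary b) -artinX -artinMg ym artin1e.
  apply: artin_ext => x; rewrite !artinM /= !H' !artinMg artinV by_.
  by [].
by move=> y1; apply: artin_faithful => x; rewrite H' y1 invg1 mul1g mulg1.
Qed.

Variables (R : realType) (phi : B -> F -> R[i]).
Hypothesis phiP : cocycle (@artin n) phi.

Lemma phi_neq0 a x : phi a x != 0.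
Proof. by rewrite -normr_eq0 (cocycle_circle phiP) oner_eq0. Qed.

Lemma phi_x1 a : phi a 1%g = 1.
Proof. by apply: (mulfI (phi_neq0 a 1%g)); rewrite -(cocycle_hom phiP) mulg1 mulr1. Qed.

Lemma phi_1x x : phi 1%g x = 1.
Proof.
by apply: (mulfI (phi_neq0 1%g x)); rewrite mulr1 -{1}(artin1 x) -(cocycle_mul phiP) mulg1.
Qed.

Lemma phi_conj a x y : phi a (y^-1 * x * y)%g = phi a x.
Proof.
by rewrite !(cocycle_hom phiP) mulrAC -(cocycle_hom phiP) mulVg phi_x1 mul1r.
Qed.

Lemma phiX a x m : phi a (x ^+ m)%g = phi a x ^+ m.
Proof. by elim: m => [|m IHm]; rewrite ?phi_x1 // expgS (cocycle_hom phiP) IHm exprS. Qed.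

Lemma phi_boundaryM a b : phi (a * b)%g boundary = phi a boundary * phi b boundary.
Proof. by rewrite (cocycle_mul phiP) artin_boundary. Qed.

Lemma phi_boundaryX a m : phi (a ^+ m)%g boundary = phi a boundary ^+ m.
Proof.
by elim: m => [|m IHm]; rewrite ?phi_1x // expgS phi_boundaryM IHm exprS.
Qed.

Definition nu := phi (S 0) boundary.

(** Every braid fixes the boundary word, so the cocycle at it is a character of the braid group; the
    braid relation then equates its values on neighbouring generators. *)
Lemma phi_sg_boundary i : (i < n.-1)%N -> phi (S i) boundary = nu.
Proof.
elim: i => [|i IHi] // ilt; rewrite -IHi; last by lia.
have := congr1 (phi^~ boundary) (sg_braid ilt).
rewrite /= !phi_boundaryM [X in _ = X * _]mulrC.
by move/(mulfI (mulf_neq0 (phi_neq0 _ _) (phi_neq0 _ _))).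
Qed.

Definition mu := \prod_(j < n.-1) \prod_(k < n) phi (br_gen j) (fg_gen k).

Lemma phi_boundary a : phi a boundary = \prod_(k < n) phi a (fg_gen k).
Proof.
rewrite /boundary /xprod (big_morph (phi a) (cocycle_hom phiP a) (phi_x1 a)).
by rewrite big_mkord; apply: eq_bigr => k _; rewrite xg_ord.
Qed.

Lemma muE : mu = nu ^+ n.-1.
Proof.
rewrite /mu; under eq_bigr do rewrite -phi_boundary -sg_ord phi_sg_boundary //.
by rewrite prodr_const card_ord.
Qed.

(** The full twist is a product of [n * n.-1] generators, each contributing [nu]. *)
Lemma phi_full_twist_boundary : phi full_twist boundary = mu ^+ n.
Proof.
rewrite /full_twist phi_boundaryX muE; congr (_ ^+ _).
rewrite /rotation; move: (leqnn n.-1); move: {-2}n.-1 => m.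
elim: m => [|m IHm] mn; first by rewrite /sprod big_nil phi_1x.
by rewrite sprodS phi_boundaryM IHm ?phi_sg_boundary ?exprSr //; lia.
Qed.

(** The cocycle identity is expanded in both orders on the commuting product of the full twist and a
    power of the rotation; the full twist acts by conjugation, which [phi] does not see. *)
Lemma phi_full_twist_gen j : (j < n)%N -> phi full_twist (X j) = phi full_twist (X 0).
Proof.
move=> jn; rewrite -(artin_rotation_pow jn); set b := (rotation ^+ j)%g.
apply: (mulIf (phi_neq0 b (X 0))); rewrite -(cocycle_mul phiP).
have -> : (full_twist * b = b * full_twist)%g.
  by rewrite /full_twist /b -!expgnDr addnC.
by rewrite (cocycle_mul phiP) artin_full_twist phi_conj mulrC.
Qed.

Lemma phi_full_twistX m x : phi (full_twist ^+ m)%g x = phi full_twist x ^+ m.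
Proof.
elim: m => [|m IHm]; first by rewrite phi_1x.
by rewrite expgS (cocycle_mul phiP) artin_full_twistX IHm phi_conj exprS.
Qed.

Lemma nontorsion_nu m : nontorsion mu -> (0 < m)%N -> nu ^+ m != 1.
Proof.
move=> nt m0; have := nt m; rewrite -lt0n m0 => /(_ isT).
by apply: contra_neq => e; rewrite -exprnP muE exprAC e expr1n.
Qed.

(* Hence the m-th power of the boundary word times the full twist stays       *)
(* central after the deformation.                                             *)
Lemma torsion_center : ~ nontorsion mu ->
  exists2 m : nat, (0 < m)%N &
    (forall b, phi b (boundary ^+ m)%g = 1) /\ forall x, phi (full_twist ^+ m)%g x = 1.
Proof.
move=> /existsNP[z /not_implyP[z0 /negP/negPn/eqP muz]].
have [d d0 mud] : exists2 d : nat, (0 < d)%N & mu ^+ d = 1.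
  case: z z0 muz => d z0; first by exists d => //; rewrite lt0n.
  by move/(congr1 (@GRing.inv _)); rewrite invr1 invrK; exists d.+1.
(* The exponent serves two purposes: [nu ^+ n.-1 = mu] handles the boundary word, and the common
   value of the full twist on the generators has n-th power [mu ^+ n]. *)
exists (n.-1 * n * d)%N; first by rewrite !muln_gt0 d0; lia.
have nud : nu ^+ (n.-1 * n * d) = 1 by rewrite -mulnA exprM -muE mulnC exprM mud expr1n.
split=> [b|x].
  rewrite phiX; move: b; apply: pres_ind => [|i b IHb|i b IHb].
  - by rewrite phi_1x expr1n.
  - by rewrite phi_boundaryM exprMn IHb -/(br_gen i) -sg_ord phi_sg_boundary // nud mulr1.
  - rewrite phi_boundaryM exprMn IHb mulr1.
    have := phi_boundaryM (br_gen i) (br_gen i)^-1%g.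
    rewrite mulgV phi_1x => /(congr1 (fun t => t ^+ (n.-1 * n * d))).
    by rewrite expr1n exprMn -{1}sg_ord phi_sg_boundary // nud mul1r => <-.
have gP (j : 'I_n) : phi full_twist (fg_gen j) ^+ (n.-1 * n * d) = 1.
  rewrite -xg_ord phi_full_twist_gen // -mulnA mulnC exprM exprM.
  have <- : phi full_twist boundary = phi full_twist (X 0) ^+ n.
    rewrite phi_boundary; under eq_bigr do rewrite -xg_ord phi_full_twist_gen //.
    by rewrite prodr_const card_ord.
  by rewrite phi_full_twist_boundary [_ ^+ n ^+ d]exprAC mud !expr1n.
rewrite phi_full_twistX; move: x; apply: pres_ind => [|i x IHx|i x IHx].
- by rewrite phi_x1 expr1n.
- by rewrite (cocycle_hom phiP) exprMn IHx -/(fg_gen i) gP mulr1.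
- rewrite (cocycle_hom phiP) exprMn IHx mulr1.
  have := cocycle_hom phiP full_twist (fg_gen i) (fg_gen i)^-1%g.
  rewrite mulgV phi_x1 => /(congr1 (fun t => t ^+ (n.-1 * n * d))).
  by rewrite expr1n exprMn gP mul1r => <-.
Qed.

(** Here [y] is a nonzero power of the boundary word, since [y = 1] would give [a = 1] by
    faithfulness; so [phi (S 0) y] is a nonzero power of [nu]. Conjugation by the first braid
    generator therefore detects every nontrivial pair that centralizes the free group. *)
Lemma nontorsion_center (y : F) (a : B) : nontorsion mu ->
    (forall j, y * artin a (X j) * y^-1 = X j)%g -> (y, a) != (1%g, 1%g) ->
  [/\ forall b : B, (b * a = a * b)%g, forall b : B, artin b y = y & phi (S 0) y != 1].
Proof.
move=> nt /inner_artin[[m ym] ca y1] ne.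
have m0 : (0 < m)%N.
  rewrite lt0n; apply: contra_neq ne => m0; suff y1' : y = 1%g by rewrite y1' y1.
  by case: ym; rewrite m0 // mulg1.
have yw (b : B) : artin b y = y.
  case: ym => [->|ym]; first by rewrite artinX artin_boundary.
  apply: (mulIg (boundary ^+ m)%g).
  by rewrite -{1}[boundary](artin_boundary b) -artinX -artinMg ym artin1e.
split=> //; have num := nontorsion_nu nt m0.
case: ym => [->|ym]; first by rewrite phiX.
apply: contra_neq num => p1; have := cocycle_hom phiP (S 0) y (boundary ^+ m)%g.
by rewrite ym p1 mul1r phiX phi_x1 => <-.
Qed.

End FullTwist.

(** * Square summable families *)

Section RealSums.
Variables (R : realType) (X : choiceType).
Implicit Types (f g h : X -> R) (s : seq X) (c e : R).

Definition has_total f :=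
  (forall x, 0 <= f x) /\ (\esum_(x in [set: X]) (f x)%:E < +oo)%E.

Definition tsum f : R := fine (\esum_(x in [set: X]) (f x)%:E)%E.

Lemma has_total_ge0 f x : has_total f -> 0 <= f x. Proof. by case. Qed.

Lemma esum_tsum f : has_total f -> (\esum_(x in [set: X]) (f x)%:E = (tsum f)%:E)%E.
Proof.
case=> f0 ff; rewrite fineK // ge0_fin_numE //.
by apply: esum_ge0 => x _; rewrite lee_fin.
Qed.

Lemma tsum_ge0 f : (forall x, 0 <= f x) -> 0 <= tsum f.
Proof. by move=> f0; rewrite fine_ge0 // esum_ge0 // => x _; rewrite lee_fin. Qed.

Lemma tsum_bound f c : (forall x, 0 <= f x) ->
  (forall s, uniq s -> \sum_(x <- s) f x <= c) -> has_total f /\ tsum f <= c.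
Proof.
move=> f0 fc.
have le : (\esum_(x in [set: X]) (f x)%:E <= c%:E)%E.
  apply: ge_ereal_sup => _ [A [finA _] <-].
  by rewrite fsbig_finite // sumEFin lee_fin fc // fset_uniq.
have sf : has_total f by split => //; exact: le_lt_trans le (ltry _).
by split=> //; rewrite -lee_fin -esum_tsum.
Qed.

Lemma sum_le_tsum f s : has_total f -> uniq s -> \sum_(x <- s) f x <= tsum f.
Proof.
move=> sf us; rewrite -lee_fin -esum_tsum // -sumEFin.
apply: esum_ge; exists [set` s]; first by split=> //; exact: finite_seq.
by rewrite fsbig_seq.
Qed.

Lemma tsum_approx f e : has_total f -> 0 < e ->
  exists2 s, uniq s & tsum f - e < \sum_(x <- s) f x.
Proof.
move=> sf e0.
have : ((tsum f - e)%:E < \esum_(x in [set: X]) (f x)%:E)%E.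
  by rewrite esum_tsum // lte_fin ltrBlDr ltrDl.
move/ereal_sup_gt => [_ [A [finA _] <-]].
rewrite fsbig_finite // sumEFin lte_fin => H.
by exists (fset_set A) => //; exact: fset_uniq.
Qed.

Lemma le_tsum f g : (forall x, 0 <= f x <= g x) -> has_total g ->
  has_total f /\ tsum f <= tsum g.
Proof.
move=> fg sg; apply: tsum_bound => [x|s us]; first by case/andP: (fg x).
apply: le_trans (sum_le_tsum sg us); apply: ler_sum => x _.
by case/andP: (fg x).
Qed.

Lemma tsumD f g : has_total f -> has_total g ->
  has_total (fun x => f x + g x) /\ tsum (fun x => f x + g x) = tsum f + tsum g.
Proof.
move=> sf sg; have E : (\esum_(x in [set: X]) (f x + g x)%:E = (tsum f + tsum g)%:E)%E.
  rewrite EFinD -!esum_tsum // -esumD // => x _; rewrite lee_fin; exact: has_total_ge0.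
split; last by rewrite /tsum E.
by split=> [x|]; [rewrite addr_ge0 ?has_total_ge0|rewrite E ltry].
Qed.

Lemma tsumZ f c : 0 <= c -> has_total f ->
  has_total (fun x => c * f x) /\ tsum (fun x => c * f x) = c * tsum f.
Proof.
move=> c0 sf.
have le d g : 0 <= d -> has_total g ->
    has_total (fun x => d * g x) /\ tsum (fun x => d * g x) <= d * tsum g.
  move=> d0 sg; apply: tsum_bound => [x|s us].
    exact: mulr_ge0 d0 (sg.1 x).
  by rewrite -mulr_sumr; apply: ler_wpM2l => //; exact: sum_le_tsum.
have [scf le1] := le c f c0 sf; split=> //; apply/eqP; rewrite eq_le le1 /=.
have [->|c1] := eqVneq c 0; first by rewrite mul0r tsum_ge0 // => x; rewrite mul0r.
have ci : 0 <= c^-1 by rewrite invr_ge0.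
have [_ +] := le c^-1 _ ci scf.
under eq_fun do rewrite mulKf //.
by rewrite ler_pdivlMl // lt_def c1.
Qed.

Lemma tsum_split f (P : pred X) : has_total f ->
  tsum f = tsum (fun x => if P x then f x else 0) + tsum (fun x => if P x then 0 else f x).
Proof.
move=> sf; have [|s1 _] := @le_tsum (fun x => if P x then f x else 0) f _ sf.
  by move=> x; case: (P x); rewrite lexx ?(sf.1 x).
have [|s2 _] := @le_tsum (fun x => if P x then 0 else f x) f _ sf.
  by move=> x; case: (P x); rewrite lexx ?(sf.1 x).
have [_ <-] := tsumD s1 s2; congr tsum; apply/funext => x.
by case: (P x); rewrite ?addr0 ?add0r.
Qed.

Lemma tsum_finite f s : uniq s -> (forall x, 0 <= f x) ->
  (forall x, x \notin s -> f x = 0) -> has_total f /\ tsum f = \sum_(x <- s) f x.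
Proof.
move=> us f0 fs; have [sf le] : has_total f /\ tsum f <= \sum_(x <- s) f x.
  apply: tsum_bound => // t ut.
  rewrite (bigID (mem s)) /= [X in _ + X]big1 ?addr0; last by move=> x /fs.
  rewrite -big_filter [leRHS](bigID (mem t)) /= -[X in _ <= X + _]big_filter.
  rewrite (perm_big [seq x <- s | x \in t]).
    by rewrite lerDl sumr_ge0.
  apply: uniq_perm; rewrite ?filter_uniq // => x.
  by rewrite !mem_filter andbC.
by split=> //; apply/eqP; rewrite eq_le le sum_le_tsum.
Qed.

End RealSums.

Lemma tsum_reindex (R : realType) (X Y : choiceType) (p : Y -> X) (f : X -> R) :
  bijective p -> has_total f -> has_total (f \o p) /\ tsum (f \o p) = tsum f.
Proof.
rewrite -setTT_bijective => pbij [f0 ff].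
have E := @reindex_esum R Y X setT setT p (fun x => (f x)%:E) pbij.
split; last by rewrite /tsum [in RHS]E.
by split=> [y|]; [exact: f0|rewrite -E].
Qed.

(** * The norm of square summable functions *)

Section Norm.
Variables (R : realType) (X : choiceType).
Local Notation C := R[i].
Local Notation H := (ell2 R X).
Implicit Types (xi eta zeta : H) (a : C).

Lemma normc_ge0 (z : C) : 0 <= normc z.
Proof. by case: z => a b; rewrite sqrtr_ge0. Qed.

Lemma has_total_ell2 xi : has_total (fun x => normc (xi x) ^+ 2).
Proof. by split=> [x|]; [rewrite sqr_ge0|exact: valP xi]. Qed.

Lemma tsum_ell2 xi : tsum (fun x => normc (xi x) ^+ 2) = l2norm xi ^+ 2.
Proof. by apply: EFin_inj; rewrite -sqnormE -esum_tsum //; exact: has_total_ell2. Qed.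

Lemma l2norm_ge0 xi : 0 <= l2norm xi. Proof. exact: sqrtr_ge0. Qed.

Lemma to_ell2_total (f : X -> C) : has_total (fun x => normc (f x) ^+ 2) ->
  to_ell2 f = f :> (X -> C).
Proof. by case=> _ ff; apply: to_ell2E. Qed.

Lemma ell2D xi eta x : (xi + eta) x = xi x + eta x. Proof. by []. Qed.
Lemma ell2Z a xi x : (a *: xi) x = a * xi x. Proof. by []. Qed.
Lemma ell2N xi x : (- xi) x = - xi x. Proof. by []. Qed.
Lemma ell20 x : (0 : H) x = 0. Proof. by []. Qed.

Lemma ell2_sum (I : Type) (r : seq I) (P : pred I) (F : I -> H) x :
  (\sum_(i <- r | P i) F i) x = \sum_(i <- r | P i) F i x.
Proof.
by elim/big_rec2: _ => // i y z _ <-.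
Qed.

Lemma normc_le_l2norm xi x : normc (xi x) <= l2norm xi.
Proof.
rewrite -(@ler_pXn2r _ 2) ?nnegrE ?normc_ge0 ?l2norm_ge0 // -tsum_ell2.
by have := @sum_le_tsum _ _ _ [:: x] (has_total_ell2 xi) isT; rewrite big_seq1.
Qed.

Lemma l2norm_le xi c : 0 <= c ->
  tsum (fun x => normc (xi x) ^+ 2) <= c ^+ 2 -> l2norm xi <= c.
Proof. by move=> c0; rewrite tsum_ell2 ler_pXn2r // nnegrE ?l2norm_ge0. Qed.

Lemma l2norm0 : l2norm (0 : H) = 0.
Proof.
by rewrite /l2norm (_ : sqnorm _ = 0%E) ?sqrtr0 //; exact: sqnorm0.
Qed.

Lemma l2norm_eq0 xi : l2norm xi = 0 -> xi = 0.
Proof.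
move=> xi0; apply: ell2P => x; apply: eq0_normc; apply/eqP.
by rewrite eq_le normc_ge0 andbT -xi0 normc_le_l2norm.
Qed.

Lemma l2normZ a xi : l2norm (a *: xi) = normc a * l2norm xi.
Proof.
have E : l2norm (a *: xi) ^+ 2 = (normc a * l2norm xi) ^+ 2.
  have [_ +] := tsumZ (sqr_ge0 (normc a)) (has_total_ell2 xi).
  rewrite exprMn -!tsum_ell2 => <-; congr tsum; apply/funext => x.
  by rewrite ell2Z normcM exprMn.
apply/eqP; rewrite -(@eqrXn2 _ 2) ?E // ?l2norm_ge0 //.
by rewrite mulr_ge0 ?normc_ge0 ?l2norm_ge0.
Qed.

Lemma l2normN xi : l2norm (- xi) = l2norm xi.
Proof. by rewrite -scaleN1r l2normZ normcN normc1 mul1r. Qed.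

Lemma l2norm_normr z xi : l2norm (Complex z 0 *: xi) = `|z| * l2norm xi.
Proof. by rewrite l2normZ /= expr0n addr0 sqrtr_sqr. Qed.

(* Minkowski's inequality, from the convexity of the square by optimizing     *)
(* (u + v)^2 <= (1 + s) u^2 + (1 + 1 / s) v^2 over s > 0.                     *)
Lemma l2normD xi eta : l2norm (xi + eta) <= l2norm xi + l2norm eta.
Proof.
have [xi0|xi0] := eqVneq (l2norm xi) 0.
  by rewrite (l2norm_eq0 xi0) add0r l2norm0 add0r.
have [eta0|eta0] := eqVneq (l2norm eta) 0.
  by rewrite (l2norm_eq0 eta0) addr0 l2norm0 addr0.
set u := l2norm xi in xi0 *; set v := l2norm eta in eta0 *.
have u0 : 0 < u by rewrite lt_def xi0 l2norm_ge0.
have v0 : 0 < v by rewrite lt_def eta0 l2norm_ge0.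
apply: l2norm_le; first by rewrite addr_ge0 // ltW.
have vu : 0 < v / u by rewrite divr_gt0.
have uv : 0 < u / v by rewrite divr_gt0.
have [s1 t1] := tsumZ (addr_ge0 ler01 (ltW vu)) (has_total_ell2 xi).
have [s2 t2] := tsumZ (addr_ge0 ler01 (ltW uv)) (has_total_ell2 eta).
have [s12 t12] := tsumD s1 s2.
have -> : (u + v) ^+ 2 = (1 + v / u) * u ^+ 2 + (1 + u / v) * v ^+ 2.
  by field; rewrite xi0 eta0.
rewrite -(tsum_ell2 xi) -(tsum_ell2 eta) -t1 -t2 -t12.
suff [_] : has_total (fun x => normc ((xi + eta) x) ^+ 2) /\
  tsum (fun x => normc ((xi + eta) x) ^+ 2) <=
  tsum (fun x => (1 + v / u) * normc (xi x) ^+ 2 + (1 + u / v) * normc (eta x) ^+ 2) by [].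
apply: le_tsum => // x; rewrite sqr_ge0 /=.
set a := normc (xi x); set b := normc (eta x).
apply: (@le_trans _ _ ((a + b) ^+ 2)).
  rewrite ler_pXn2r ?nnegrE ?addr_ge0 ?normc_ge0 //; exact: le_normcD.
rewrite -subr_ge0.
have -> : (1 + v / u) * a ^+ 2 + (1 + u / v) * b ^+ 2 - (a + b) ^+ 2 =
    (v * a - u * b) ^+ 2 / (u * v) by field; rewrite xi0 eta0.
by rewrite divr_ge0 ?sqr_ge0 // mulr_ge0 // ltW.
Qed.

Lemma l2norm_dist xi zeta eta :
  l2norm (xi - eta) <= l2norm (xi - zeta) + l2norm (zeta - eta).
Proof. by rewrite (le_trans _ (l2normD _ _)) // addrA subrK. Qed.

Lemma l2norm_sum (I : Type) (r : seq I) (P : pred I) (F : I -> H) :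
  l2norm (\sum_(i <- r | P i) F i) <= \sum_(i <- r | P i) l2norm (F i).
Proof.
elim/big_rec2: _ => [|i y z _ IH]; first by rewrite l2norm0.
by rewrite (le_trans (l2normD _ _)) // lerD2l.
Qed.

Definition ebasis (x : X) : H := to_ell2 (fun y => (y == x)%:R).

Lemma normc_bool (b : bool) : normc (b%:R : C) = b%:R.
Proof. by case: b; [exact: normc1|exact: normc0]. Qed.

Lemma has_total_basis x : has_total (fun y : X => normc (((y == x)%:R) : C) ^+ 2) /\
  tsum (fun y : X => normc (((y == x)%:R) : C) ^+ 2) = 1.
Proof.
have [//|y|y|sf ->] := @tsum_finite R X (fun y : X => normc (((y == x)%:R) : C) ^+ 2) [:: x].
- by rewrite sqr_ge0.
- by rewrite inE => /negPf ->; rewrite normc_bool expr0n.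
by rewrite big_seq1 eqxx normc_bool expr1n.
Qed.

Lemma basisE x y : ebasis x y = (y == x)%:R.
Proof. by rewrite /ebasis to_ell2_total //; case: (has_total_basis x). Qed.

Lemma l2norm_basis x : l2norm (ebasis x) = 1.
Proof.
have : l2norm (ebasis x) ^+ 2 = 1.
  rewrite -tsum_ell2; under [X in tsum X]eq_fun do rewrite basisE.
  by case: (has_total_basis x).
by move/eqP; rewrite sqrf_eq1 => /orP[/eqP //|/eqP e]; have := l2norm_ge0 (ebasis x); rewrite e ler0N1.
Qed.

Lemma ell2_approx xi e : 0 < e -> exists2 s : seq X, uniq s &
  l2norm (xi - \sum_(x <- s) xi x *: ebasis x) <= e.
Proof.
move=> e0; have e20 : 0 < e ^+ 2 by rewrite exprn_gt0.
have [s us se] := tsum_approx (has_total_ell2 xi) e20.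
exists s => //; apply: l2norm_le; first exact: ltW.
have sE y : (\sum_(x <- s) xi x *: ebasis x) y = if y \in s then xi y else 0.
  rewrite ell2_sum; under eq_bigr do rewrite ell2Z basisE.
  case: ifPn => ys.
    rewrite (bigD1_seq y) //= eqxx mulr1 big1 ?addr0 // => x /negPf.
    by rewrite eq_sym => ->; rewrite mulr0.
  rewrite big_seq big1 // => x xs; case: eqP => [e1|]; last by rewrite mulr0.
  by rewrite e1 xs in ys.
have E := tsum_split (mem s) (has_total_ell2 xi).
have <- : tsum (fun x => if x \in s then 0 else normc (xi x) ^+ 2) =
    tsum (fun x => normc ((xi - \sum_(x <- s) xi x *: ebasis x) x) ^+ 2).
  congr tsum; apply/funext => y; rewrite ell2D ell2N sE.
  by case: ifP => _; rewrite ?subrr ?subr0 // normc0 expr0n.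
have [|//|_ ts] := @tsum_finite R X (fun x => if x \in s then normc (xi x) ^+ 2 else 0) s us.
- by move=> y; case: ifP; rewrite ?sqr_ge0.
- by move=> y /negPf ->.
have ss : \sum_(x <- s) (if x \in s then normc (xi x) ^+ 2 else 0) =
    \sum_(x <- s) normc (xi x) ^+ 2.
  by apply: eq_big_seq => y ys; rewrite ys.
move: se; rewrite E; rewrite ss in ts.
rewrite [X in X + _ - _]ts [X in X <= _](_ : _ = tsum (fun x => if mem s x then 0 else normc (xi x) ^+ 2)) //.
lra.
Qed.

End Norm.

(** * Unordered sums and the inner product *)

Section InnerProduct.
Variables (R : realType) (X : choiceType).
Local Notation C := R[i].
Local Notation H := (ell2 R X).
Implicit Types (xi eta zeta : H) (a z : C) (f g h p q : X -> R).

(** Any splitting into summable nonnegative functions computes the sum, not only the positive and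
    negative parts of the definition; linearity follows from this. *)
Lemma real_sum_sub p q : has_total p -> has_total q ->
  real_sum (fun x => p x - q x) = tsum p - tsum q.
Proof.
move=> tp tq; rewrite /real_sum -!/(tsum _).
set f := fun x => p x - q x.
have [|t1 _] := @le_tsum _ _ (fun x => Num.max (f x) 0) p _ tp.
  move=> x; rewrite le_max lexx orbT ge_max tp.1 andbT.
  by rewrite /f gerBl tq.1.
have [|t2 _] := @le_tsum _ _ (fun x => Num.max (- f x) 0) q _ tq.
  move=> x; rewrite le_max lexx orbT ge_max tq.1 andbT.
  by rewrite /f opprB gerBl tp.1.
have [_ e1] := tsumD t1 tq; have [_ e2] := tsumD t2 tp.
have : tsum (fun x => Num.max (f x) 0) + tsum q = tsum (fun x => Num.max (- f x) 0) + tsum p.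
  rewrite -e1 -e2; congr tsum; apply/funext => x.
  by rewrite /f; case: (leP (p x - q x) 0) => H1; case: (leP (- (p x - q x)) 0) => H2; lra.
lra.
Qed.

Definition dominated f := exists2 h, has_total h & forall x, `|f x| <= h x.

Lemma dominatedE f : dominated f -> exists p q,
  [/\ has_total p, has_total q & f = (fun x => p x - q x)].
Proof.
move=> [h th fh]; exists (fun x => 2^-1 * (h x + f x)), (fun x => 2^-1 * (h x - f x)).
have fh' x : - h x <= f x <= h x by rewrite -ler_norml.
have [|tp _] := @le_tsum _ _ (fun x => 2^-1 * (h x + f x)) h _ th.
  by move=> x; have := fh' x; lra.
have [|tq _] := @le_tsum _ _ (fun x => 2^-1 * (h x - f x)) h _ th.
  by move=> x; have := fh' x; lra.
by split=> //; apply/funext => x; lra.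
Qed.

Lemma real_sumD f g : dominated f -> dominated g ->
  real_sum (fun x => f x + g x) = real_sum f + real_sum g.
Proof.
move=> /dominatedE[p [q [tp tq ->]]] /dominatedE[p' [q' [tp' tq' ->]]].
have [t1 e1] := tsumD tp tp'; have [t2 e2] := tsumD tq tq'.
rewrite !real_sum_sub //.
under eq_fun do rewrite addrACA -opprD.
by rewrite real_sum_sub // e1 e2; lra.
Qed.

Lemma real_sumN f : real_sum (fun x => - f x) = - real_sum f.
Proof.
by rewrite /real_sum opprB; congr (_ - fine _); apply: eq_esum => x _; rewrite opprK.
Qed.

Lemma real_sumZ f c : dominated f -> real_sum (fun x => c * f x) = c * real_sum f.
Proof.
move=> /dominatedE[p [q [tp tq ->]]].
wlog c0 : c / 0 <= c => [W|].
  have [/W //|/ltW c0] := leP 0 c.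
  rewrite -[c]opprK; under eq_fun do rewrite mulNr.
  by rewrite real_sumN W ?oppr_ge0 // [RHS]mulNr.
have [t1 e1] := tsumZ c0 tp; have [t2 e2] := tsumZ c0 tq.
rewrite real_sum_sub //; under eq_fun do rewrite mulrBr.
by rewrite real_sum_sub // e1 e2 mulrBr.
Qed.

Lemma dominatedD f g : dominated f -> dominated g -> dominated (fun x => f x + g x).
Proof.
move=> [h th fh] [k tk gk]; exists (fun x => h x + k x); first by case: (tsumD th tk).
by move=> x; rewrite (le_trans (ler_normD _ _)) // lerD.
Qed.

Lemma dominatedZ f c : dominated f -> dominated (fun x => c * f x).
Proof.
move=> [h th fh]; exists (fun x => `|c| * h x); first by case: (tsumZ (normr_ge0 c) th).
by move=> x; rewrite normrM ler_wpM2l.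
Qed.

Lemma real_sum_le f h : has_total h -> (forall x, `|f x| <= h x) ->
  `|real_sum f| <= tsum h.
Proof.
move=> th fh.
have le g : (forall x, `|g x| <= h x) -> real_sum g <= tsum h.
  move=> gh; rewrite /real_sum -!/(tsum _).
  have [|_ t1] := @le_tsum _ _ (fun x => Num.max (g x) 0) h _ th.
    move=> x; rewrite le_max lexx orbT ge_max th.1 andbT.
    exact: le_trans (ler_norm _) (gh x).
  rewrite (le_trans _ t1) // gerBl tsum_ge0 // => x.
  by rewrite le_max lexx orbT.
rewrite ler_norml le // andbT lerNl -real_sumN le // => x.
by rewrite normrN.
Qed.

Lemma real_sum1 f x0 : (forall x, x != x0 -> f x = 0) -> real_sum f = f x0.
Proof.
move=> fx; rewrite /real_sum -!/(tsum _).
have [//|x|x|_ ->] := @tsum_finite _ _ (fun x => Num.max (f x) 0) [:: x0].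
- by rewrite le_max lexx orbT.
- by rewrite inE => /fx ->; rewrite maxxx.
have [//|x|x|_ ->] := @tsum_finite _ _ (fun x => Num.max (- f x) 0) [:: x0].
- by rewrite le_max lexx orbT.
- by rewrite inE => /fx ->; rewrite oppr0 maxxx.
rewrite !big_seq1; case: (leP (f x0) 0) => H1; case: (leP (- f x0) 0) => H2; lra.
Qed.

Lemma normr_Re_le z : `|complex.Re z| <= normc z.
Proof.
case: z => a b /=; rewrite -sqrtr_sqr; apply: ler_wsqrtr.
by rewrite lerDl sqr_ge0.
Qed.

Lemma normr_Im_le z : `|complex.Im z| <= normc z.
Proof.
case: z => a b /=; rewrite -sqrtr_sqr; apply: ler_wsqrtr.
by rewrite lerDr sqr_ge0.
Qed.

Lemma normc_le_ReIm z : normc z <= `|complex.Re z| + `|complex.Im z|.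
Proof.
rewrite -(@ler_pXn2r _ 2) ?nnegrE ?addr_ge0 // ?normc_ge0 // normc_sqE.
rewrite sqrrD !real_normK ?num_real //.
by have := mulr_ge0 (normr_ge0 (complex.Re z)) (normr_ge0 (complex.Im z)); lra.
Qed.

Lemma normc_conj z : normc (z^*)%C = normc z.
Proof. by case: z => a b /=; rewrite sqrrN. Qed.

Definition half_sq xi eta x :=
  2^-1 * (normc (xi x) ^+ 2 + normc (eta x) ^+ 2).

Lemma half_sqP xi eta : has_total (half_sq xi eta) /\
  tsum (half_sq xi eta) = 2^-1 * (l2norm xi ^+ 2 + l2norm eta ^+ 2).
Proof.
have [t1 e1] := tsumD (has_total_ell2 xi) (has_total_ell2 eta).
have h0 : (0 : R) <= 2^-1 by lra.
by have [t2 e2] := tsumZ h0 t1; split=> //; rewrite e2 e1 !tsum_ell2.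
Qed.

Lemma inner_term_le xi eta x : normc (xi x * (eta x)^*%C) <= half_sq xi eta x.
Proof.
rewrite normcM normc_conj /half_sq.
have := sqr_ge0 (normc (xi x) - normc (eta x)); rewrite sqrrB; lra.
Qed.

Lemma inner_Re_dom xi eta : dominated (fun x => complex.Re (xi x * (eta x)^*%C)).
Proof.
exists (half_sq xi eta); first by case: (half_sqP xi eta).
by move=> x; exact: le_trans (normr_Re_le _) (inner_term_le _ _ _).
Qed.

Lemma inner_Im_dom xi eta : dominated (fun x => complex.Im (xi x * (eta x)^*%C)).
Proof.
exists (half_sq xi eta); first by case: (half_sqP xi eta).
by move=> x; exact: le_trans (normr_Im_le _) (inner_term_le _ _ _).
Qed.

Lemma inner_linear a xi eta zeta :
  inner (a *: xi + eta) zeta = a * inner xi zeta + inner eta zeta.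
Proof.
rewrite /inner /complex_sum; case: a => r s.
have E x : (Complex r s *: xi + eta) x * (zeta x)^*%C =
   Complex r s * (xi x * (zeta x)^*%C) + eta x * (zeta x)^*%C.
  by rewrite ell2D ell2Z mulrDl mulrA.
have dR := inner_Re_dom xi zeta; have dI := inner_Im_dom xi zeta.
congr Complex.
- have -> : (fun x => complex.Re ((Complex r s *: xi + eta) x * (zeta x)^*%C)) =
    fun x => (r * complex.Re (xi x * (zeta x)^*%C) + - s * complex.Im (xi x * (zeta x)^*%C))
      + complex.Re (eta x * (zeta x)^*%C).
    apply/funext => x; rewrite E; case: (xi x * _) => u v; case: (eta x * _) => u' v' /=.
    by rewrite mulNr.
  rewrite real_sumD; [|exact: dominatedD (dominatedZ _ dR) (dominatedZ _ dI)|exact: inner_Re_dom].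
  rewrite real_sumD ?real_sumZ //; [|exact: dominatedZ..].
  by rewrite mulNr.
- have -> : (fun x => complex.Im ((Complex r s *: xi + eta) x * (zeta x)^*%C)) =
    fun x => (r * complex.Im (xi x * (zeta x)^*%C) + s * complex.Re (xi x * (zeta x)^*%C))
      + complex.Im (eta x * (zeta x)^*%C).
    by apply/funext => x; rewrite E; case: (xi x * _) => u v; case: (eta x * _) => u' v' /=.
  rewrite real_sumD; [|exact: dominatedD (dominatedZ _ dI) (dominatedZ _ dR)|exact: inner_Im_dom].
  by rewrite real_sumD ?real_sumZ //; exact: dominatedZ.
Qed.

Lemma inner_conj xi eta : inner eta xi = ((inner xi eta)^*)%C.
Proof.
rewrite /inner /complex_sum /=; congr Complex.
  by congr real_sum; apply/funext => x; case: (xi x) (eta x) => u v [u' v'] /=; ring.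
rewrite -real_sumN; congr real_sum; apply/funext => x.
by case: (xi x) (eta x) => u v [u' v'] /=; ring.
Qed.

Lemma innerDl xi eta zeta : inner (xi + eta) zeta = inner xi zeta + inner eta zeta.
Proof. by have := inner_linear 1 xi eta zeta; rewrite scale1r mul1r. Qed.

Lemma inner0l eta : inner 0 eta = 0.
Proof.
by have := innerDl 0 0 eta; rewrite addr0 => /eqP; rewrite addrC -subr_eq subrr => /eqP.
Qed.

Lemma innerZl a xi eta : inner (a *: xi) eta = a * inner xi eta.
Proof. by have := inner_linear a xi 0 eta; rewrite addr0 inner0l addr0. Qed.

Lemma innerBl xi eta zeta : inner (xi - eta) zeta = inner xi zeta - inner eta zeta.
Proof. by rewrite innerDl -scaleN1r innerZl mulN1r. Qed.

Lemma innerDr xi eta zeta : inner xi (eta + zeta) = inner xi eta + inner xi zeta.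
Proof. by rewrite !(inner_conj _ xi) innerDl; exact: rmorphD. Qed.

Lemma innerZr a xi eta : inner xi (a *: eta) = (a^*)%C * inner xi eta.
Proof. by rewrite !(inner_conj _ xi) innerZl; exact: rmorphM. Qed.

Lemma innerBr xi eta zeta : inner xi (eta - zeta) = inner xi eta - inner xi zeta.
Proof. by rewrite !(inner_conj _ xi) innerBl; exact: rmorphB. Qed.

Lemma inner_diag xi : inner xi xi = Complex (l2norm xi ^+ 2) 0.
Proof.
rewrite /inner /complex_sum; congr Complex.
  rewrite -tsum_ell2 -[RHS]subr0.
  have t0 : has_total (fun _ : X => 0 : R) /\ tsum (fun _ : X => 0 : R) = 0.
    by have [//|//|//|t ->] := @tsum_finite R X (fun=> 0) [::]; rewrite big_nil.
  rewrite -[X in _ - X]t0.2 -real_sum_sub //; [|exact: has_total_ell2|exact: t0.1].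
  congr real_sum; apply/funext => x; rewrite subr0 normc_sqE.
  by case: (xi x) => u v /=; ring.
have -> : (fun x => complex.Im (xi x * (xi x)^*%C)) = fun=> 0.
  by apply/funext => x; case: (xi x) => u v /=; ring.
by rewrite /real_sum oppr0 subrr.
Qed.

(** Cauchy-Schwarz with a loose constant, enough for continuity: for unit vectors the real and the
    imaginary part are each at most 1 by the inequality between arithmetic and geometric means, and
    scaling does the rest. *)
Lemma inner_le xi eta : normc (inner xi eta) <= 2 * (l2norm xi * l2norm eta).
Proof.
have W xi' eta' : normc (inner xi' eta') <= l2norm xi' ^+ 2 + l2norm eta' ^+ 2.
  have [tH eH] := half_sqP xi' eta'.
  rewrite (le_trans (normc_le_ReIm _)) //=.
  have := @real_sum_le (fun x => complex.Re (xi' x * (eta' x)^*%C)) _ tH.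
  have := @real_sum_le (fun x => complex.Im (xi' x * (eta' x)^*%C)) _ tH.
  rewrite eH => h1 h2.
  have := h1 (fun x => le_trans (normr_Im_le _) (inner_term_le _ _ _)).
  have := h2 (fun x => le_trans (normr_Re_le _) (inner_term_le _ _ _)).
  lra.
have [xi0|xi0] := eqVneq (l2norm xi) 0.
  by rewrite (l2norm_eq0 xi0) inner0l l2norm0 mul0r mulr0 (normc0 R).
have [eta0|eta0] := eqVneq (l2norm eta) 0.
  by rewrite (l2norm_eq0 eta0) inner_conj inner0l normc_conj l2norm0 !mulr0 (normc0 R).
have u0 : 0 < l2norm xi by rewrite lt_def xi0 l2norm_ge0.
have v0 : 0 < l2norm eta by rewrite lt_def eta0 l2norm_ge0.
pose s : C := Complex (l2norm xi)^-1 0; pose t : C := Complex (l2norm eta)^-1 0.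
have := W (s *: xi) (t *: eta).
rewrite innerZl innerZr !l2norm_normr !gtr0_norm ?invr_gt0 // !mulVf //.
rewrite !normcM normc_conj /s /t /= !expr0n /= !addr0 !sqrtr_sqr !gtr0_norm ?invr_gt0 //.
by rewrite mulrA -invfM ler_pdivrMl ?mulr_gt0 // expr1n => /le_trans; apply; rewrite mulrC [X in _ <= _ * X]mulrC; lra.
Qed.

Lemma inner_basis xi x : inner xi (ebasis R x) = xi x.
Proof.
rewrite /inner /complex_sum.
have E y : xi y * (ebasis R x y)^*%C = if y == x then xi x else 0.
  by rewrite basisE; case: eqP => [->|_]; rewrite ?rmorph1 ?rmorph0 ?mulr1 ?mulr0.
rewrite (@real_sum1 _ x) => [|y /negPf yx]; last by rewrite E yx.
rewrite (@real_sum1 _ x) => [|y /negPf yx]; last by rewrite E yx.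
by rewrite !E eqxx; case: (xi x).
Qed.

End InnerProduct.

(** * Bounded operators *)

Section Completeness.
Variables (R : realType) (X : choiceType).
Local Notation C := R[i].
Local Notation H := (ell2 R X).
Implicit Types (xi eta zeta : H) (K : R).

Lemma exp2_gt0 k : 0 < (2 : R) ^+ k. Proof. by rewrite exprn_gt0. Qed.

Lemma le_geom (a b K : R) : (forall l, a <= b + K / 2 ^+ l) -> a <= b.
Proof.
move=> le; rewrite leNgt; apply/negP => ab.
have d0 : 0 < a - b by rewrite subr_gt0.
have := upper_nthrootP (leqnn (Num.bound (K / (a - b)))).
set l := Num.bound _ => lt; have := le l.
rewrite -lerBlDl ler_pdivlMr ?exp2_gt0 // leNgt => /negP; apply.
by move: lt; rewrite ltr_pdivrMr // mulrC.
Qed.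

Lemma geom_dist (d : nat -> nat -> R) K :
  (forall k l m, d k m <= d k l + d l m) -> (forall k, d k k = 0) ->
  (forall k, d k.+1 k <= K / 2 ^+ k) ->
  forall k l, d (k + l)%N k <= 2 * K / 2 ^+ k - 2 * K / 2 ^+ (k + l).
Proof.
move=> tri d0 dS k; elim=> [|l IHl]; first by rewrite addn0 subrr d0.
rewrite addnS (le_trans (tri _ (k + l)%N _)) // (le_trans (lerD (dS _) IHl)) //.
rewrite exprS.
have -> : 2 * K / (2 * 2 ^+ (k + l)) = K / 2 ^+ (k + l).
  by field; rewrite expf_neq0 // pnatr_eq0.
lra.
Qed.

(** The intervals of radius [2 * K / 2 ^+ k] around [u k] are nested; the limit is the supremum of
    their left ends. *)
Lemma real_complete (u : nat -> R) K : 0 <= K ->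
  (forall k, `|u k.+1 - u k| <= K / 2 ^+ k) ->
  exists r, forall k, `|r - u k| <= 2 * K / 2 ^+ k.
Proof.
move=> K0 uS; pose e k := 2 * K / 2 ^+ k.
have eE k : e k.+1 = e k - K / 2 ^+ k.
  by rewrite /e exprS; field; rewrite expf_neq0 // pnatr_eq0.
have e0 k : 0 <= e k by rewrite divr_ge0 ?mulr_ge0 // ltW // exp2_gt0.
have lo k l : u k - e k <= u (k + l)%N - e (k + l)%N.
  elim: l => [|l IHl]; first by rewrite addn0.
  rewrite (le_trans IHl) // addnS eE; have := uS (k + l)%N.
  by rewrite ler_norml => /andP[]; lra.
have hi k l : u (k + l)%N + e (k + l)%N <= u k + e k.
  elim: l => [|l IHl]; first by rewrite addn0.
  rewrite (le_trans _ IHl) // addnS eE; have := uS (k + l)%N.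
  by rewrite ler_norml => /andP[]; lra.
have lohi k l : u k - e k <= u l + e l.
  have := lo k l; have := hi l k; rewrite addnC => h1 h2.
  by have := e0 (l + k)%N; rewrite addnC in h1 *; rewrite addnC in h2 *; lra.
pose A := [set u k - e k | k in [set: nat]].
have A0 : has_sup A.
  split; first by exists (u 0%N - e 0%N), 0%N.
  by exists (u 0%N + e 0%N) => _ [k _ <-]; exact: lohi.
exists (sup A) => k; rewrite ler_distl; apply/andP; split.
  by apply: ub_le_sup; [case: A0|exists k].
by apply: ge_sup; [case: A0|move=> _ [l _ <-]; exact: lohi].
Qed.

(** The limit is taken coordinatewise. On finitely many coordinates its distance to [xi k] is
    controlled by that of a later term, up to an error that vanishes, and the bound does not depend
    on the finite set. *)
Lemma ell2_complete (xi : nat -> H) K : 0 <= K ->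
  (forall k, l2norm (xi k.+1 - xi k) <= K / 2 ^+ k) ->
  exists eta, forall k, l2norm (eta - xi k) <= 2 * K / 2 ^+ k.
Proof.
move=> K0 xiS.
have xid k l : l2norm (xi (k + l)%N - xi k) <= 2 * K / 2 ^+ k.
  have := @geom_dist (fun k l => l2norm (xi k - xi l)) K.
  move=> /(_ _ _ xiS k l) W; apply: le_trans (W _ _) _.
  - by move=> *; exact: l2norm_dist.
  - by move=> j; rewrite subrr l2norm0.
  - by rewrite gerBl divr_ge0 ?mulr_ge0 // ltW // exp2_gt0.
have /choice[f fP] x : exists z : C, forall k, normc (z - xi k x) <= 4 * K / 2 ^+ k.
  have [k|r rP] := @real_complete (fun k => complex.Re (xi k x)) K K0.
    rewrite (le_trans _ (xiS k)) // (le_trans _ (normc_le_l2norm _ x)) //.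
    apply: le_trans (normr_Re_le _); rewrite ell2D ell2N.
    by case: (xi k.+1 x) (xi k x) => a b [].
  have [k|s sP] := @real_complete (fun k => complex.Im (xi k x)) K K0.
    rewrite (le_trans _ (xiS k)) // (le_trans _ (normc_le_l2norm _ x)) //.
    apply: le_trans (normr_Im_le _); rewrite ell2D ell2N.
    by case: (xi k.+1 x) (xi k x) => a b [].
  exists (Complex r s) => k; rewrite (le_trans (normc_le_ReIm _)) //.
  have := rP k; have := sP k; case: (xi k x) => a b /=; lra.
have fin k (s : seq X) : uniq s ->
    \sum_(x <- s) normc (f x - xi k x) ^+ 2 <= (2 * K / 2 ^+ k) ^+ 2.
  move=> us; set D := 2 * K / 2 ^+ k.
  have D0 : 0 <= D by rewrite divr_ge0 ?mulr_ge0 // ltW // exp2_gt0.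
  pose M := \sum_(x <- s) (2 * D * (4 * K) + (4 * K) ^+ 2).
  apply: (@le_geom _ _ M) => l0; pose l := (k + l0)%N.
  have dl : l2norm (xi l - xi k) <= D by exact: xid.
  have p0 : 0 < ((2 : R) ^+ l0)^-1 by rewrite invr_gt0 exp2_gt0.
  have p1 : ((2 : R) ^+ l0)^-1 <= 1 by rewrite invf_le1 ?exp2_gt0 // exprn_ege1 // ler1n.
  have q0 : 4 * K / 2 ^+ l <= 4 * K / 2 ^+ l0.
    by rewrite ler_wpM2l ?mulr_ge0 // lef_pV2 ?posrE ?exp2_gt0 // ler_eXn2l ?ltr1n // leq_addl.
  apply: (@le_trans _ _ (\sum_(x <- s) (normc ((xi l - xi k) x) ^+ 2 +
      (2 * D * (4 * K) + (4 * K) ^+ 2) / 2 ^+ l0))).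
    apply: ler_sum => x _.
    set a := normc (f x - xi k x); set b := normc ((xi l - xi k) x).
    have ab : a <= b + 4 * K / 2 ^+ l0.
      rewrite /a (_ : f x - xi k x = (xi l - xi k) x + (f x - xi l x)); last first.
        by rewrite ell2D ell2N; ring.
      by rewrite (le_trans (le_normcD _ _)) // lerD2l (le_trans (fP _ _)).
    have b0 : 0 <= b by exact: normc_ge0.
    have a0 : 0 <= a by exact: normc_ge0.
    have bD : b <= D by exact: le_trans (normc_le_l2norm _ _) dl.
    set p := ((2 : R) ^+ l0)^-1 in p0 p1 ab *.
    have : a ^+ 2 <= (b + 4 * K * p) ^+ 2 by rewrite ler_pXn2r // nnegrE addr_ge0 // mulr_ge0 ?mulr_ge0 // ltW.
    have : b * (4 * K * p) <= D * (4 * K * p) by rewrite ler_wpM2r // mulr_ge0 ?mulr_ge0 // ltW.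
    have : (4 * K) ^+ 2 * (p * p) <= (4 * K) ^+ 2 * p by rewrite ler_wpM2l ?sqr_ge0 // ler_piMr // ltW.
    nra.
  rewrite big_split /= -mulr_suml -/M lerD2r.
  apply: (le_trans (sum_le_tsum (has_total_ell2 (xi l - xi k)) us)); rewrite tsum_ell2.
  by rewrite ler_pXn2r // nnegrE l2norm_ge0.
have ff k : has_total (fun x => normc (f x - xi k x) ^+ 2) /\
    tsum (fun x => normc (f x - xi k x) ^+ 2) <= (2 * K / 2 ^+ k) ^+ 2.
  by apply: tsum_bound => [x|s us]; [exact: sqr_ge0|exact: fin].
have [ff0 _] := ff 0%N.
(* Square summability is known for [f - xi 0], so the limit is rebuilt from that difference. *)
pose eta := xi 0%N + to_ell2 (fun x => f x - xi 0%N x).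
have etaE x : eta x = f x.
  by rewrite /eta ell2D (to_ell2_total ff0) addrC subrK.
exists eta => k; apply: l2norm_le.
  by rewrite divr_ge0 ?mulr_ge0 // ltW // exp2_gt0.
have [_ +] := ff k; congr (_ <= _); congr tsum; apply/funext => x.
by rewrite ell2D ell2N etaE.
Qed.

End Completeness.

Section Operators.
Variables (R : realType) (X : choiceType).
Local Notation C := R[i].
Local Notation H := (ell2 R X).
Local Notation op := (H -> H).
Implicit Types (xi eta zeta : H) (a : C) (c d e : R) (S T U : op) (A P : set op).

Definition opbd T c := forall xi, l2norm (T xi) <= c * l2norm xi.

Lemma linD T : linear T -> {morph T : xi eta / xi + eta}.
Proof. by move=> lT xi eta; have := lT 1 xi eta; rewrite !scale1r. Qed.

Lemma lin0 T : linear T -> T 0 = 0.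
Proof. by move=> lT; have := lT (-1) 0 0; rewrite !scaleN1r oppr0 addr0 addNr. Qed.

Lemma linZ T : linear T -> forall a xi, T (a *: xi) = a *: T xi.
Proof. by move=> lT a xi; have := lT a xi 0; rewrite !addr0 lin0 // addr0. Qed.

Lemma linB T : linear T -> {morph T : xi eta / xi - eta}.
Proof. by move=> lT xi eta; rewrite linD // -scaleN1r linZ // scaleN1r. Qed.

Lemma lin_sum T : linear T -> forall (I : Type) (r : seq I) (F : I -> H),
  T (\sum_(i <- r) F i) = \sum_(i <- r) T (F i).
Proof. by move=> lT I r F; apply: (big_morph T (linD lT) (lin0 lT)). Qed.

Lemma opbd_ge0 T c : opbd T c -> exists2 d, 0 <= d & opbd T d.
Proof.
move=> Tc; exists `|c| => // xi; apply: le_trans (Tc xi) _.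
by rewrite ler_wpM2r ?l2norm_ge0 // ler_norm.
Qed.

Lemma opbd_le T c d : c <= d -> opbd T c -> opbd T d.
Proof.
by move=> cd Tc xi; apply: le_trans (Tc xi) _; rewrite ler_wpM2r ?l2norm_ge0.
Qed.

Lemma opbdD S T c d : opbd S c -> opbd T d -> opbd (S + T) (c + d).
Proof.
move=> Sc Td xi; rewrite mulrDl; apply: le_trans (l2normD _ _) _.
exact: lerD (Sc xi) (Td xi).
Qed.

Lemma opbdZ a T c : opbd T c -> opbd (a *: T) (normc a * c).
Proof.
move=> Tc xi; rewrite -[(_ *: _) _]/(a *: T xi) l2normZ -mulrA.
by rewrite ler_wpM2l ?normc_ge0.
Qed.

Lemma opbdN T c : opbd T c -> opbd (- T) c.
Proof. by move=> Tc xi; rewrite -[(- T) xi]/(- T xi) l2normN. Qed.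

Lemma opbd_comp S T c d : 0 <= c -> opbd S c -> opbd T d -> opbd (S \o T) (c * d).
Proof.
move=> c0 Sc Td xi; apply: le_trans (Sc _) _.
by rewrite -mulrA ler_wpM2l.
Qed.

Lemma opbd0 : opbd 0 0.
Proof. by move=> xi; rewrite mul0r -[(0 : op) xi]/(0 : H) l2norm0. Qed.

Lemma opbd_id : opbd idfun 1.
Proof. by move=> xi; rewrite mul1r. Qed.

Lemma opbd_eq S T : (forall e, 0 < e -> opbd (S - T) e) -> S = T.
Proof.
move=> ST; apply/funext => xi; apply/eqP; rewrite -subr_eq0; apply/eqP/l2norm_eq0.
apply/eqP; rewrite eq_le l2norm_ge0 andbT; apply/ler_addgt0Pr => e e0.
rewrite add0r; have d0 : 0 < e / (l2norm xi + 1) by rewrite divr_gt0 // ltr_wpDl ?l2norm_ge0.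
apply: le_trans (ST _ d0 xi) _; rewrite mulrAC ler_pdivrMr ?ltr_wpDl ?l2norm_ge0 //.
by rewrite ler_pM2l // lerDl.
Qed.

Lemma bounded_lin T : bounded_op T -> linear T. Proof. by case. Qed.

Lemma bounded_opbd T : bounded_op T -> exists2 c, 0 <= c & opbd T c.
Proof. by case=> _ [c /opbd_ge0]. Qed.

Lemma opbd_bounded T c : linear T -> opbd T c -> bounded_op T.
Proof. by move=> lT Tc; split=> //; exists c. Qed.

Lemma linear_comp S T : linear S -> linear T -> linear (S \o T).
Proof. by move=> lS lT a xi eta /=; rewrite lT lS. Qed.

Lemma linear_lin a S T : linear S -> linear T -> linear (a *: S + T).
Proof.
move=> lS lT b xi eta; rewrite -![(a *: S + T) _]/(a *: S _ + T _) lS lT.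
by rewrite !scalerDr !scalerA [a * b]mulrC addrACA.
Qed.

Lemma bounded_comp S T : bounded_op S -> bounded_op T -> bounded_op (S \o T).
Proof.
move=> bS bT; have [c c0 Sc] := bounded_opbd bS; have [d d0 Td] := bounded_opbd bT.
exact: opbd_bounded (linear_comp bS.1 bT.1) (opbd_comp c0 Sc Td).
Qed.

Lemma bounded_linear_comb a S T : bounded_op S -> bounded_op T -> bounded_op (a *: S + T).
Proof.
move=> bS bT; have [c c0 Sc] := bounded_opbd bS; have [d d0 Td] := bounded_opbd bT.
exact: opbd_bounded (linear_lin a bS.1 bT.1) (opbdD (opbdZ a Sc) Td).
Qed.

Lemma bounded0 : bounded_op (0 : op).
Proof.
apply: opbd_bounded opbd0 => a xi eta.
by rewrite -![(0 : op) _]/(0 : H) scaler0 addr0.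
Qed.

Lemma bounded_id : bounded_op (idfun : op).
Proof. by apply: opbd_bounded opbd_id => a xi eta. Qed.

Lemma bounded_sub S T : bounded_op S -> bounded_op T -> bounded_op (S - T).
Proof. by move=> bS bT; rewrite addrC -scaleN1r; apply: bounded_linear_comb. Qed.

Lemma opnorm_lt T e : bounded_op T -> opnorm T < e -> opbd T e.
Proof.
move=> bT; have [c c0 Tc] := bounded_opbd bT.
move=> /inf_lt[|d [d0 Td] de]; first by exists c.
exact: opbd_le (ltW de) Td.
Qed.

Lemma opnorm_le T c : 0 <= c -> opbd T c -> opnorm T <= c.
Proof. by move=> c0 Tc; apply: ge_inf; [exists 0 => d []|]. Qed.

(** Trades the operator norm, an infimum, for explicit bounds [opbd]; halving [e] recovers the
    strict inequality. *)
Lemma norm_closedP A : A `<=` @bounded_op R X -> norm_closed A <->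
  forall T, bounded_op T -> (forall e, 0 < e -> exists2 S, A S & opbd (T - S) e) -> A T.
Proof.
move=> Ab; split=> cA T bT TS; apply: cA => // e e0.
  have e20 : 0 < e / 2 by lra.
  have [S AS Se] := TS _ e20; exists S => //.
  by apply: le_lt_trans (opnorm_le (ltW e20) Se) _; lra.
have [S AS Se] := TS e e0; exists S => //; apply: opnorm_lt => //.
by apply: bounded_sub => //; exact: Ab.
Qed.

Lemma op_complete (T_ : nat -> op) (K : R) : 0 <= K -> (forall k, linear (T_ k)) ->
  (forall k, opbd (T_ k.+1 - T_ k) (K / 2 ^+ k)) ->
  exists2 T, linear T & forall k, opbd (T - T_ k) (2 * K / 2 ^+ k).
Proof.
move=> K0 lT TS.
have /choice[T TP] xi : exists eta, forall k,
    l2norm (eta - T_ k xi) <= 2 * K / 2 ^+ k * l2norm xi.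
  have [||eta etaP] := @ell2_complete _ _ (T_^~ xi) (K * l2norm xi).
  - by rewrite mulr_ge0 ?l2norm_ge0.
  - by move=> k; rewrite mulrAC; exact: TS.
  by exists eta => k; apply: le_trans (etaP k) _; rewrite mulrA mulrAC.
exists T => [a xi eta|k xi]; last exact: TP.
apply/eqP; rewrite -subr_eq0; apply/eqP/l2norm_eq0.
apply/eqP; rewrite eq_le l2norm_ge0 andbT.
pose M := 2 * K * l2norm (a *: xi + eta) + (normc a * (2 * K * l2norm xi) + 2 * K * l2norm eta).
apply: (@le_geom _ _ _ M) => k; rewrite add0r.
have -> : T (a *: xi + eta) - (a *: T xi + T eta) =
   (T (a *: xi + eta) - T_ k (a *: xi + eta)) -
   (a *: (T xi - T_ k xi) + (T eta - T_ k eta)).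
  rewrite lT scalerBr; apply/eqP; rewrite -subr_eq0; apply/eqP.
  by apply: ell2P => x; rewrite !(ell2D, ell2N) ell20; ring.
apply: le_trans (l2normD _ _) _; rewrite l2normN /M [leRHS]mulrDl lerD //.
  by rewrite mulrAC; exact: TP.
apply: le_trans (l2normD _ _) _; rewrite l2normZ [leRHS]mulrDl lerD //.
  by rewrite -[leRHS]mulrA ler_wpM2l ?normc_ge0 // mulrAC; exact: TP.
by rewrite mulrAC; exact: TP.
Qed.

Lemma adjoint_opbd S T c : 0 < c -> is_adjoint S T -> opbd S c -> opbd T c.
Proof.
move=> c0 ST Sc eta.
(* 2 |T eta|^2 = 2 Re <S (T eta), eta> <= |S (T eta)|^2 / c^2 + c^2 |eta|^2. *)
have := ST (T eta) eta; rewrite inner_diag => E.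
have [tH eH] := half_sqP ((Complex c^-1 0) *: S (T eta)) ((Complex c 0) *: eta).
have := @real_sum_le _ _ (fun x => complex.Re (((Complex c^-1 0) *: S (T eta)) x * (((Complex c 0) *: eta) x)^*%C)) _ tH.
move=> /(_ (fun x => le_trans (normr_Re_le _) (inner_term_le _ _ _))).
rewrite eH !l2norm_normr.
have -> : real_sum (fun x => complex.Re (((Complex c^-1 0) *: S (T eta)) x * (((Complex c 0) *: eta) x)^*%C)) = l2norm (T eta) ^+ 2.
  transitivity (complex.Re (inner ((Complex c^-1 0) *: S (T eta)) ((Complex c 0) *: eta))) => //.
  rewrite innerZl innerZr E /=; field; exact: lt0r_neq0.
rewrite [X in X <= _]ger0_norm ?sqr_ge0 // !gtr0_norm ?invr_gt0 // => le1.
have le2 : c^-1 * l2norm (S (T eta)) <= l2norm (T eta).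
  by rewrite ler_pdivrMl.
have le3 : (c^-1 * l2norm (S (T eta))) ^+ 2 <= l2norm (T eta) ^+ 2.
  by rewrite ler_pXn2r // nnegrE ?l2norm_ge0 // mulr_ge0 ?l2norm_ge0 // invr_ge0 ltW.
rewrite -(@ler_pXn2r _ 2) ?nnegrE ?mulr_ge0 ?l2norm_ge0 ?(ltW c0) //.
lra.
Qed.

Lemma is_adjoint_sym S T : is_adjoint S T -> is_adjoint T S.
Proof. by move=> ST xi eta; rewrite inner_conj -ST -inner_conj. Qed.

Lemma is_adjoint_lin a S S' T T' : is_adjoint S T -> is_adjoint S' T' ->
  is_adjoint (a *: S + S') ((a^*)%C *: T + T').
Proof.
move=> ST ST' xi eta; rewrite -[(_ + _) xi]/(a *: S xi + S' xi) innerDl innerZl.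
rewrite -[(_ + _) eta]/((a^*)%C *: T eta + T' eta) innerDr innerZr ST ST'.
by case: a => u v /=; rewrite opprK.
Qed.

Lemma is_adjoint_sub S S' T T' : is_adjoint S T -> is_adjoint S' T' ->
  is_adjoint (S - S') (T - T').
Proof.
move=> ST ST' xi eta; rewrite -[(_ - _) xi]/(S xi - S' xi) innerBl.
by rewrite -[(_ - _) eta]/(T eta - T' eta) innerBr ST ST'.
Qed.

Lemma is_adjoint_comp S S' T T' : is_adjoint S T -> is_adjoint S' T' ->
  is_adjoint (S \o S') (T' \o T).
Proof. by move=> ST ST' xi eta /=; rewrite ST ST'. Qed.

Lemma inner_inj xi eta : (forall zeta, inner zeta xi = inner zeta eta) -> xi = eta.
Proof.
move=> E; apply/eqP; rewrite -subr_eq0; apply/eqP/l2norm_eq0.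
have : inner (xi - eta) (xi - eta) = 0 by rewrite innerBr E subrr.
by rewrite inner_diag => -[/eqP]; rewrite sqrf_eq0 => /eqP.
Qed.

Lemma adjoint_unique S T T' : is_adjoint S T -> is_adjoint S T' -> T = T'.
Proof.
move=> ST ST'; apply/funext => eta; apply: inner_inj => xi.
by rewrite -ST -ST'.
Qed.

Lemma bounded_ext S T : bounded_op S -> bounded_op T ->
  (forall x, S (ebasis R x) = T (ebasis R x)) -> S = T.
Proof.
move=> bS bT ST; have bD := bounded_sub bS bT.
have D0 x : (S - T) (ebasis R x) = 0.
  by rewrite -[(S - T) _]/(S (ebasis R x) - T (ebasis R x)) ST subrr.
have [c c0 Dc] := bounded_opbd bD.
apply/funext => xi; apply/eqP; rewrite -subr_eq0; apply/eqP/l2norm_eq0/eqP.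
rewrite eq_le l2norm_ge0 andbT; apply/ler_addgt0Pr => e e0; rewrite add0r.
have d0 : 0 < e / (c + 1) by rewrite divr_gt0 // ltr_wpDl.
have [s us sd] := ell2_approx xi d0.
have -> : S xi - T xi = (S - T) (xi - \sum_(x <- s) xi x *: ebasis R x).
  rewrite (linB bD.1) (lin_sum bD.1) big1 ?subr0 // => x _.
  by rewrite (linZ bD.1) D0 scaler0.
apply: le_trans (Dc _) _; apply: le_trans (ler_wpM2l c0 sd) _.
by rewrite mulrCA ler_piMr ?(ltW e0) // ler_pdivrMr ?ltr_wpDl // mul1r lerDl.
Qed.

End Operators.

(** * Norm closures of star algebras *)

Section Closure.
Variables (R : realType) (X : choiceType).
Local Notation C := R[i].
Local Notation H := (ell2 R X).
Local Notation op := (H -> H).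
Implicit Types (xi eta zeta : H) (a : C) (c d e : R) (S T U : op) (A P : set op).

(** Adjoints are required to exist here, whereas [cstar_algebra] only asks to contain those that do;
    [cl_adjoint] carries existence over to the closure. *)
Record star_algebra A : Prop := {
  star_bounded : A `<=` @bounded_op R X ;
  star_zero : A 0 ;
  star_lin : forall a S T, A S -> A T -> A (a *: S + T) ;
  star_mul : forall S T, A S -> A T -> A (S \o T) ;
  star_adj : forall S, A S -> exists2 T, A T & is_adjoint S T }.

Definition cl A : set op := [set T | bounded_op T /\
  forall e, 0 < e -> exists2 S, A S & opbd (T - S) e].

Variable A : set op.
Hypothesis sA : star_algebra A.

Lemma sub_cl : A `<=` cl A.
Proof.
move=> T AT; split; first exact: (star_bounded sA).
by move=> e e0; exists T => //; rewrite subrr; apply: opbd_le (ltW e0) (@opbd0 _ _).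
Qed.

Lemma cl_cstar : cstar_algebra (cl A).
Proof.
split.
- by move=> T [].
- exact/sub_cl/(star_zero sA).
- move=> a S T [bS aS] [bT aT]; split; first exact: bounded_linear_comb.
  move=> e e0; have d0 : 0 < e / 2 / (normc a + 1).
    by rewrite divr_gt0 ?ltr_wpDl ?normc_ge0 //; lra.
  have e20 : 0 < e / 2 by lra.
  have [S' AS' S'd] := aS _ d0; have [T' AT' T'd] := aT _ e20.
  exists (a *: S' + T'); first exact: (star_lin sA).
  have -> : a *: S + T - (a *: S' + T') = a *: (S - S') + (T - T').
    by rewrite scalerBr opprD addrACA.
  apply: opbd_le (opbdD (opbdZ a S'd) T'd).
  have a1 : 0 < normc a + 1 by rewrite ltr_wpDl ?normc_ge0.
  have : normc a * (e / 2 / (normc a + 1)) <= e / 2.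
    by rewrite mulrCA ler_piMr ?(ltW e20) // ler_pdivrMr // mul1r lerDl.
  lra.
- move=> S T [bS aS] [bT aT]; split; first exact: bounded_comp.
  move=> e e0; have e20 : 0 < e / 2 by lra.
  have [c c0 Tc] := bounded_opbd bT.
  have d0 : 0 < e / 2 / (c + 1) by rewrite divr_gt0 ?ltr_wpDl.
  have [S' AS' S'd] := aS _ d0.
  have [c' c'0 S'c] := bounded_opbd (star_bounded sA AS').
  have d'0 : 0 < e / 2 / (c' + 1) by rewrite divr_gt0 ?ltr_wpDl.
  have [T' AT' T'd] := aT _ d'0.
  exists (S' \o T'); first exact: (star_mul sA).
  have -> : (S \o T) - (S' \o T') = ((S - S') \o T) + (S' \o (T - T')).
    apply/funext => xi; rewrite -[LHS]/(S (T xi) - S' (T' xi)).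
    rewrite -[RHS]/(S (T xi) - S' (T xi) + S' (T xi - T' xi)).
    by rewrite (linB (star_bounded sA AS').1) addrA subrK.
  apply: opbd_le (opbdD (opbd_comp (ltW d0) S'd Tc) (opbd_comp c'0 S'c T'd)).
  have : e / 2 / (c + 1) * c <= e / 2.
    by rewrite -mulrA ler_piMr ?(ltW e20) // ler_pdivrMl ?ltr_wpDl // mulr1 lerDl.
  have : c' * (e / 2 / (c' + 1)) <= e / 2.
    by rewrite mulrCA ler_piMr ?(ltW e20) // ler_pdivrMr ?ltr_wpDl // mul1r lerDl.
  lra.
- move=> S T [bS aS] bT ST; split=> [//|e e0].
  have [S' AS' S'e] := aS _ e0; have [T' AT' ST'] := star_adj sA AS'.
  by exists T'; [exact: AT' | exact: adjoint_opbd (is_adjoint_sub ST ST') S'e].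
- apply/norm_closedP; first by move=> T [].
  move=> T bT aT; split=> // e e0; have e20 : 0 < e / 2 by lra.
  have [S [bS aS] Se] := aT _ e20; have [S' AS' S'e] := aS _ e20.
  exists S' => //; rewrite -(subrK S T) -addrA.
  by apply: opbd_le (opbdD Se S'e); lra.
Qed.

Lemma cl_generated G : G `<=` cl A -> cstar_generated G `<=` cl A.
Proof. by move=> GA T; apply; exact: conj cl_cstar GA. Qed.

Lemma adjoint_limit (T : op) (S_ S'_ : nat -> op) K : 0 <= K ->
  bounded_op T -> (forall k, opbd (T - S_ k) (K / 2 ^+ k)) ->
  (forall k, is_adjoint (S_ k) (S'_ k)) ->
  forall T' K', (forall k, opbd (T' - S'_ k) (K' / 2 ^+ k)) -> is_adjoint T T'.
Proof.
move=> K0 bT TS SS' T' K' TS' xi eta.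
apply/eqP; rewrite -subr_eq0; apply/eqP/eq0_normc/eqP; rewrite eq_le normc_ge0 andbT.
pose M := 2 * (K * l2norm xi * l2norm eta) + 2 * (l2norm xi * (K' * l2norm eta)).
apply: (@le_geom _ _ _ M) => k; rewrite add0r.
have -> : inner (T xi) eta - inner xi (T' eta) =
    inner ((T - S_ k) xi) eta - inner xi ((T' - S'_ k) eta).
  rewrite -[(T - _) xi]/(T xi - S_ k xi) -[(T' - _) eta]/(T' eta - S'_ k eta).
  by rewrite innerBl innerBr SS'; ring.
apply: le_trans (le_normcD _ _) _; rewrite normcN /M mulrDl lerD //.
  apply: le_trans (inner_le _ _) _; rewrite -[leRHS]mulrA ler_pM2l // [leRHS]mulrAC.
  by rewrite ler_wpM2r ?l2norm_ge0 // [leRHS]mulrAC; exact: TS.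
apply: le_trans (inner_le _ _) _; rewrite -[leRHS]mulrA ler_pM2l // -[leRHS]mulrA.
by rewrite ler_wpM2l ?l2norm_ge0 // [leRHS]mulrAC; exact: TS'.
Qed.

(** Approximate [T] geometrically within [A]. Adjoints satisfy the same bounds by [adjoint_opbd], so
    the adjoints of the approximants converge too, and their limit is the adjoint of [T]. *)
Lemma cl_adjoint T : cl A T -> exists2 T', cl A T' & is_adjoint T T'.
Proof.
move=> [bT aT].
have /choice[S_ SP] k : exists S, A S /\ opbd (T - S) (1 / 2 ^+ k).
  by have [|S ? ?] := aT (1 / 2 ^+ k); [rewrite divr_gt0 ?exp2_gt0|exists S].
have /choice[S'_ SP'] k : exists S', A S' /\ is_adjoint (S_ k) S'.
  by have [S' ? ?] := star_adj sA (SP k).1; exists S'.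
have lS' k : linear (S'_ k) by exact: bounded_lin (star_bounded sA (SP' k).1).
have dS k : opbd (S_ k.+1 - S_ k) (2 / 2 ^+ k).
  have -> : S_ k.+1 - S_ k = (T - S_ k) - (T - S_ k.+1).
    by rewrite opprB [RHS]addrC addrA subrK.
  apply: opbd_le (opbdD (SP k).2 (opbdN (SP k.+1).2)).
  have p0 := exp2_gt0 R k; rewrite exprS invfM.
  have : 0 < (2 ^+ k : R)^-1 by rewrite invr_gt0.
  lra.
have dS' k : opbd (S'_ k.+1 - S'_ k) (2 / 2 ^+ k).
  apply: adjoint_opbd (dS k); first by rewrite divr_gt0 ?exp2_gt0.
  by apply: is_adjoint_sub; exact: (SP' _).2.
have [//|//|//|T' lT' T'P] := @op_complete _ _ S'_ 2.
have TT' : is_adjoint T T'.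
  exact: (adjoint_limit ler01 bT (fun k => (SP k).2) (fun k => (SP' k).2) T'P).
have bT' : bounded_op T'.
  have [c c0 Tc] := bounded_opbd bT.
  apply: (opbd_bounded lT' (adjoint_opbd (c := c + 1) _ TT' _)); first by rewrite ltr_wpDl.
  by apply: opbd_le Tc; rewrite lerDl.
by exists T'; [exact: (cstar_adj cl_cstar) TT' | exact: TT'].
Qed.

End Closure.

(** * Square roots and continuity of tracial states *)

Section SquareRoot.
Variables (R : realType) (X : choiceType).
Local Notation C := R[i].
Local Notation H := (ell2 R X).
Local Notation op := (H -> H).
Variables (A : set op).
Hypotheses (cA : cstar_algebra A) (A1 : A idfun).
Implicit Types (a : C) (S T Y : op).

Let half : C := Complex 2^-1 0.

Lemma normc_half : normc half = 2^-1.
Proof. by rewrite /half /= expr0n addr0 sqrtr_sqr ger0_norm //; lra. Qed.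

Lemma half_half : half + half = 1.
Proof. by rewrite /half; congr Complex; rewrite ?addr0 //; lra. Qed.

Lemma cstar_add S T : A S -> A T -> A (S + T).
Proof. by move=> AS AT; have := cstar_lin cA 1 AS AT; rewrite scale1r. Qed.

Lemma cstar_scale a T : A T -> A (a *: T).
Proof. by move=> AT; have := cstar_lin cA a AT (cstar_zero cA); rewrite addr0. Qed.

Lemma cstar_sub S T : A S -> A T -> A (S - T).
Proof. by move=> AS AT; rewrite -scaleN1r; apply/cstar_add/cstar_scale. Qed.

Lemma adjointD S S' T T' : is_adjoint S T -> is_adjoint S' T' ->
  is_adjoint (S + S') (T + T').
Proof. by move=> h h'; have := is_adjoint_lin 1 h h'; rewrite rmorph1 !scale1r. Qed.

Lemma adjointZ a S T : is_adjoint S T -> is_adjoint (a *: S) ((a^*)%C *: T).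
Proof.
move=> h xi eta; rewrite -[(a *: S) xi]/(a *: S xi) -[X in _ = inner _ X]/((a^*)%C *: T eta).
by rewrite innerZl innerZr h; case: a => u v /=; rewrite opprK.
Qed.

Lemma adjoint_id : is_adjoint (idfun : op) idfun. Proof. by []. Qed.

(** Exhibits [1 - a] as the square of a self-adjoint element of the algebra, so that a state is
    nonnegative on it. *)
Lemma one_sub_sqrt (a : op) : A a -> is_adjoint a a -> opbd a (3 / 4) ->
  exists S, [/\ A S, is_adjoint S S & S \o S = idfun - a].
Proof.
move=> Aa aa a34.
(* Y = (a + Y^2) / 2 has a fixed point in the ball of radius 1/2; S = 1 - Y. *)
pose Y_ := fix Y k : op := if k is k'.+1 then half *: (a + (Y k' \o Y k')) else 0.
have AY k : A (Y_ k).
  elim: k => [|k IHk] /=; first exact: cstar_zero.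
  by apply/cstar_scale/cstar_add => //; exact: cstar_mul.
have bY k : bounded_op (Y_ k) by exact: (cstar_bounded cA).
have lY k : linear (Y_ k) by exact: (bY k).1.
have half_real : (half^*)%C = half by rewrite /half /= oppr0.
have Yadj k : is_adjoint (Y_ k) (Y_ k).
  elim: k => [|k IHk] /=.
    by move=> xi eta; rewrite -[(0 : op) xi]/(0 : H) -[(0 : op) eta]/(0 : H) inner0l inner_conj inner0l conjc0.
  rewrite -{2}half_real; apply/adjointZ/adjointD => //.
  exact: is_adjoint_comp.
have h0 : (0 : R) <= 2^-1 by lra.
(* The radius 1/2 is preserved because (3/4 + 1/4)/2 = 1/2; on this ball the iteration does not
   enlarge differences by more than the factor (1/2 + 1/2)/2 = 1/2. *)
have Yb k : opbd (Y_ k) 2^-1.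
  elim: k => [|k IHk] /=; first exact: opbd_le h0 (@opbd0 _ _).
  apply: opbd_le (opbdZ half (opbdD a34 (opbd_comp h0 IHk IHk))).
  by rewrite normc_half; lra.
have YS k : opbd (Y_ k.+1 - Y_ k) (1 / 2 ^+ k).
  elim: k => [|k IHk].
    rewrite /= subr0; apply: opbd_le (opbdZ half (opbdD a34 (opbd_comp h0 (Yb 0%N) (Yb 0%N)))).
    by rewrite normc_half expr0; lra.
  have -> : Y_ k.+2 - Y_ k.+1 =
     half *: ((Y_ k.+1 \o (Y_ k.+1 - Y_ k)) + ((Y_ k.+1 - Y_ k) \o Y_ k)).
    have -> : (Y_ k.+1 \o (Y_ k.+1 - Y_ k)) + ((Y_ k.+1 - Y_ k) \o Y_ k) =
       (Y_ k.+1 \o Y_ k.+1) - (Y_ k \o Y_ k).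
      apply/funext => xi.
      rewrite -[LHS]/(Y_ k.+1 (Y_ k.+1 xi - Y_ k xi) + (Y_ k.+1 (Y_ k xi) - Y_ k (Y_ k xi))).
      by rewrite (linB (lY k.+1)) addrA subrK.
    rewrite -[Y_ k.+2]/(half *: (a + (Y_ k.+1 \o Y_ k.+1))).
    rewrite -[X in _ - X = _]/(half *: (a + (Y_ k \o Y_ k))).
    by rewrite -scalerBr [in LHS]opprD addrACA subrr add0r.
  have p0 : (0 : R) <= 1 / 2 ^+ k by rewrite divr_ge0 // ltW // exp2_gt0.
  apply: opbd_le (opbdZ half (opbdD (opbd_comp h0 (Yb k.+1) IHk) (opbd_comp p0 IHk (Yb k)))).
  rewrite normc_half exprS invfM; lra.
have [Y linY YP] := op_complete ler01 lY YS.
have bYY : bounded_op Y.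
  apply: opbd_bounded linY (_ : opbd Y 2).
  by have := YP 0%N; rewrite subr0 expr0 => W; apply: opbd_le W; lra.
have Y2 : opbd Y 2 by have := YP 0%N; rewrite subr0 expr0 => W; apply: opbd_le W; lra.
have small e : 0 < e -> exists k, (2 : R) * 1 / 2 ^+ k <= e.
  move=> e0; exists (Num.bound (2 / e)).
  have := upper_nthrootP (leqnn (Num.bound (2 / e))).
  by rewrite ler_pdivrMr ?exp2_gt0 // ltr_pdivrMr // mulrC => /ltW; lra.
have AYY : A Y.
  have /norm_closedP W := cstar_closed cA; apply: W (cstar_bounded cA) _ bYY _.
  by move=> e /small[k ke]; exists (Y_ k) => //; exact: opbd_le ke (YP k).
have YY : is_adjoint Y Y.
  by apply: (@adjoint_limit _ _ Y Y_ Y_ (2 * 1)) (YP) => //; exact: YP.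
have Yfix : Y = half *: (a + (Y \o Y)).
  apply: opbd_eq => e e0; have [|k ke] := small (e / 8); first by lra.
  have -> : Y - half *: (a + (Y \o Y)) = (Y - Y_ k.+1) +
      half *: ((Y_ k \o (Y_ k - Y)) + ((Y_ k - Y) \o Y)).
    have -> : (Y_ k \o (Y_ k - Y)) + ((Y_ k - Y) \o Y) = (Y_ k \o Y_ k) - (Y \o Y).
      apply/funext => xi.
      rewrite -[LHS]/(Y_ k (Y_ k xi - Y xi) + (Y_ k (Y xi) - Y (Y xi))).
      by rewrite (linB (lY k)) addrA subrK.
    rewrite -[Y_ k.+1]/(half *: (a + (Y_ k \o Y_ k))).
    have -> : (Y_ k \o Y_ k) - (Y \o Y) = (a + (Y_ k \o Y_ k)) - (a + (Y \o Y)).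
      by rewrite opprD addrACA subrr add0r.
    by rewrite scalerBr addrA subrK.
  have p0 : (0 : R) <= 2 * 1 / 2 ^+ k by rewrite divr_ge0 // ltW // exp2_gt0.
  have YkY : opbd (Y_ k - Y) (2 * 1 / 2 ^+ k) by rewrite -opprB; exact/opbdN/YP.
  apply: opbd_le (opbdD (YP k.+1)
    (opbdZ half (opbdD (opbd_comp h0 (Yb k) YkY) (opbd_comp p0 YkY Y2)))).
  move: p0 ke; rewrite normc_half exprS invfM mulr1; set p := (2 ^+ k)^-1; lra.
exists (idfun - Y); split.
- exact: cstar_sub.
- exact: is_adjoint_sub.
apply/funext => xi; rewrite -[LHS]/((xi - Y xi) - Y (xi - Y xi)) (linB linY).
rewrite -[RHS]/(xi - a xi).
have y2 : Y xi + Y xi = a xi + Y (Y xi).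
  rewrite [in LHS]Yfix -[X in X + X = _]/(half *: (a xi + Y (Y xi))).
  by rewrite -scalerDl half_half scale1r.
by rewrite opprB addrACA -opprD y2 opprD addrACA subrr addr0.
Qed.

Section State.
Variable psi : op -> C.
Hypothesis tpsi : tracial_state A psi.

Lemma stateD S T : A S -> A T -> psi (S + T) = psi S + psi T.
Proof.
by move=> AS AT; have := state_lin tpsi 1 AS AT; rewrite scale1r mul1r.
Qed.

Lemma state0 : psi 0 = 0.
Proof.
have := stateD (cstar_zero cA) (cstar_zero cA); rewrite addr0.
by move/(congr1 (fun z => z - psi 0)); rewrite subrr addrK => <-.
Qed.

Lemma stateZ a T : A T -> psi (a *: T) = a * psi T.
Proof.
by move=> AT; have := state_lin tpsi a AT (cstar_zero cA); rewrite addr0 state0 addr0.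
Qed.

(** States are defined by positivity alone, so their continuity is derived. After scaling by
    [3 / 4 / r], both 1 - a and 1 + a are squares of self-adjoint elements; this makes [psi a] real
    and bounds it by 4r/3. *)
Lemma adjoint_real_bound (a : op) (r : R) : A a -> is_adjoint a a -> 0 < r -> opbd a r -> normc (psi a) <= 2 * r.
Proof.
move=> Aa aa r0 ar.
have one b : A b -> is_adjoint b b -> opbd b (3 / 4) -> 0 <= 1 - psi b.
  move=> Ab bb b34; have [S [AS SS SE]] := one_sub_sqrt Ab bb b34.
  have := state_pos tpsi AS AS SS; rewrite SE.
  have -> : idfun - b = (-1) *: b + idfun by rewrite addrC scaleN1r.
  by rewrite (state_lin tpsi) // (state_unit tpsi) mulN1r addrC.
pose t : C := Complex (3 / 4 / r) 0.
have t0 : 0 < 3 / 4 / r by rewrite divr_gt0 //; lra.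
have nt : normc t = 3 / 4 / r by rewrite /t /= expr0n addr0 sqrtr_sqr gtr0_norm.
have tb s : s = t \/ s = - t -> 0 <= 1 - s * psi a.
  move=> st; rewrite -stateZ //; apply: one; first exact: cstar_scale.
    have s_real : (s^*)%C = s by case: st => ->; apply/eqP; rewrite eq_complex /= !oppr0 !eqxx.
    by rewrite -{2}s_real; exact: adjointZ.
  apply: opbd_le (opbdZ s ar).
  have -> : normc s = 3 / 4 / r by case: st => ->; rewrite ?normcN.
  by rewrite mulrVK // unitfE gt_eqF.
have := tb _ (or_introl erefl); have := tb _ (or_intror erefl).
rewrite !lecE /t; case: (psi a) => u v /=.
rewrite !(mul0r, mulr0, oppr0, addr0, add0r, subr0, sub0r, mulNr, opprK).
move=> /andP[/eqP im h1] /andP[_ h2].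
have v0 : v = 0.
  by move/eqP: im; rewrite mulf_eq0 gt_eqF // => /eqP.
rewrite v0 expr0n addr0 sqrtr_sqr ler_norml.
have e : 3 / 4 / r * r = 3 / 4 by rewrite mulrVK // unitfE gt_eqF.
by apply/andP; split; rewrite -(ler_pM2l t0) ?mulrN; lra.
Qed.

Hypothesis adjA : forall T, A T -> exists2 T', A T' & is_adjoint T T'.

(** Decompose T into self-adjoint parts as (T + T')/2 - (i/2)(iT + S'), with T' and S' the adjoints
    of T and iT. Each sum has bound 2r, and the two halves add up to 4r. *)
Lemma tracial_bound T (r : R) : A T -> 0 < r -> opbd T r -> normc (psi T) <= 4 * r.
Proof.
move=> AT r0 Tr.
have sum S : A S -> opbd S r ->
    exists S', [/\ A S', is_adjoint S S' & normc (psi (S + S')) <= 4 * r].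
  move=> AS Sr; have [S' AS' SS'] := adjA AS; exists S'; split=> //.
  have -> : 4 * r = 2 * (r + r) by lra.
  apply: adjoint_real_bound; first exact: cstar_add.
  - by rewrite {2}[S + S']addrC; apply: adjointD => //; exact: is_adjoint_sym.
  - by lra.
  - exact: opbdD Sr (adjoint_opbd r0 SS' Sr).
pose i1 : C := Complex 0 1.
have ni : normc i1 = 1 by rewrite /i1 /= expr0n add0r expr1n sqrtr1.
have [T' [AT' TT' le1]] := sum T AT Tr.
have [|S' [AS' SS' le2]] := sum (i1 *: T) (cstar_scale _ AT).
  by have := opbdZ i1 Tr; rewrite ni mul1r.
have SE : S' = (i1^*)%C *: T' by apply: adjoint_unique SS' (adjointZ _ TT').
have -> : T = half *: (T + T') + (- (half * i1)) *: (i1 *: T + S').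
  rewrite SE !scalerDr !scalerA.
  have -> : - (half * i1) * i1 = half.
    by rewrite /half /i1; apply/eqP; rewrite eq_complex /=; apply/andP; split; apply/eqP; ring.
  have -> : - (half * i1) * (i1^*)%C = - half.
    by rewrite /half /i1; apply/eqP; rewrite eq_complex /=; apply/andP; split; apply/eqP; ring.
  by rewrite addrACA -!scalerDl half_half subrr scale0r addr0 scale1r.
have AX : A (T + T') by exact: cstar_add.
have AZ : A (i1 *: T + S') by exact/cstar_add/AS'/cstar_scale.
rewrite stateD ?stateZ //; [|exact: cstar_scale..].
apply: le_trans (le_normcD _ _) _.
rewrite !normcM normcN normcM ni normc_half; lra.
Qed.

End State.

End SquareRoot.

(** * The crossed product as a closed span of monomial unitaries *)

Section Span.
Variables (R : realType) (X : choiceType).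
Local Notation C := R[i].
Local Notation H := (ell2 R X).
Local Notation op := (H -> H).
Implicit Types (a : C) (S T U : op) (P Q : set op).

Inductive lspan P : op -> Prop :=
| lspan0 : lspan P 0
| lspanS a S T : P S -> lspan P T -> lspan P (a *: S + T).

Lemma lspan_sub P : P `<=` lspan P.
Proof.
by move=> S PS; have := lspanS 1 PS (lspan0 P); rewrite scale1r addr0.
Qed.

Lemma lspanD P S T : lspan P S -> lspan P T -> lspan P (S + T).
Proof.
elim=> [|a S' S1 PS' _ IH] lT; first by rewrite add0r.
by rewrite -addrA; apply: lspanS => //; exact: IH.
Qed.

Lemma lspanZ P a S : lspan P S -> lspan P (a *: S).
Proof.
elim=> [|b S' T PS' _ IH]; first by rewrite scaler0; exact: lspan0.
by rewrite scalerDr scalerA; apply: lspanS.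
Qed.

Lemma lspan_mono P Q : P `<=` lspan Q -> lspan P `<=` lspan Q.
Proof.
move=> PQ _ [|a S T PS lT]; first exact: lspan0.
apply: lspanD; first exact/lspanZ/PQ.
elim: lT => [|b S' T' PS' _ IH]; first exact: lspan0.
by apply: lspanD => //; exact/lspanZ/PQ.
Qed.

Lemma lspan_star P :
  P `<=` @bounded_op R X ->
  (forall S T, P S -> P T -> lspan P (S \o T)) ->
  (forall S, P S -> exists2 T, lspan P T & is_adjoint S T) ->
  star_algebra (lspan P).
Proof.
move=> Pb PM Padj.
have lb T : lspan P T -> bounded_op T.
  elim=> [|a S T' PS _ bT']; first exact: bounded0.
  by apply: bounded_linear_comb => //; exact: Pb.
split=> //; first exact: lspan0.
- by move=> a S T lS lT; apply: lspanD => //; exact: lspanZ.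
- move=> S T lS lT; elim: lS => [|a S' S1 PS' _ IH].
    by rewrite (_ : _ \o _ = 0) //; exact: lspan0.
  have -> : (a *: S' + S1) \o T = a *: (S' \o T) + (S1 \o T) by [].
  apply: lspanD => //; apply: lspanZ.
  elim: lT => [|b T' T1 PT' lT1 IHT].
    rewrite (_ : _ \o _ = 0); first exact: lspan0.
    by apply/funext => xi /=; rewrite (lin0 (Pb _ PS').1).
  have -> : S' \o (b *: T' + T1) = b *: (S' \o T') + (S' \o T1).
    by apply/funext => xi; exact: (Pb _ PS').1.
  by apply: lspanD IHT; exact/lspanZ/PM.
- move=> S; elim=> [|a S' T PS' _ [T1 lT1 TT1]].
    exists 0; first exact: lspan0.
    by move=> xi eta; rewrite -[(0 : op) xi]/(0 : H) -[(0 : op) eta]/(0 : H) inner0l inner_conj inner0l conjc0.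
  have [S1 lS1 SS1] := Padj _ PS'; exists ((a^*)%C *: S1 + T1).
    by apply: lspanD => //; exact: lspanZ.
  exact: is_adjoint_lin.
Qed.

(** Boundedness of the elements of the intersection is read off its member [B]; the other clauses
    pass to intersections. *)
Lemma cstar_generated_cstar (Gs B : set op) : Gs `<=` B -> cstar_algebra B ->
  cstar_algebra (cstar_generated Gs).
Proof.
move=> GB cB; split.
- by move=> T; move/(_ B (conj cB GB)); exact: (cstar_bounded cB).
- by move=> B' [cB' _]; exact: (cstar_zero cB').
- by move=> a S T AS AT B' B'P; apply: (cstar_lin B'P.1); [exact: AS|exact: AT].
- by move=> S T AS AT B' B'P; apply: (cstar_mul B'P.1); [exact: AS|exact: AT].
- by move=> S T AS bT ST B' B'P; apply: (cstar_adj B'P.1) ST; [exact: AS|].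
- move=> T bT TS B' B'P; apply: (cstar_closed B'P.1) => // e e0.
  by have [S AS Se] := TS e e0; exists S => //; exact: AS.
Qed.

Lemma cstar_generated_sub (Gs : set op) : Gs `<=` cstar_generated Gs.
Proof. by move=> T GT B [_ GB]; exact: GB. Qed.

Lemma lspan_cstar P A : cstar_algebra A -> P `<=` A -> lspan P `<=` A.
Proof.
move=> cA PA T; elim=> [|a S T' PS _ AT']; first exact: cstar_zero.
by apply: cstar_lin => //; exact: PA.
Qed.

Lemma cl_cstar_sub P A : cstar_algebra A -> P `<=` A -> cl P `<=` A.
Proof.
move=> cA PA T [bT aT]; have /norm_closedP W := cstar_closed cA.
apply: W (cstar_bounded cA) _ bT _ => e e0.
by have [S PS Se] := aT e e0; exists S => //; exact: PA.
Qed.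

End Span.

Section Monomial.
Variables (R : realType) (X : choiceType).
Local Notation C := R[i].
Local Notation H := (ell2 R X).
Variables (T : H -> H) (w : X -> C) (p : X -> X).
Hypothesis TE : forall xi q, T xi q = w q * xi (p q).
Hypothesis w1 : forall q, normc (w q) = 1.
Hypothesis pbij : bijective p.

Lemma mono_linear : linear T.
Proof.
by move=> a xi eta; apply: ell2P => q; rewrite ell2D ell2Z !TE ell2D ell2Z; ring.
Qed.

Lemma mono_isometry xi : l2norm (T xi) = l2norm xi.
Proof.
rewrite /l2norm -(sqnorm_reindex xi pbij w1); congr (Num.sqrt (fine (sqnorm _))).
by apply/funext => q; exact: TE.
Qed.

Lemma mono_opbd : opbd T 1.
Proof. by move=> xi; rewrite mul1r mono_isometry. Qed.

Lemma mono_bounded : bounded_op T.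
Proof. exact: opbd_bounded mono_linear mono_opbd. Qed.

Lemma mono_adjoint (T' : H -> H) (w' : X -> C) (p' : X -> X) :
  (forall xi q, T' xi q = w' q * xi (p' q)) ->
  (forall q, p' (p q) = q) -> (forall q, ((w' (p q))^*)%C = w q) -> is_adjoint T T'.
Proof.
move=> T'E pK wE xi eta; rewrite /inner -[RHS](complex_sum_reindex _ pbij).
congr complex_sum; apply/funext => q /=.
by rewrite TE T'E rmorphM /= wE pK; ring.
Qed.

End Monomial.

Lemma commute_adjoint (R : realType) (X : choiceType)
    (S S' U U' : ell2 R X -> ell2 R X) :
  is_adjoint S S' -> is_adjoint U U' -> S \o U = U \o S -> S' \o U' = U' \o S'.
Proof.
move=> SS' UU' SU; apply: (@adjoint_unique _ _ (U \o S)); last rewrite -SU.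
  exact: is_adjoint_comp.
exact: is_adjoint_comp.
Qed.

(** * The unitaries of the crossed product, right translations and the canonical trace *)

Section CrossedProduct.
Variables (R : realType) (G F : groupType) (act : G -> F -> F) (phi : G -> F -> R[i]).
Hypothesis actM : forall a b x, act (a * b)%g x = act a (act b x).
Hypothesis act1 : forall x, act 1%g x = x.
Hypothesis act_mul : forall a x y, act a (x * y)%g = (act a x * act a y)%g.
Hypothesis phiP : cocycle act phi.
Local Notation C := R[i].
Local Notation H0 := (ell2 R F).
Local Notation H := (ell2 R (G * F)%type).
Local Notation op0 := (H0 -> H0).
Local Notation op := (H -> H).
Local Notation theta := (deformed_action act phi).
Local Notation u_ := (deform_unitary act phi).

Lemma act_one a : act a 1%g = 1%g.
Proof. by apply: (mulgI (act a 1%g)); rewrite -act_mul !mulg1. Qed.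

Lemma act_inv a x : act a x^-1%g = (act a x)^-1%g.
Proof. by apply: (mulgI (act a x)); rewrite -act_mul !mulgV act_one. Qed.

Lemma phi_nz a x : phi a x != 0.
Proof. by rewrite -normr_eq0 (cocycle_circle phiP) oner_eq0. Qed.

Lemma phi_one a : phi a 1%g = 1.
Proof. by apply: (mulfI (phi_nz a 1%g)); rewrite -(cocycle_hom phiP) mulg1 mulr1. Qed.

Lemma normc_phi a x : normc (phi a x) = 1.
Proof. exact/normc_norm/(cocycle_circle phiP). Qed.

Lemma phi_conj_inv a x : ((phi a x^-1%g)^*)%C = phi a x.
Proof.
apply: (mulfI (phi_nz a x^-1%g)).
rewrite -sqr_normc (cocycle_circle phiP) expr1n -(cocycle_hom phiP).
by rewrite mulVg phi_one.
Qed.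

Lemma lreg_mono x : exists w p, [/\ forall xi q, @lreg R F x xi q = w q * xi (p q),
  forall q, normc (w q) = 1 & bijective p].
Proof.
exists (fun=> 1), (fun y => x^-1 * y)%g; split=> [xi q|q|]; last exact: mulg_bij.
  by rewrite lregE mul1r.
exact: normc1.
Qed.

Lemma lreg_bounded x : bounded_op (@lreg R F x).
Proof. by have [w [p [? ? ?]]] := lreg_mono x; apply: mono_bounded. Qed.

Lemma lreg_adjoint x : is_adjoint (@lreg R F x) (lreg x^-1%g).
Proof.
apply: (@mono_adjoint _ _ _ (fun=> 1) (fun y => x^-1 * y)%g _ _ _ (fun=> 1) (fun y => x * y)%g).
- by move=> xi q; rewrite lregE mul1r.
- exact: mulg_bij.
- by move=> xi q; rewrite lregE invgK mul1r.
- by move=> q; rewrite mulVKg.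
- by move=> q; rewrite rmorph1.
Qed.

Lemma lregM x y : @lreg R F x \o lreg y = lreg (x * y)%g.
Proof.
apply/funext => xi; apply: ell2P => z /=.
by rewrite !lregE invgM mulgA.
Qed.

Lemma theta_bounded a T : bounded_op T -> bounded_op (theta a T).
Proof.
have bu b : bounded_op (u_ b).
  apply: (@mono_bounded _ _ _ (fun x => phi b (act b^-1%g x)) (act b^-1%g)).
  - by move=> xi q; rewrite (deform_unitaryE actM act1 phiP).
  - by move=> q; rewrite normc_phi.
  - exact: act_bij.
by move=> bT; rewrite /deformed_action; do 2 apply: bounded_comp => //.
Qed.

Lemma l2norm_u a xi : l2norm (u_ a xi) = l2norm xi.
Proof. by rewrite /l2norm (deform_unitary_sqnorm actM act1 phiP). Qed.

Lemma cov_opbd T c : 0 <= c -> bounded_op T -> opbd T c -> opbd (cov theta T) c.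
Proof.
move=> c0 bT Tc xi.
have : (sqnorm (cov theta T xi) <= (c ^+ 2)%:E * sqnorm xi)%E.
  rewrite !sqnorm_pair; apply: le_trans (esum_scale_le _ _); rewrite ?sqr_ge0 //; last first.
    by move=> h; exact: sqnorm_ge0.
  apply: le_esum => h _ /=.
  have -> : sqnorm (fun x => xi (h, x)) = sqnorm (slice xi h).
    by congr sqnorm; apply/funext => x; rewrite sliceE.
  have -> : sqnorm (fun x => cov theta T xi (h, x)) = sqnorm (theta h^-1%g T (slice xi h)).
    by congr sqnorm; apply/funext => x; rewrite (covE actM act1 phiP).
  rewrite !sqnormE -EFinM lee_fin -exprMn lerXn2r ?nnegrE ?mulr_ge0 ?l2norm_ge0 //.
  rewrite /deformed_action /= l2norm_u; apply: le_trans (Tc _) _.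
  by rewrite l2norm_u.
rewrite !sqnormE -EFinM lee_fin -exprMn ler_pXn2r // nnegrE ?mulr_ge0 ?l2norm_ge0 //.
Qed.

Lemma slice_lin g a (xi eta : H) :
  slice (a *: xi + eta) g = a *: slice xi g + slice eta g.
Proof. by apply: ell2P => x; rewrite ell2D ell2Z !sliceE. Qed.

Lemma cov_linear T : bounded_op T -> linear (cov theta T).
Proof.
move=> bT a xi eta; apply: ell2P => -[g x].
apply: etrans (covE actM act1 phiP (a *: xi + eta) g x bT) _.
rewrite slice_lin (theta_bounded g^-1%g bT).1.
have comb (z1 z2 : ell2 R F) c1 c2 : c1 = z1 x -> c2 = z2 x ->
  (a *: z1 + z2) x = a * c1 + c2 by move=> -> ->.
transitivity (a * cov theta T xi (g, x) + cov theta T eta (g, x)) => //.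
exact: comb (covE actM act1 phiP xi g x bT) (covE actM act1 phiP eta g x bT).
Qed.

Lemma cov_bounded T : bounded_op T -> bounded_op (cov theta T).
Proof.
move=> bT; have [c c0 Tc] := bounded_opbd bT.
exact: opbd_bounded (cov_linear bT) (cov_opbd c0 bT Tc).
Qed.

Lemma cov_lin a S T : bounded_op S -> bounded_op T ->
  cov theta (a *: S + T) = a *: cov theta S + cov theta T.
Proof.
move=> bS bT; apply/funext => xi; apply: ell2P => -[g x].
apply: etrans (covE actM act1 phiP xi g x (bounded_linear_comb a bS bT)) _.
transitivity (a * cov theta S xi (g, x) + cov theta T xi (g, x)) => //.
rewrite (covE actM act1 phiP xi g x bS) (covE actM act1 phiP xi g x bT).
pose eta := u_ (g^-1)^-1%g (slice xi g).
rewrite -[LHS]/(u_ g^-1%g (a *: S eta + T eta) x) -[X in _ = a * X + _]/(u_ g^-1%g (S eta) x).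
rewrite -[X in _ = _ + X]/(u_ g^-1%g (T eta) x); move: (S eta) (T eta) => zeta1 zeta2.
by rewrite !(deform_unitaryE actM act1 phiP) ell2D ell2Z; ring.
Qed.

(* The operators below are sealed behind opaque proofs: comparing two of them *)
(* by conversion would unfold the subtype [ell2].                             *)
Lemma V_sealed : {V : F -> op | forall y, V y = cov theta (lreg y)}.
Proof. by exists (fun y => cov theta (lreg y)). Qed.
Definition V := sval V_sealed.
Lemma V_def y : V y = cov theta (lreg y). Proof. exact: svalP V_sealed y. Qed.

Lemma Tr_sealed : {Tr : G -> op | forall b, Tr b = trans b}.
Proof. by exists (@trans R F G). Qed.
Definition Tr := sval Tr_sealed.
Lemma Tr_def b : Tr b = trans b. Proof. exact: svalP Tr_sealed b. Qed.

Lemma su_sealed : {su : G -> op0 | forall b, su b = u_ b}.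
Proof. by exists u_. Qed.
Definition su := sval su_sealed.
Lemma su_def b : su b = u_ b. Proof. exact: svalP su_sealed b. Qed.

Lemma sl_sealed : {sl : H -> G -> H0 | sl = @slice R F G}.
Proof. by exists (@slice R F G). Qed.
Definition sl := sval sl_sealed.

Lemma slE xi g x : sl xi g x = xi (g, x).
Proof. by rewrite /sl (svalP sl_sealed) sliceE. Qed.

Lemma suE a xi x : su a xi x = phi a (act a^-1%g x) * xi (act a^-1%g x).
Proof. by rewrite su_def (deform_unitaryE actM act1 phiP). Qed.

Lemma suM a b xi : su (a * b)%g xi = su a (su b xi).
Proof. by rewrite !su_def (deform_unitaryM actM act1 phiP). Qed.

Lemma cov_slE T xi g x : bounded_op T ->
  cov theta T xi (g, x) = su g^-1%g (T (su g (sl xi g))) x.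
Proof.
move=> bT; apply: etrans (covE actM act1 phiP xi g x bT) _.
by rewrite /deformed_action /sl (svalP sl_sealed) !su_def invgK.
Qed.

Lemma VE y xi g x : V y xi (g, x) =
  phi g^-1%g y * xi (g, (act g^-1%g y)^-1 * x)%g.
Proof.
rewrite V_def; apply: etrans (covE actM act1 phiP xi g x (lreg_bounded y)) _.
rewrite (deformed_action_lreg actM act1 act_mul phiP).
transitivity (phi g^-1%g y * lreg (act g^-1%g y) (slice xi g) x) => //.
by rewrite lregE sliceE.
Qed.

Lemma TrE b xi q : Tr b xi q = xi (b^-1 * q.1, q.2)%g.
Proof. by rewrite Tr_def transE. Qed.

Lemma V_M y z : V y \o V z = V (y * z)%g.
Proof.
apply/funext => xi; apply: ell2P => -[g x] /=.
by rewrite !VE (cocycle_hom phiP) act_mul invgM mulgA mulrA.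
Qed.

Lemma trans_M a b : Tr a \o Tr b = Tr (a * b)%g.
Proof.
by apply/funext => xi; apply: ell2P => -[g x] /=; rewrite !TrE /= invgM mulgA.
Qed.

Lemma trans_V b y : Tr b \o V y = phi b y *: (V (act b y) \o Tr b).
Proof.
apply/funext => xi; apply: ell2P => -[g x].
transitivity (phi b y * V (act b y) (Tr b xi) (g, x)) => //.
rewrite [LHS]TrE /= !VE TrE /=.
by rewrite invgM invgK actM (cocycle_mul phiP) mulrA [phi b y * _]mulrC.
Qed.

Lemma V_bij y : bijective (fun q : G * F => (q.1, (act q.1^-1%g y)^-1 * q.2)%g).
Proof.
exists (fun q : G * F => (q.1, act q.1^-1%g y * q.2)%g) => -[g x] /=.
  by rewrite mulVKg.
by rewrite mulKg.
Qed.

Lemma VE' y xi q : V y xi q = phi q.1^-1%g y * xi (q.1, (act q.1^-1%g y)^-1 * q.2)%g.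
Proof. by case: q => g x; exact: VE. Qed.

Lemma V_isometry y xi : l2norm (V y xi) = l2norm xi.
Proof. by apply: (mono_isometry (VE' y)) (V_bij y) _ => q; rewrite normc_phi. Qed.

Lemma V_bounded y : bounded_op (V y).
Proof. by apply: (mono_bounded (VE' y)) (V_bij y) => q; rewrite normc_phi. Qed.

Lemma V_adjoint y : is_adjoint (V y) (V y^-1%g).
Proof.
apply: (mono_adjoint (VE' y) (V_bij y) (VE' y^-1%g)) => -[g x] /=.
  by rewrite act_inv invgK mulVKg.
by rewrite phi_conj_inv.
Qed.

Lemma trans_bij (b : G) : bijective (fun q : G * F => (b^-1 * q.1, q.2)%g).
Proof.
by exists (fun q : G * F => (b * q.1, q.2)%g) => -[g x] /=; rewrite ?mulVKg ?mulKg.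
Qed.

Lemma TrE' b xi q : Tr b xi q = 1 * xi (b^-1 * q.1, q.2)%g.
Proof. by rewrite TrE mul1r. Qed.

Lemma trans_isometry b xi : l2norm (Tr b xi) = l2norm xi.
Proof. by apply: (mono_isometry (TrE' b)) (trans_bij b) _ => q; rewrite normc1. Qed.

Lemma trans_bounded b : bounded_op (Tr b).
Proof. by apply: (mono_bounded (TrE' b)) (trans_bij b) => q; rewrite normc1. Qed.

Lemma trans_adjoint b : is_adjoint (Tr b) (Tr b^-1%g).
Proof.
apply: (mono_adjoint (TrE' b) (trans_bij b) (TrE' b^-1%g)) => [[g x]|q]; last exact: rmorph1.
by rewrite /= invgK mulVKg.
Qed.

Lemma V1 : V 1%g = idfun.
Proof.
apply/funext => xi; apply: ell2P => -[g x]; rewrite [LHS]VE phi_one act_one.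
by rewrite invg1 !mul1g mul1r.
Qed.

Lemma trans1 : Tr 1%g = idfun.
Proof.
by apply/funext => xi; apply: ell2P => -[g x]; rewrite TrE /= invg1 mul1g.
Qed.

(** The unitary of the element [q] of the semidirect product of [F] by [G]; by [W_M] these multiply
    like the group up to values of [phi]. *)
Definition W (q : F * G) : op := V q.1 \o Tr q.2.

Lemma W_M y b z c : W (y, b) \o W (z, c) = phi b z *: W (y * act b z, b * c)%g.
Proof.
apply/funext => xi.
transitivity (V y ((Tr b \o V z) (Tr c xi))) => //; rewrite trans_V.
rewrite -[LHS]/(V y (phi b z *: V (act b z) (Tr b (Tr c xi)))) (linZ (V_bounded y).1).
rewrite -[RHS]/(phi b z *: V (y * act b z)%g (Tr (b * c)%g xi)).
by rewrite -V_M -trans_M.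
Qed.

Lemma W_bounded q : bounded_op (W q).
Proof. by apply: bounded_comp; [exact: V_bounded|exact: trans_bounded]. Qed.

Lemma W_isometry q xi : l2norm (W q xi) = l2norm xi.
Proof. by rewrite [LHS]V_isometry trans_isometry. Qed.

Lemma W_trans b : W (1%g, b) = Tr b. Proof. by rewrite /W V1. Qed.

Lemma W_V y : W (y, 1%g) = V y. Proof. by rewrite /W trans1. Qed.

Lemma W_adjoint q : exists2 T, lspan (range W) T & is_adjoint (W q) T.
Proof.
case: q => y b; exists (Tr b^-1%g \o V y^-1%g); last first.
  by apply: is_adjoint_comp; [exact: V_adjoint|exact: trans_adjoint].
rewrite trans_V; apply/lspanZ/lspan_sub.
by exists (act b^-1%g y^-1%g, b^-1%g).
Qed.

Lemma W_star : star_algebra (lspan (range W)).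
Proof.
apply: lspan_star.
- by move=> _ [q _ <-]; exact: W_bounded.
- move=> _ _ [[y b] _ <-] [[z c] _ <-]; rewrite W_M; apply/lspanZ/lspan_sub.
  by eexists.
- by move=> _ [q _ <-]; exact: W_adjoint.
Qed.

Lemma lreg_star : star_algebra (lspan (range (@lreg R F))).
Proof.
apply: lspan_star.
- by move=> _ [q _ <-]; exact: lreg_bounded.
- by move=> _ _ [y _ <-] [z _ <-]; rewrite lregM; apply: lspan_sub; eexists.
- move=> _ [q _ <-]; exists (lreg q^-1%g); last exact: lreg_adjoint.
  by apply: lspan_sub; eexists.
Qed.

Local Notation A := (reduced_crossed_product theta (cstar_reduced R F)).
Local Notation M := (vn_crossed_product theta (vn_group R F)).

Lemma cstar_reduced_cl : cstar_reduced R F `<=` cl (lspan (range (@lreg R F))).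
Proof.
apply: cl_generated; first exact: lreg_star.
by move=> T [x _ <-]; apply/(sub_cl lreg_star)/lspan_sub; exists x.
Qed.

Lemma cov_cl T : cl (lspan (range (@lreg R F))) T -> cl (lspan (range W)) (cov theta T).
Proof.
move=> [bT aT]; split=> [|e e0]; first exact: cov_bounded.
have [S lS Se] := aT e e0; have bS := star_bounded lreg_star lS.
exists (cov theta S); last first.
  have -> : cov theta T - cov theta S = cov theta (T - S).
    have := cov_lin (-1) bS bT; rewrite !scaleN1r => E.
    apply: etrans (addrC _ _) _; apply: etrans (esym E) _.
    by congr (cov theta _); exact: addrC.
  by apply: cov_opbd (ltW e0) _ Se; exact: bounded_sub.
elim: lS {Se bS} => [|a _ S' [x _ <-] lS' IH].
  have -> : cov theta 0 = 0.
    have := cov_lin (-1) (@bounded0 R F) (@bounded0 R F).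
    by rewrite scaler0 addr0 scaleN1r addNr.
  exact: lspan0.
rewrite cov_lin; [|exact: lreg_bounded|exact: star_bounded lreg_star _ lS'].
by apply: lspanS IH; exists (x, 1%g) => //; rewrite W_V V_def.
Qed.

Lemma crossed_gens_cl : cov theta @` cstar_reduced R F `|` range (@trans R F G) `<=` cl (lspan (range W)).
Proof.
move=> T [[S AS <-]|[b _ <-]]; first exact/cov_cl/cstar_reduced_cl.
by apply/(sub_cl W_star)/lspan_sub; exists (1%g, b) => //; rewrite W_trans Tr_def.
Qed.

Lemma crossed_cstar : cstar_algebra A.
Proof.
exact: cstar_generated_cstar crossed_gens_cl (cl_cstar W_star).
Qed.

Lemma crossed_V y : A (V y).
Proof.
rewrite V_def; apply: cstar_generated_sub; left; exists (lreg y) => //.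
by apply: cstar_generated_sub; exists y.
Qed.

Lemma crossed_trans b : A (Tr b).
Proof. by rewrite Tr_def; apply: cstar_generated_sub; right; exists b. Qed.

Lemma crossed_W q : A (W q).
Proof. exact: (cstar_mul crossed_cstar (crossed_V _) (crossed_trans _)). Qed.

Lemma crossed_id : A idfun. Proof. by rewrite -V1; exact: crossed_V. Qed.

(** Makes every element of the reduced crossed product a norm limit of finite combinations of the
    [W q], on which identities and estimates can be checked. *)
Lemma crossedE : A = cl (lspan (range W)).
Proof.
apply/seteqP; split; first exact: cl_generated W_star _ crossed_gens_cl.
apply: cl_cstar_sub crossed_cstar _; apply: lspan_cstar crossed_cstar _.
by move=> _ [q _ <-]; exact: crossed_W.
Qed.

Lemma mulgr_bij (y : F) : bijective (fun x => x * y)%g.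
Proof. by exists (fun x => x * y^-1)%g => x; rewrite ?mulgK ?mulgVK. Qed.

Lemma rho_bij (y : F) : bijective (fun q : G * F => (q.1, q.2 * y)%g).
Proof.
by exists (fun q : G * F => (q.1, q.2 * y^-1)%g) => -[g x] /=; rewrite ?mulgK ?mulgVK.
Qed.

Lemma Rb_bij (b : G) : bijective (fun q : G * F => (q.1 * b, act b^-1 q.2)%g).
Proof.
exists (fun q : G * F => (q.1 * b^-1, act b q.2)%g) => -[g x] /=.
  by rewrite mulgK (actKV actM act1).
by rewrite mulgVK (actVK actM act1).
Qed.

Lemma rho0_sealed : {rho0 : F -> op0 | forall y xi x, rho0 y xi x = 1 * xi (x * y)%g}.
Proof.
exists (fun y xi => to_ell2 (fun x => xi (x * y)%g)) => y xi x.
by rewrite mul1r to_ell2E //; exact: sq_summable_reindex1 (mulgr_bij y).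
Qed.
Definition rho0 := sval rho0_sealed.
Lemma rho0E y xi x : rho0 y xi x = 1 * xi (x * y)%g.
Proof. exact: svalP rho0_sealed y xi x. Qed.

Lemma rho_sealed : {rho : F -> op | forall y xi q, rho y xi q = 1 * xi (q.1, q.2 * y)%g}.
Proof.
exists (fun y (xi : H) => to_ell2 (fun q : G * F => xi (q.1, q.2 * y)%g)) => y xi q.
by rewrite mul1r to_ell2E //; exact: sq_summable_reindex1 (rho_bij y).
Qed.
Definition rho := sval rho_sealed.
Lemma rhoE y xi q : rho y xi q = 1 * xi (q.1, q.2 * y)%g.
Proof. exact: svalP rho_sealed y xi q. Qed.

(** Right translation on [G] alone would not commute with [cov theta T], whose fibre at [g] depends
    on [g]; applying the deformed unitary of [b] in the second coordinate repairs this. *)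
Lemma Rb_sealed : {Rb : G -> op | forall b xi q,
  Rb b xi q = phi b (act b^-1%g q.2) * xi (q.1 * b, act b^-1 q.2)%g}.
Proof.
exists (fun b (xi : H) => to_ell2 (fun q : G * F =>
  phi b (act b^-1%g q.2) * xi (q.1 * b, act b^-1 q.2)%g)) => b xi q.
rewrite to_ell2E //; apply: (sq_summable_reindex xi (Rb_bij b)) => x; exact: normc_phi.
Qed.
Definition Rb := sval Rb_sealed.
Lemma RbE b xi q : Rb b xi q = phi b (act b^-1%g q.2) * xi (q.1 * b, act b^-1 q.2)%g.
Proof. exact: svalP Rb_sealed b xi q. Qed.

Lemma rho0_bounded y : bounded_op (rho0 y).
Proof. by apply: (mono_bounded (rho0E y)) (mulgr_bij y) => q; rewrite normc1. Qed.

Lemma rho_bounded y : bounded_op (rho y).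
Proof. by apply: (mono_bounded (rhoE y)) (rho_bij y) => q; rewrite normc1. Qed.

Lemma rho_isometry y xi : l2norm (rho y xi) = l2norm xi.
Proof. by apply: (mono_isometry (rhoE y)) (rho_bij y) _ => q; rewrite normc1. Qed.

Lemma Rb_bounded b : bounded_op (Rb b).
Proof. by apply: (mono_bounded (RbE b)) (Rb_bij b) => q; rewrite normc_phi. Qed.

Lemma Rb_isometry b xi : l2norm (Rb b xi) = l2norm xi.
Proof. by apply: (mono_isometry (RbE b)) (Rb_bij b) _ => q; rewrite normc_phi. Qed.

Lemma rho0_adjoint y : is_adjoint (rho0 y) (rho0 y^-1%g).
Proof.
apply: (mono_adjoint (rho0E y) (mulgr_bij y) (rho0E y^-1%g)) => x; last exact: rmorph1.
exact: mulgK.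
Qed.

Lemma rho_adjoint y : is_adjoint (rho y) (rho y^-1%g).
Proof.
apply: (mono_adjoint (rhoE y) (rho_bij y) (rhoE y^-1%g)) => [[g x]|q]; last exact: rmorph1.
by rewrite /= mulgK.
Qed.

Lemma Rb_adjoint b : is_adjoint (Rb b) (Rb b^-1%g).
Proof.
apply: (mono_adjoint (RbE b) (Rb_bij b) (RbE b^-1%g)) => -[g x].
  by rewrite /= invgK mulgK (actKV actM act1).
rewrite [(_, _).2]/= [(_, _).2]/= invgK.
have := cocycleV_conj act1 phiP b (act b^-1%g x).
by rewrite !(actKV actM act1).
Qed.

(** The commutant of the right translations contains both the reduced and the von Neumann crossed
    product, so facts about it serve both. *)
Definition rcomm : set op := [set T | bounded_op T /\
  (forall y, T \o rho y = rho y \o T) /\ forall b, T \o Rb b = Rb b \o T].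

Lemma rcomm_trans b : rcomm (Tr b).
Proof.
split; [exact: trans_bounded|split=> [y|c]]; apply/funext => xi; apply: ell2P => -[g x] /=.
  by rewrite !(TrE, rhoE) /=.
by rewrite !(TrE, RbE) /= mulgA.
Qed.

Lemma sl_Rb b xi g : sl (Rb b xi) g = su b (sl xi (g * b)%g).
Proof. by apply: ell2P => x; rewrite slE RbE suE slE. Qed.

Lemma sl_rho y xi g : sl (rho y xi) g = rho0 y (sl xi g).
Proof. by apply: ell2P => x; rewrite slE rhoE rho0E slE. Qed.

Lemma su_rho0 g y xi : su g (rho0 y xi) = (phi g y)^-1 *: rho0 (act g y) (su g xi).
Proof.
apply: ell2P => x; rewrite [RHS]ell2Z rho0E !suE rho0E.
rewrite act_mul (actVK actM act1) (cocycle_hom phiP) !mul1r.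
by rewrite mulrA [_ * phi g y]mulrC mulKf // phi_nz.
Qed.

Lemma suZ g a xi : su g (a *: xi) = a *: su g xi.
Proof. by apply: ell2P => x; rewrite [RHS]ell2Z !suE mulrCA. Qed.

Lemma rcomm_cov T : bounded_op T -> (forall y, T \o rho0 y = rho0 y \o T) ->
  rcomm (cov theta T).
Proof.
move=> bT Tr0; split; first exact: cov_bounded.
split=> [y|b]; apply/funext => xi; apply: ell2P => -[g x].
  rewrite [LHS](cov_slE _ _ _ bT) [RHS]rhoE mul1r (cov_slE _ _ _ bT) sl_rho.
  have E eta : T (rho0 (act g y) eta) = rho0 (act g y) (T eta).
    by have := congr1 (fun f => f eta) (Tr0 (act g y)).
  rewrite su_rho0 (linZ bT.1) E suZ su_rho0 (actVK actM act1) scalerA -invfM.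
  by rewrite mulrC (cocycleV act1 phiP) invr1 scale1r rho0E mul1r.
rewrite [LHS](cov_slE _ _ _ bT) [RHS]RbE (cov_slE _ _ _ bT) sl_Rb -suM.
set eta := T _; rewrite invgM suM.
rewrite [su b^-1%g _ _]suE invgK mulrA.
have := cocycleV act1 phiP b (act b^-1%g x); rewrite (actKV actM act1) mulrC => ->.
by rewrite mul1r.
Qed.

Lemma rcomm_lin a S T : rcomm S -> rcomm T -> rcomm (a *: S + T).
Proof.
move=> [bS [Sr SR]] [bT [TrC TR]]; split; first exact: bounded_linear_comb.
split=> [y|b]; apply/funext => xi.
  rewrite -[LHS]/(a *: (S \o rho y) xi + (T \o rho y) xi) Sr TrC.
  by rewrite -[RHS]/(rho y (a *: S xi + T xi)) (rho_bounded y).1.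
rewrite -[LHS]/(a *: (S \o Rb b) xi + (T \o Rb b) xi) SR TR.
by rewrite -[RHS]/(Rb b (a *: S xi + T xi)) (Rb_bounded b).1.
Qed.

Lemma rcomm_comp S T : rcomm S -> rcomm T -> rcomm (S \o T).
Proof.
move=> [bS [Sr SR]] [bT [TrC TR]]; split; first exact: bounded_comp.
split=> [y|b].
  rewrite -[LHS]/(S \o (T \o rho y)) TrC -[LHS]/((S \o rho y) \o T) Sr //.
rewrite -[LHS]/(S \o (T \o Rb b)) TR -[LHS]/((S \o Rb b) \o T) SR //.
Qed.

Lemma lreg_rho0 x y : @lreg R F x \o rho0 y = rho0 y \o lreg x.
Proof.
by apply/funext => xi; apply: ell2P => z; rewrite [LHS]lregE [RHS]rho0E lregE rho0E mulgA.
Qed.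

Lemma rcomm_W q : rcomm (W q).
Proof.
apply: rcomm_comp (rcomm_trans _); rewrite V_def.
by apply: rcomm_cov => [|y]; [exact: lreg_bounded|exact: lreg_rho0].
Qed.

Lemma commute_cl (P : set op) (U : op) : bounded_op U -> (forall S, P S -> bounded_op S) ->
  (forall S, P S -> S \o U = U \o S) -> forall T, cl P T -> T \o U = U \o T.
Proof.
move=> bU bP PU T [bT aT]; apply: opbd_eq => e e0.
have [c c0 Uc] := bounded_opbd bU.
have d0 : 0 < e / 2 / (c + 1) by rewrite divr_gt0 ?ltr_wpDl //; lra.
have [S PS Se] := aT _ d0.
have -> : (T \o U) - (U \o T) = ((T - S) \o U) - (U \o (T - S)).
  apply/funext => xi; rewrite -[LHS]/(T (U xi) - U (T xi)).
  rewrite -[RHS]/(T (U xi) - S (U xi) - U (T xi - S xi)) (linB bU.1).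
  have := congr1 (fun f => f xi) (PU _ PS) => /= ->.
  by rewrite opprB addrA subrK.
apply: opbd_le (opbdD (opbd_comp (ltW d0) Se Uc) (opbdN (opbd_comp c0 Uc Se))).
have : e / 2 / (c + 1) * c <= e / 2.
  by rewrite -mulrA ler_piMr ?ler_pdivrMl ?ltr_wpDl // ?mulr1 ?lerDl //; lra.
lra.
Qed.

Lemma rcomm_lspan : lspan (range W) `<=` rcomm.
Proof.
move=> T; elim=> [|a _ T' [q _ <-] _ IH]; last by apply: rcomm_lin => //; exact: rcomm_W.
have := rcomm_lin (-1) (rcomm_W (1%g, 1%g)) (rcomm_W (1%g, 1%g)).
by rewrite scaleN1r addNr.
Qed.

Lemma rcomm_crossed : A `<=` rcomm.
Proof.
rewrite crossedE => T cT; split; first by case: cT.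
have bP S : lspan (range W) S -> bounded_op S by move/rcomm_lspan => [].
split=> [y|b]; apply: (commute_cl _ bP _ cT).
- exact: rho_bounded.
- by move=> S /rcomm_lspan [_ [+ _]].
- exact: Rb_bounded.
- by move=> S /rcomm_lspan [_ [_ +]].
Qed.

Local Notation vn_gens := (cov theta @` vn_group R F `|` range (@trans R F G)).

Lemma vn_group_rho0 T : vn_group R F T -> bounded_op T /\ forall y, T \o rho0 y = rho0 y \o T.
Proof.
move=> [bT TC]; split=> // y; apply: TC; split; first exact: rho0_bounded.
move=> S [[x _ <-]|[bS [_ [x _ <-] xS]]]; first by rewrite lreg_rho0.
by have := commute_adjoint xS (rho0_adjoint y^-1%g) (lreg_rho0 x _); rewrite invgK.
Qed.

Lemma vn_gens_rcomm T : (vn_gens `|` adjoints vn_gens) T -> rcomm T.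
Proof.
have gP S : vn_gens S -> rcomm S.
  move=> [[S' MS' <-]|[b _ <-]]; last by rewrite -Tr_def; exact: rcomm_trans.
  by have [bS' S'r] := vn_group_rho0 MS'; apply: rcomm_cov.
move=> [/gP //|[bT [S /gP[bS [Sr SR]] ST]]]; split=> //; split=> [y|b].
  by have := commute_adjoint ST (rho_adjoint y^-1%g) (Sr _); rewrite invgK.
by have := commute_adjoint ST (Rb_adjoint b^-1%g) (SR _); rewrite invgK.
Qed.

Lemma rcomm_vn : M `<=` rcomm.
Proof.
move=> T [bT TC]; split=> //; split=> [y|b]; apply: TC; split.
- exact: rho_bounded.
- by move=> S /vn_gens_rcomm [_ [-> _]].
- exact: Rb_bounded.
- by move=> S /vn_gens_rcomm [_ [_ ->]].
Qed.

Lemma vn_gen_M T : bounded_op T -> vn_gens T -> M T.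
Proof. by move=> bT gT; split=> // S [bS SC]; rewrite SC //; left. Qed.

Lemma vn_W q : M (W q).
Proof.
have MV y : M (V y).
  apply: vn_gen_M; first exact: V_bounded.
  rewrite V_def; left; exists (lreg y) => //; split; first exact: lreg_bounded.
  by move=> S [bS SC]; rewrite SC //; left; exists y.
have MT b : M (Tr b) by apply: vn_gen_M; [exact: trans_bounded|rewrite Tr_def; right; exists b].
case: (MV q.1) (MT q.2) => [bV VC] [bT TC]; split; first exact: bounded_comp.
move=> S SC; rewrite /W -[LHS]/(V q.1 \o (Tr q.2 \o S)) TC //.
by rewrite -[LHS]/((V q.1 \o S) \o Tr q.2) VC.
Qed.

Local Notation e0 := (ebasis R ((1, 1)%g : G * F)).

Lemma rho_Rb_e0 b y : rho y^-1%g (Rb b^-1%g e0) = ebasis R (b, y).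
Proof.
apply: ell2P => -[g x]; rewrite rhoE RbE /= !basisE mul1r invgK.
have -> : ((g * b^-1, act b (x * y^-1)) == (1, 1))%g = ((g, x) == (b, y)).
  rewrite !xpair_eqE; congr (_ && _).
    by apply/eqP/eqP => [/(congr1 (fun h => h * b)%g)|->]; rewrite ?mulgVK ?mul1g ?mulgV.
  apply/eqP/eqP => [/(congr1 (act b^-1%g))|->]; rewrite ?mulgV ?act_one //.
  rewrite (actVK actM act1) => /(congr1 (fun h => h * y)%g).
  by rewrite mulgVK mul1g.
case: eqP => [[_ ->]|_]; last by rewrite mulr0.
by rewrite mulgV act_one phi_one mulr1.
Qed.

(** The right translations carry [e0] to every basis vector, and [S] and [T] commute with them. *)
Lemma rcomm_ext S T : rcomm S -> rcomm T -> S e0 = T e0 -> S = T.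
Proof.
move=> [bS [Sr SR]] [bT [TrC TR]] E; apply: bounded_ext => // -[b y].
rewrite -rho_Rb_e0.
rewrite -[LHS]/((S \o rho y^-1%g) (Rb b^-1%g e0)) -[RHS]/((T \o rho y^-1%g) (Rb b^-1%g e0)).
rewrite Sr TrC /=; congr (rho _ _).
rewrite -[LHS]/((S \o Rb b^-1%g) e0) -[RHS]/((T \o Rb b^-1%g) e0).
by rewrite SR TR /= E.
Qed.

Lemma W_e0 y b : W (y, b) e0 = phi b^-1%g y *: ebasis R (b, act b^-1%g y).
Proof.
apply: ell2P => -[g x]; rewrite ell2Z !basisE /W /= VE TrE /= basisE.
have -> : ((b^-1 * g, (act g^-1 y)^-1 * x) == (1, 1))%g = ((g, x) == (b, act b^-1%g y)).
  apply/eqP/eqP => [[]|[-> ->]]; last by rewrite !mulVg.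
  move/(congr1 (fun h => b * h)%g); rewrite mulVKg mulg1 => ->.
  by move/(congr1 (fun h => act b^-1 y * h)%g); rewrite mulVKg mulg1 => ->.
by case: eqP => [[-> _]|_]; rewrite ?mulr1 ?mulr0.
Qed.

Definition tau (T : op) : C := T e0 (1, 1)%g.

Lemma tau_le T c : opbd T c -> normc (tau T) <= c.
Proof.
move=> Tc; apply: le_trans (normc_le_l2norm _ _) _.
by apply: le_trans (Tc _) _; rewrite l2norm_basis mulr1.
Qed.

Lemma tau_W y b : (y, b) != (1, 1)%g -> tau (W (y, b)) = 0.
Proof.
move=> ne; rewrite /tau W_e0 ell2Z basisE; case: eqP => [[b1 y1]|_]; last by rewrite mulr0.
case/eqP: ne; move: y1; rewrite -b1 invg1 act1 => <-.
by [].
Qed.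

(** On [e0] the left translation [W q] is a scalar times a right translation, which moves past [S];
    the coefficient at the identity is then the one read by [W q] on the left. *)
Lemma tau_commute S q : rcomm S -> tau (S \o W q) = tau (W q \o S).
Proof.
case: q => y b [bS [Sr SR]]; rewrite /tau /= W_e0 (linZ bS.1) ell2Z -rho_Rb_e0.
rewrite -[S (rho _ _)]/((S \o rho _) _) Sr /= -[S (Rb _ _)]/((S \o Rb _) _) SR /=.
rewrite rhoE RbE [RHS]VE TrE /= !mul1g !mulg1 !mul1r invg1 act1 invgK.
rewrite act_inv (actKV actM act1) (cocycle1 act1 phiP) mul1r mulrA.
by rewrite -(cocycle_hom phiP) mulgV phi_one mul1r.
Qed.

End CrossedProduct.

(** * Powers' averaging argument *)

Lemma tsum_sum_le (R : realType) (X : choiceType) (I : Type) (r : seq I)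
    (f : I -> X -> R) (g : X -> R) : (forall i x, 0 <= f i x) ->
  (forall i, has_total (f i)) -> has_total g ->
  (forall x, \sum_(i <- r) f i x <= g x) -> \sum_(i <- r) tsum (f i) <= tsum g.
Proof.
move=> f0 tf tg fg.
have [t E] : has_total (fun x => \sum_(i <- r) f i x) /\
    tsum (fun x => \sum_(i <- r) f i x) = \sum_(i <- r) tsum (f i).
  elim: r {fg} => [|i r [t IHr]].
    have [//|//|//|t ->] := @tsum_finite R X (fun x => \sum_(i <- [::]) f i x) [::].
    - by move=> x; rewrite big_nil.
    - by move=> x _; rewrite big_nil.
    by split=> //; rewrite !big_nil.
  have [t1 E1] := tsumD (tf i) t; split.
    by under eq_fun do rewrite big_cons.
  by under eq_fun do rewrite big_cons; rewrite E1 IHr big_cons.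
rewrite -E; suff [_] : has_total (fun x => \sum_(i <- r) f i x) /\
  tsum (fun x => \sum_(i <- r) f i x) <= tsum g by [].
by apply: le_tsum => // x; rewrite fg andbT sumr_ge0.
Qed.

Lemma sqr_sum_le (R : realType) N (b : 'I_N -> R) :
  (\sum_i b i) ^+ 2 <= N%:R * \sum_i b i ^+ 2.
Proof.
rewrite expr2 big_distrlr /=.
apply: (@le_trans _ _ (\sum_(i < N) \sum_(j < N) 2^-1 * (b i ^+ 2 + b j ^+ 2))).
  apply: ler_sum => i _; apply: ler_sum => j _.
  by have := sqr_ge0 (b i - b j); rewrite sqrrB; lra.
set S := \sum_i b i ^+ 2.
have -> : \sum_(i < N) \sum_(j < N) 2^-1 * (b i ^+ 2 + b j ^+ 2) =
    \sum_(i < N) 2^-1 * (N%:R * b i ^+ 2 + S).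
  apply: eq_bigr => i _; rewrite -mulr_sumr big_split /=.
  by rewrite sumr_const card_ord mulr_natl.
rewrite -mulr_sumr big_split /= sumr_const card_ord -[S *+ N]mulr_natl -mulr_sumr -/S.
lra.
Qed.

Section Powers.
Variables (R : realType) (X : choiceType) (L : eqType) (N : nat).
Local Notation H := (ell2 R X).
Variables (U : 'I_N -> H -> H) (w : 'I_N -> X -> R[i]) (p : 'I_N -> X -> X).
Hypothesis UE : forall i xi q, U i xi q = w i q * xi (p i q).
Hypothesis w1 : forall i q, normc (w i q) = 1.
Hypothesis pbij : forall i, bijective (p i).
Variables (source target : X -> L) (s t : 'I_N -> L).
Hypotheses (s_inj : injective s) (t_inj : injective t).
Hypothesis st : forall i q, target q != t i -> source (p i q) = s i.

(* The i-th unitary maps functions that vanish on [source = s i] to functions *)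
(* supported on [target = t i], and both families of sets are disjoint.       *)
Lemma powers_estimate xi : l2norm (\sum_i U i xi) <= 2 * Num.sqrt N%:R * l2norm xi.
Proof.
have c0 : 0 <= 2 * Num.sqrt N%:R * l2norm xi.
  by rewrite !mulr_ge0 ?sqrtr_ge0 ?l2norm_ge0.
apply: l2norm_le => //; rewrite !exprMn sqr_sqrtr ?ler0n //.
pose f q := normc (xi q) ^+ 2.
have tf : has_total f := has_total_ell2 xi.
have fE : tsum f = l2norm xi ^+ 2 := tsum_ell2 xi.
pose fs i q := (source q == s i)%:R * f q.
have tfs i : has_total (fs i).
  suff [] : has_total (fs i) /\ tsum (fs i) <= tsum f by [].
  apply: le_tsum => // q; rewrite /fs /f.
  by case: eqP => _; rewrite ?mul1r ?mul0r ?sqr_ge0 ?lexx.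
suff [_] : has_total (fun q => normc ((\sum_i U i xi) q) ^+ 2) /\
  tsum (fun q => normc ((\sum_i U i xi) q) ^+ 2) <= 2 ^+ 2 * N%:R * l2norm xi ^+ 2 by [].
apply: tsum_bound => [q|r ur]; first exact: sqr_ge0.
have pt q : normc ((\sum_i U i xi) q) ^+ 2 <=
    2 * \sum_i f (p i q) + 2 * N%:R * \sum_i fs i (p i q).
  rewrite ell2_sum.
  pose a i := normc (xi (p i q)).
  have a0 i : 0 <= a i by exact: normc_ge0.
  pose d i : R := (target q == t i)%:R * a i.
  pose c i : R := (source (p i q) == s i)%:R * a i.
  (* By [st], at a given point each index is accounted for by its target, in [d], or by its source,
     in [c]. *)
  have le1 : normc (\sum_i U i xi q) <= \sum_i d i + \sum_i c i.
    rewrite -big_split /=; apply: (@le_trans _ _ (\sum_i normc (U i xi q))).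
      by elim/big_rec2: _ => [|i y z _ IH]; [rewrite (normc0 R)|
        apply: le_trans (le_normcD _ _) _; rewrite lerD2l].
    apply: ler_sum => i _; rewrite UE normcM w1 mul1r /d /c -/(a i).
    have [tq|/st ->] := eqVneq (target q) (t i).
      by rewrite mul1r lerDl mulr_ge0 ?ler0n.
    by rewrite eqxx mul0r mul1r add0r.
  (* Targets are distinct, so at most one [d i] is nonzero. *)
  have le2 : (\sum_i d i) ^+ 2 <= \sum_i f (p i q).
    have [/existsP[i0 /eqP ti0]|/existsPn nt] := boolP [exists i, target q == t i].
      rewrite (bigD1 i0) //= big1 => [|i ii0]; last first.
        rewrite /d ti0; case: eqP => [/t_inj e|_]; last by rewrite mul0r.
        by rewrite e eqxx in ii0.
      rewrite addr0 /d ti0 eqxx mul1r (bigD1 i0) //= lerDl sumr_ge0 // => i _.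
      exact: sqr_ge0.
    rewrite big1 ?expr0n ?sumr_ge0 // => [i _|i _]; first exact: sqr_ge0.
    by rewrite /d (negPf (nt i)) mul0r.
  (* Cauchy-Schwarz costs a factor [N], but summing over all points afterwards gives only one copy
     of the squared norm, because the sources are disjoint ([S2]). *)
  have le3 : (\sum_i c i) ^+ 2 <= N%:R * \sum_i fs i (p i q).
    apply: le_trans (sqr_sum_le _) _; rewrite ler_wpM2l ?ler0n //.
    apply: ler_sum => i _; rewrite /c /fs /f exprMn.
    by case: eqP => _; rewrite ?expr1n ?expr0n ?mul0r.
  have : normc (\sum_i U i xi q) ^+ 2 <= (\sum_i d i + \sum_i c i) ^+ 2.
    rewrite ler_pXn2r // nnegrE ?normc_ge0 //.
    exact: le_trans (normc_ge0 _) le1.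
  have := sqr_ge0 (\sum_i d i - \sum_i c i); rewrite sqrrB sqrrD.
  move: le2 le3; rewrite -mulrA.
  set D := \sum_i d i; set E := \sum_i c i; set P := \sum_i f _; set Q := N%:R * _.
  lra.
apply: le_trans (ler_sum _ (fun q _ => pt q)) _.
rewrite big_split /= -!mulr_sumr exchange_big /= [X in _ + _ * X]exchange_big /=.
have re i (h : X -> R) : has_total h -> \sum_(q <- r) h (p i q) <= tsum h.
  move=> th; have [th' <-] := tsum_reindex (pbij i) th.
  exact: sum_le_tsum.
have S1 : \sum_(i < N) \sum_(q <- r) f (p i q) <= N%:R * l2norm xi ^+ 2.
  apply: (@le_trans _ _ (\sum_(i < N) tsum f)); first by apply: ler_sum => i _; exact: re.
  by rewrite sumr_const card_ord fE mulr_natl.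
have S2 : \sum_(i < N) \sum_(q <- r) fs i (p i q) <= l2norm xi ^+ 2.
  apply: (@le_trans _ _ (\sum_(i < N) tsum (fs i))); first by apply: ler_sum => i _; exact: re.
  rewrite -fE; apply: tsum_sum_le => // [i q|q].
    by rewrite mulr_ge0 ?ler0n // sqr_ge0.
  rewrite -mulr_suml ler_piMl ?sqr_ge0 //.
  have [/existsP[i0 /eqP si0]|/existsPn ns] := boolP [exists i, source q == s i].
    rewrite (bigD1 i0) //= big1 => [|i ii0]; last first.
      by rewrite si0 (inj_eq s_inj) eq_sym (negPf ii0).
    by rewrite si0 eqxx addr0.
  by rewrite big1 // => i _; rewrite (negPf (ns i)).
have S2' : N%:R * \sum_(i < N) \sum_(q <- r) fs i (p i q) <= N%:R * l2norm xi ^+ 2.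
  by rewrite ler_wpM2l ?ler0n.
rewrite -[2 * N%:R * _]mulrA; lra.
Qed.

End Powers.

(** * Averages of conjugates *)

Section Averaging.
Variables (R : realType) (X : choiceType).
Local Notation C := R[i].
Local Notation H := (ell2 R X).
Local Notation op := (H -> H).
Implicit Types (S T : op) (c e : R) (a : C).
Variable P : op -> op -> Prop.

Definition avg (U U' : nat -> op) N T : op :=
  (N.+1%:R^-1 : C) *: \sum_(i < N.+1) (U i \o T \o U' i).

(** Composites of finite averages of conjugates, for pairs of mutually inverse unitaries. Such maps
    are contractive and preserve ideals, tracial states and central elements, which is all the later
    arguments use. *)
Inductive avg_map : (op -> op) -> Prop :=
| avg_map_id : avg_map id
| avg_map_step Phi U U' N : (forall i, P (U i) (U' i)) -> avg_map Phi ->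
    avg_map (fun T => avg U U' N (Phi T)).

Lemma op_sumE (I : Type) (r : seq I) (Q : pred I) (F : I -> op) xi :
  (\sum_(i <- r | Q i) F i) xi = \sum_(i <- r | Q i) F i xi.
Proof. by elim/big_rec2: _ => // i y z _ <-. Qed.

Lemma avgE U U' N T xi :
  avg U U' N T xi = (N.+1%:R^-1 : C) *: \sum_(i < N.+1) U i (T (U' i xi)).
Proof. by rewrite -[LHS]/(_ *: (\sum_(i < N.+1) (U i \o T \o U' i)) xi) op_sumE. Qed.

Lemma normc_natV N : normc (N.+1%:R^-1 : C) = N.+1%:R^-1.
Proof.
have -> : (N.+1%:R : C) = Complex N.+1%:R 0.
  elim: N.+1 => [|k IHk] //; rewrite -addn1 natrD IHk natrD.
  by apply/eqP; rewrite eq_complex /= addr0 !eqxx.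
by rewrite normcV /= expr0n addr0 sqrtr_sqr ger0_norm.
Qed.

Hypothesis Pb : forall U U', P U U' -> bounded_op U /\ bounded_op U'.

Section OneStep.
Variables (U U' : nat -> op) (N : nat).
Hypothesis UP : forall i, P (U i) (U' i).

Lemma avg_lin a S T : avg U U' N (a *: S + T) = a *: avg U U' N S + avg U U' N T.
Proof.
apply/funext => xi; rewrite avgE -[RHS]/(a *: avg U U' N S xi + avg U U' N T xi) !avgE.
rewrite scalerA mulrC -scalerA -scalerDr; congr (_ *: _).
rewrite scaler_sumr -big_split /=; apply: eq_bigr => i _.
by rewrite -[(_ + _) _]/(a *: S _ + T _) (Pb (UP i)).1.1.
Qed.

Lemma avg_norm (f : 'I_N.+1 -> H) c :
  (forall i, l2norm (f i) <= c) -> l2norm ((N.+1%:R^-1 : C) *: \sum_i f i) <= c.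
Proof.
move=> fc; rewrite l2normZ normc_natV ler_pdivrMl ?ltr0n //.
apply: le_trans (l2norm_sum _ _ _) _.
apply: (@le_trans _ _ (\sum_(i < N.+1) c)); first by apply: ler_sum.
by rewrite sumr_const card_ord mulr_natl.
Qed.

Hypothesis Piso : forall V V' xi, P V V' -> l2norm (V xi) = l2norm xi /\ l2norm (V' xi) = l2norm xi.

Lemma avg_opbd T c : opbd T c -> opbd (avg U U' N T) c.
Proof.
move=> Tc xi; rewrite avgE; apply: avg_norm => i.
rewrite (Piso _ (UP i)).1; apply: le_trans (Tc _) _.
by rewrite (Piso _ (UP i)).2.
Qed.

Lemma avg_const (x : H) : (N.+1%:R^-1 : C) *: \sum_(i < N.+1) x = x.
Proof.
rewrite sumr_const card_ord -[x *+ _]scaler_nat scalerA mulVf ?scale1r //.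
Qed.

Lemma avg_fixed T : (forall i, U i \o T \o U' i = T) -> avg U U' N T = T.
Proof.
move=> UT; apply/funext => xi; rewrite avgE -[RHS]avg_const; congr (_ *: _).
by apply: eq_bigr => i _; have := congr1 (fun f => f xi) (UT i).
Qed.

Lemma avg_mem (J : set op) T : J 0 -> (forall a S T, J S -> J T -> J (a *: S + T)) ->
  (forall i, J (U i \o T \o U' i)) -> J (avg U U' N T).
Proof.
move=> J0 Jlin JU; rewrite /avg -[_ *: _]addr0; apply: (Jlin) => //.
elim: (index_enum _) => [|i r IHr]; first by rewrite big_nil.
by rewrite big_cons -[X in X + _]scale1r; exact: Jlin.
Qed.

Lemma avg_trace (A : set op) (psi : op -> C) T : cstar_algebra A -> tracial_state A psi ->
  (forall i, A (U i) /\ A (U' i)) -> (forall i, U' i \o U i = idfun) -> A T ->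
  psi (avg U U' N T) = psi T.
Proof.
move=> cA tpsi AU UU AT.
have AUT i : A (U i \o T \o U' i).
  by have [? ?] := AU i; do 2 apply: (cstar_mul cA) => //.
have [AS sE] : A (\sum_(i < N.+1) (U i \o T \o U' i)) /\
    psi (\sum_(i < N.+1) (U i \o T \o U' i)) = \sum_(i < N.+1) psi T.
  elim: (index_enum _) => [|i r [AS IHr]].
    by rewrite !big_nil; split; [exact: cstar_zero|exact: (@state0 _ _ A cA psi tpsi)].
  rewrite !big_cons; split; first exact: cstar_add.
  rewrite (stateD tpsi) // IHr; congr (_ + _).
  have [AUi AU'i] := AU i.
  rewrite (state_trace tpsi) //; last exact: (cstar_mul cA).
  by rewrite -[_ \o _]/((U' i \o U i) \o T) UU.
rewrite /avg (@stateZ _ _ A cA psi tpsi) // sE sumr_const card_ord -[psi T *+ _]mulr_natl mulrA mulVf ?mul1r //.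
Qed.

End OneStep.

End Averaging.

(** * Simplicity, uniqueness of the trace and factoriality from averaging *)

Section Consequences.
Variables (R : realType) (G F : groupType) (act : G -> F -> F) (phi : G -> F -> R[i]).
Hypothesis actM : forall a b x, act (a * b)%g x = act a (act b x).
Hypothesis act1 : forall x, act 1%g x = x.
Hypothesis act_mul : forall a x y, act a (x * y)%g = (act a x * act a y)%g.
Hypothesis phiP : cocycle act phi.
Local Notation C := R[i].
Local Notation H := (ell2 R (G * F)%type).
Local Notation op := (H -> H).
Local Notation theta := (deformed_action act phi).
Local Notation V := (V act phi).
Local Notation Tr := (@Tr R G F).
Local Notation W := (W act phi).
Local Notation A := (reduced_crossed_product theta (cstar_reduced R F)).
Local Notation M := (vn_crossed_product theta (vn_group R F)).
Local Notation e0 := (ebasis R ((1, 1)%g : G * F)).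
Local Notation rcomm := (rcomm actM act1 phiP).
Local Notation tau := (@tau R G F).

Let cA := crossed_cstar actM act1 act_mul phiP.
Let A1 := crossed_id actM act1 act_mul phiP.

Lemma crossed_adj T : A T -> exists2 T', A T' & is_adjoint T T'.
Proof.
rewrite (crossedE actM act1 act_mul phiP) => cT.
exact: (cl_adjoint (W_star actM act1 act_mul phiP) cT).
Qed.

Definition upair (U U' : op) : Prop :=
  (exists y, U = V y /\ U' = V y^-1%g) \/ (exists b, U = Tr b /\ U' = Tr b^-1%g).

Lemma upair_W U U' : upair U U' -> exists q q', U = W q /\ U' = W q'.
Proof.
case=> [[y [-> ->]]|[b [-> ->]]].
  by exists (y, 1%g), (y^-1, 1)%g; rewrite !W_V.
by exists (1%g, b), (1, b^-1)%g; rewrite !(W_trans actM act1 act_mul phiP).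
Qed.

Lemma upair_bounded U U' : upair U U' -> bounded_op U /\ bounded_op U'.
Proof.
move=> /upair_W[q [q' [-> ->]]].
by split; apply: (W_bounded actM act1 act_mul phiP).
Qed.

Lemma upair_isometry U U' (xi : H) : upair U U' ->
  l2norm (U xi) = l2norm xi /\ l2norm (U' xi) = l2norm xi.
Proof.
move=> /upair_W[q [q' [-> ->]]].
by rewrite !(W_isometry actM act1 act_mul phiP).
Qed.

Lemma upair_A U U' : upair U U' -> A U /\ A U'.
Proof.
by move=> /upair_W[q [q' [-> ->]]]; split; apply: (crossed_W actM act1 act_mul phiP).
Qed.

Lemma upair_M U U' : upair U U' -> M U /\ M U'.
Proof.
by move=> /upair_W[q [q' [-> ->]]]; split; apply: (vn_W actM act1 act_mul phiP).
Qed.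

Lemma upairK U U' : upair U U' -> U \o U' = idfun /\ U' \o U = idfun.
Proof.
case=> [[y [-> ->]]|[b [-> ->]]].
  by rewrite !(V_M actM act1 act_mul phiP) mulgV mulVg (V1 actM act1 act_mul phiP).
by rewrite !trans_M mulgV mulVg trans1.
Qed.

Section AvgMap.
Variable Phi : op -> op.
Hypothesis PhiP : avg_map upair Phi.

Lemma avg_map_lin a S T : Phi (a *: S + T) = a *: Phi S + Phi T.
Proof.
elim: PhiP => // Psi U U' N UP _ IH.
by rewrite IH (avg_lin upair_bounded).
Qed.

Lemma avg_map_opbd T c : opbd T c -> opbd (Phi T) c.
Proof.
elim: PhiP T => // Psi U U' N UP _ IH T Tc.
by apply: (avg_opbd N UP upair_isometry); exact: IH.
Qed.

Lemma avg_map_fixed T : (forall U U', upair U U' -> U \o T \o U' = T) -> Phi T = T.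
Proof.
move=> UT; elim: PhiP => // Psi U U' N UP _ ->.
by apply: avg_fixed => i; exact: UT.
Qed.

Lemma avg_map_id1 : Phi idfun = idfun.
Proof. by apply: avg_map_fixed => U U' /upairK[UK _]; rewrite -[RHS]UK. Qed.

Lemma avg_map_mem (J : set op) T : J 0 -> (forall a S T, J S -> J T -> J (a *: S + T)) ->
  (forall U U' T, upair U U' -> J T -> J (U \o T \o U')) -> J T -> J (Phi T).
Proof.
move=> J0 Jlin JU; elim: PhiP T => // Psi U U' N UP _ IH T JT.
by apply: (avg_mem) => // i; apply: JU => //; exact: IH.
Qed.

Lemma avg_map_A T : A T -> A (Phi T).
Proof.
apply: avg_map_mem (cstar_zero cA) (cstar_lin cA) _ => U U' {}T /upair_A[AU AU'] AT.
by do 2 apply: (cstar_mul cA) => //.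
Qed.

Lemma avg_map_trace psi T : tracial_state A psi -> A T -> psi (Phi T) = psi T.
Proof.
move=> tpsi AT; have : A (Phi T) /\ psi (Phi T) = psi T; last by case.
elim: PhiP => // Psi U U' N UP _ [APT <-]; split.
  apply: avg_mem (cstar_zero cA) (cstar_lin cA) _ => i.
  by have [AU AU'] := upair_A (UP i); do 2 apply: (cstar_mul cA) => //.
apply: (avg_trace N cA tpsi) => // i; first exact: upair_A (UP i).
by case: (upairK (UP i)).
Qed.

Lemma l2norm_rcomm_W T q : rcomm T -> l2norm (T (W q e0)) = l2norm (T e0).
Proof.
case: q => y b [bT [Tr_ TR]].
rewrite (W_e0 actM act1 act_mul phiP) (linZ bT.1) l2normZ (normc_phi phiP) mul1r.
rewrite -(rho_Rb_e0 actM act1 act_mul phiP).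
have E1 := congr1 (fun f => f (Rb actM act1 phiP b^-1%g e0)) (Tr_ (act b^-1%g y)^-1%g).
have E2 := congr1 (fun f => f e0) (TR b^-1%g).
by move: E1 E2 => /= -> ->; rewrite rho_isometry Rb_isometry.
Qed.

(** Elements of the von Neumann algebra are approximated only at [e0]. Averaging is contractive
    there as well, since [W q e0] is a phase times a right translate of [e0], and right translations
    commute with [T]. *)
Lemma avg_map_rcomm T : rcomm T -> rcomm (Phi T) /\ l2norm (Phi T e0) <= l2norm (T e0).
Proof.
move=> rT; elim: PhiP => // Psi U U' N UP _ [rP leP].
have rUU i : rcomm (U i) /\ rcomm (U' i).
  by have [q [q' [-> ->]]] := upair_W (UP i); split; apply: (rcomm_W actM act1 act_mul phiP).
split.
  apply: avg_mem.
  - have := rcomm_lin (-1) rT rT; by rewrite scaleN1r addNr.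
  - by move=> a S S'; apply: rcomm_lin.
  - by move=> i; have [? ?] := rUU i; do 2 apply: rcomm_comp => //.
apply: le_trans leP; rewrite avgE; apply: avg_norm => i.
rewrite (upair_isometry _ (UP i)).1.
have [q [q' [_ ->]]] := upair_W (UP i).
by rewrite l2norm_rcomm_W.
Qed.

End AvgMap.

Definition offdiag : set op := [set W q | q in [set q | q != (1, 1)%g]].

Lemma W1 : W (1, 1)%g = idfun.
Proof. by rewrite (W_trans actM act1 act_mul phiP) trans1. Qed.

Lemma lspan_offdiag S : lspan (range W) S -> exists2 S0, lspan offdiag S0 &
  exists c, S = c *: (idfun : op) + S0.
Proof.
elim=> [|a _ T [q _ <-] _ [S0 lS0 [c ->]]].
  by exists 0; [exact: lspan0|exists 0; rewrite scale0r addr0].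
have [->|q1] := eqVneq q (1, 1)%g.
  by exists S0 => //; exists (a + c); rewrite W1 scalerDl addrA.
exists (a *: W q + S0); last by exists c; rewrite addrCA.
by apply: lspanS => //; exists q.
Qed.

Lemma tau_lin a S T : tau (a *: S + T) = a * tau S + tau T.
Proof. by []. Qed.

Lemma tau_id : tau idfun = 1.
Proof. by rewrite /tau basisE eqxx. Qed.

Lemma tau_offdiag S : lspan offdiag S -> tau S = 0.
Proof.
elim=> [//|a _ T [[y b] /= q1 <-] _ IH].
by rewrite tau_lin IH addr0 (tau_W actM act1 act_mul phiP) ?mulr0.
Qed.

(** The averaging property, established for nontorsion parameters in [kill_offdiag]. *)
Hypothesis kill : forall S, lspan offdiag S -> forall e : R, 0 < e ->
  exists2 Phi, avg_map upair Phi & opbd (Phi S) e.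

(** Approximate [T] by a finite combination: its identity term is fixed by averages and its
    off-diagonal part is averaged away. Each of the three errors is at most [e / 3]. *)
Lemma dixmier T (e : R) : A T -> 0 < e ->
  exists2 Phi, avg_map upair Phi & opbd (Phi T - tau T *: (idfun : op)) e.
Proof.
move=> AT e_gt0; move: (AT); rewrite (crossedE actM act1 act_mul phiP) => -[bT aT].
have e3 : 0 < e / 3 by lra.
have [S lS Se] := aT _ e3.
have [S0 lS0 [c SE]] := lspan_offdiag lS.
have [Phi PhiP PS0] := kill lS0 e3; exists Phi => //.
have tS : tau S = c by rewrite SE tau_lin tau_id tau_offdiag // addr0 mulr1.
have -> : Phi T - tau T *: (idfun : op) =
    Phi (T - S) + (Phi S0 + (- (tau (T - S))) *: (idfun : op)).
  have -> : T - S = (-1) *: S + T by rewrite scaleN1r addrC.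
  rewrite avg_map_lin // tau_lin tS SE avg_map_lin // (avg_map_id1 PhiP) mulN1r.
  rewrite scaleN1r.
  set P := Phi T; set Q := Phi S0; apply/funext => xi; apply: ell2P => x.
  rewrite -[LHS]/(P xi x - tau T * xi x).
  rewrite -[RHS]/(- (c * xi x + Q xi x) + P xi x + (Q xi x + - (- c + tau T) * xi x)).
  ring.
apply: opbd_le (opbdD (avg_map_opbd PhiP Se) (opbdD PS0 (opbdZ _ (@opbd_id _ _)))).
rewrite normcN mulr1; have := tau_le Se; lra.
Qed.

(** A nonzero element of the ideal has a nonzero coordinate at [e0], which a left translation moves
    to the identity. Averages stay in the ideal and approach a nonzero multiple of 1. *)
Lemma crossed_simple : simple_cstar A.
Proof.
move=> J Jid; have [J0|Jn0] := pselect (J `<=` [set 0]).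
  by left; apply/seteqP; split=> // _ ->; exact: (ideal_zero Jid).
right; apply/seteqP; split; first exact: (ideal_sub Jid).
have [T [JT Tn0]] : exists T, J T /\ T <> 0.
  apply: contrapT => nT; apply: Jn0 => T JT; apply: contrapT => Tn0.
  by apply: nT; exists T.
have AT := ideal_sub Jid JT.
have rT : rcomm T by exact: (rcomm_crossed actM act1 act_mul phiP).
have r0 : rcomm 0.
  by have := rcomm_lin (-1) rT rT; rewrite scaleN1r addNr.
have [[b x] Tq] : exists q, T e0 q != 0.
  apply: contrapT => nq; apply: Tn0; apply: (rcomm_ext act_mul rT r0).
  apply: ell2P => q; apply: contrapT => Tq; apply: nq; exists q; exact/eqP.
pose S := V x^-1%g \o (Tr b^-1%g \o T).
have JS : J S.
  have JT' := ideal_mull Jid (@crossed_trans R G F act phi b^-1%g) JT.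
  exact (ideal_mull Jid (@crossed_V R G F act phi x^-1%g) JT').
have AS := ideal_sub Jid JS.
have tS : tau S != 0.
  rewrite /tau /S /= (VE actM act1 act_mul phiP) TrE /= invg1 act1 !invgK !mulg1.
  by rewrite mulf_neq0 // (phi_nz phiP).
have J1 : J idfun.
  have -> : idfun = (tau S)^-1 *: (tau S *: (idfun : op)) + 0.
    by rewrite addr0 scalerA mulVf // scale1r.
  apply: (ideal_lin Jid) _ (ideal_zero Jid).
  have Jb : J `<=` @bounded_op R _ by move=> T' /(ideal_sub Jid) /(cstar_bounded cA).
  have /norm_closedP W' := ideal_closed Jid; apply: W' Jb _ _ _.
    have := bounded_linear_comb (tau S) (@bounded_id R _) (@bounded0 R (G * F)%type).
    by rewrite addr0.
  move=> e e_gt0; have [Phi PhiP Pe] := dixmier AS e_gt0; exists (Phi S).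
    apply: (avg_map_mem PhiP (ideal_zero Jid) (ideal_lin Jid)) JS => U U' T' UU' JT'.
    have [AU AU'] := upair_A UU'.
    by apply: (ideal_mulr Jid) => //; apply: (ideal_mull Jid).
  by rewrite -opprB; exact: opbdN.
by move=> T' AT'; have := ideal_mull Jid AT' J1.
Qed.

Lemma tau_pos S T : A S -> A T -> is_adjoint S T -> 0 <= tau (T \o S).
Proof.
move=> AS AT ST; rewrite /tau /= -inner_basis inner_conj.
have -> : inner e0 (T (S e0)) = inner (S e0) (S e0) by rewrite ST.
by rewrite inner_diag lecE /= !oppr0 eqxx sqr_ge0.
Qed.

Lemma tau_trace S T : A S -> A T -> tau (S \o T) = tau (T \o S).
Proof.
move=> AS AT; apply/eqP; rewrite -subr_eq0; apply/eqP/eq0_normc/eqP.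
rewrite eq_le normc_ge0 andbT; apply/ler_addgt0Pr => e e_gt0; rewrite add0r.
have bS := cstar_bounded cA AS; have [c c0 Sc] := bounded_opbd bS.
have rS := rcomm_crossed actM act1 act_mul phiP AS.
have d0 : 0 < e / (2 * c + 1) by rewrite divr_gt0 // ltr_wpDl // mulr_ge0.
move: (AT); rewrite (crossedE actM act1 act_mul phiP) => -[bT aT].
have [T' lT' T'd] := aT _ d0.
have E : tau (S \o T') = tau (T' \o S).
  elim: lT' {T'd} => [|a _ T1 [q _ <-] lT1 IH].
    by rewrite (_ : S \o 0 = 0) //; apply/funext => xi; exact: lin0 bS.1.
  have -> : S \o (a *: W q + T1) = a *: (S \o W q) + (S \o T1).
    by apply/funext => xi; exact: bS.1.
  have -> : (a *: W q + T1) \o S = a *: (W q \o S) + (T1 \o S) by [].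
  by rewrite !tau_lin IH (tau_commute act_mul _ rS).
have -> : tau (S \o T) - tau (T \o S) = tau (S \o (T - T')) - tau ((T - T') \o S).
  have -> : S \o (T - T') = (-1) *: (S \o T') + (S \o T).
    apply/funext => xi; rewrite -[LHS]/(S (T xi - T' xi)) (linB bS.1) addrC.
    by rewrite -[RHS]/(-1 *: S (T' xi) + S (T xi)) scaleN1r.
  have -> : (T - T') \o S = (-1) *: (T' \o S) + (T \o S).
    by rewrite scaleN1r addrC.
  by rewrite !tau_lin E; ring.
apply: le_trans (le_normcD _ _) _; rewrite normcN.
apply: le_trans (lerD (tau_le (opbd_comp c0 Sc T'd)) (tau_le (opbd_comp (ltW d0) T'd Sc))) _.
have -> : c * (e / (2 * c + 1)) + e / (2 * c + 1) * c = e * (2 * c / (2 * c + 1)).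
  by field; rewrite gt_eqF // ltr_wpDl // mulr_ge0.
by rewrite ler_piMr ?(ltW e_gt0) // ler_pdivrMr ?mul1r ?lerDl // ltr_wpDl // mulr_ge0.
Qed.

Lemma tau_state : tracial_state A tau.
Proof.
split; [by move=> *; exact: tau_lin|exact: tau_pos|exact: tau_id|exact: tau_trace].
Qed.

(** Any tracial state is invariant under averaging and continuous by [tracial_bound], so its value
    at [T] is that of the limit [tau T] of averages. *)
Lemma crossed_unique_trace : unique_tracial_state A.
Proof.
exists tau; first exact: tau_state.
move=> psi tpsi T AT; apply/eqP; rewrite -subr_eq0; apply/eqP/eq0_normc/eqP.
rewrite eq_le normc_ge0 andbT; apply/ler_addgt0Pr => e e_gt0; rewrite add0r.
have e4 : 0 < e / 4 by lra.
have [Phi PhiP Pe] := dixmier AT e4.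
have AI : A (tau T *: (idfun : op)) by exact: (cstar_scale cA (tau T) A1).
have := tracial_bound cA A1 tpsi crossed_adj (cstar_sub cA (avg_map_A PhiP AT) AI) e4 Pe.
have -> : Phi T - tau T *: (idfun : op) = (- tau T) *: (idfun : op) + Phi T.
  by rewrite scaleNr addrC.
rewrite (state_lin tpsi) //; last exact: avg_map_A.
rewrite (state_unit tpsi) (avg_map_trace PhiP tpsi AT) mulr1 addrC.
by move/le_trans; apply; lra.
Qed.

(** A central [T] is fixed by averages. It need not be a norm limit of combinations of the [W q], so
    it is approximated only at [e0], where [avg_map_rcomm] keeps the error under control, while the
    off-diagonal part of the approximant is averaged away in norm. *)
Lemma crossed_factor : Defs.factor M.
Proof.
move=> T MT [bT TC].
have rT := rcomm_vn actM act1 act_mul phiP MT.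
have TU U U' : upair U U' -> U \o T \o U' = T.
  move=> UU'; have [MU _] := upair_M UU'; have [UK _] := upairK UU'.
  by rewrite -(TC _ MU) -[LHS]/(T \o (U \o U')) UK.
exists (tau T).
have rI : rcomm (tau T *: (idfun : op)).
  have := rcomm_lin (tau T) (rcomm_W actM act1 act_mul phiP (1, 1)%g)
    (rcomm_lin (-1) rT rT).
  by rewrite scaleN1r addNr addr0 W1.
apply: (rcomm_ext act_mul rT rI).
suff E0 : T e0 - tau T *: e0 = 0.
  by apply: etrans (esym (subrK (tau T *: e0) (T e0))) _; rewrite E0 add0r.
apply/l2norm_eq0/eqP.
rewrite eq_le l2norm_ge0 andbT; apply/ler_addgt0Pr => e e_gt0; rewrite add0r.
have e4 : 0 < e / 4 by lra.
have [s us se] := ell2_approx (T e0) e4.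
have [S lS SE] : exists2 S, lspan (range W) S & S e0 = \sum_(q <- s) T e0 q *: ebasis R q.
  elim: s {us se} => [|[b x] s [S lS SE]].
    by exists 0; [exact: lspan0|rewrite big_nil].
  exists ((T e0 (b, x) / phi b^-1%g (act b x)) *: W (act b x, b) + S).
    by apply: lspanS => //; exists (act b x, b).
  rewrite big_cons -SE -[LHS]/(_ *: W (act b x, b) e0 + S e0); congr (_ + _).
  rewrite (W_e0 actM act1 act_mul phiP) scalerA mulfVK ?(phi_nz phiP) //.
  by rewrite (actVK actM act1).
have [S0 lS0 [c SE0]] := lspan_offdiag lS.
have tS : tau S = c by rewrite SE0 tau_lin tau_id tau_offdiag // addr0 mulr1.
have rS := rcomm_lspan actM act1 act_mul phiP lS.
have rD : rcomm ((-1) *: S + T) by exact: rcomm_lin.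
have De : l2norm (((-1) *: S + T) e0) <= e / 4.
  by rewrite -[X in l2norm X]/((-1) *: S e0 + T e0) scaleN1r SE addrC.
have te : normc (tau T - c) <= e / 4.
  apply: le_trans De; rewrite -tS; apply: le_trans (normc_le_l2norm _ (1, 1)%g).
  rewrite -[X in _ <= normc X]/(tau ((-1) *: S + T)) tau_lin mulN1r addrC //.
have [Phi PhiP P0] := kill lS0 e4.
have [_ le1] := avg_map_rcomm PhiP rD.
have PT : Phi T = T by apply: (avg_map_fixed PhiP).
have PD : Phi ((-1) *: S + T) e0 = T e0 - (c *: e0 + Phi S0 e0).
  rewrite (avg_map_lin PhiP) PT SE0 (avg_map_lin PhiP) (avg_map_id1 PhiP).
  by rewrite -[LHS]/((-1) *: (c *: e0 + Phi S0 e0) + T e0) scaleN1r addrC.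
have -> : T e0 - tau T *: e0 =
   (T e0 - (c *: e0 + Phi S0 e0)) + (Phi S0 e0 - (tau T - c) *: e0).
  rewrite scalerBl opprB opprD.
  by rewrite !addrA !subrK.
apply: le_trans (l2normD _ _) _; rewrite -PD.
have := le_trans le1 De.
have : l2norm (Phi S0 e0 - (tau T - c) *: e0) <= e / 4 + e / 4.
  apply: le_trans (l2normD _ _) _; rewrite l2normN l2normZ l2norm_basis mulr1.
  by apply: lerD => //; apply: le_trans (P0 _) _; rewrite l2norm_basis mulr1.
lra.
Qed.

End Consequences.

Lemma l2norm_sum_basis (R : realType) (X : choiceType) N (q : 'I_N -> X) :
  injective q -> N%:R <= l2norm (\sum_i ebasis R (q i)) ^+ 2.
Proof.
move=> q_inj; rewrite -tsum_ell2.
have us : uniq [seq q i | i <- enum 'I_N] by rewrite map_inj_uniq ?enum_uniq.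
apply: le_trans (sum_le_tsum (has_total_ell2 _) us).
rewrite big_map big_enum /= (eq_bigr (fun=> 1)); last first.
  move=> i _; rewrite ell2_sum (bigD1 i) //= big1 => [|j ji]; last first.
    by rewrite basisE (inj_eq q_inj) eq_sym (negPf ji).
  by rewrite basisE eqxx addr0 normc1 expr1n.
by rewrite sumr_const card_ord.
Qed.

(** * A central unitary of infinite order and its consequences *)

Section CentralUnitary.
Variables (R : realType) (G F : groupType) (act : G -> F -> F) (phi : G -> F -> R[i]).
Hypothesis actM : forall a b x, act (a * b)%g x = act a (act b x).
Hypothesis act1 : forall x, act 1%g x = x.
Hypothesis act_mul : forall a x y, act a (x * y)%g = (act a x * act a y)%g.
Hypothesis phiP : cocycle act phi.
Local Notation C := R[i].
Local Notation H := (ell2 R (G * F)%type).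
Local Notation op := (H -> H).
Local Notation theta := (deformed_action act phi).
Local Notation V := (V act phi).
Local Notation Tr := (@Tr R G F).
Local Notation W := (W act phi).
Local Notation A := (reduced_crossed_product theta (cstar_reduced R F)).
Local Notation M := (vn_crossed_product theta (vn_group R F)).
Local Notation e0 := (ebasis R ((1, 1)%g : G * F)).
Local Notation rcomm := (rcomm actM act1 phiP).
Local Notation tau := (@tau R G F).

Let cA := crossed_cstar actM act1 act_mul phiP.
Let A1 := crossed_id actM act1 act_mul phiP.

Variables (y : F) (b : G).
Hypothesis actb : forall x, act b x = (y^-1 * x * y)%g.
Hypothesis acty : forall a, act a y = y.
Hypothesis bC : forall a : G, (a * b = b * a)%g.
Hypothesis phib : forall x, phi b x = 1.
Hypothesis phiy : forall a, phi a y = 1.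
Hypothesis y_free : forall m, (0 < m)%N -> (y ^+ m)%g <> 1%g.

Let U : op := W (y, b).
Let U' : op := Tr b^-1%g \o V y^-1%g.

Lemma centralE xi g x : U xi (g, x) = xi (b^-1 * g, y^-1 * x)%g.
Proof.
by rewrite [LHS](VE actM act1 act_mul phiP) TrE phiy mul1r acty.
Qed.

(** Since [(y, b)] is central in the semidirect product and the cocycle is trivial on it, its left
    translation is also a right one. Hence it commutes with [rcomm], and so with both crossed
    products. *)
Lemma central_right : U = @rho R G F y^-1%g \o Rb actM act1 phiP b^-1%g.
Proof.
apply/funext => xi; apply: ell2P => -[g x]; rewrite centralE [RHS]rhoE mul1r RbE.
rewrite [_.1]/= [_.2]/= invgK.
have -> : phi b^-1%g (act b (x * y^-1)%g) = 1.
  by have := cocycleV act1 phiP b (x * y^-1)%g; rewrite phib mulr1.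
rewrite mul1r actb !mulgA mulgVK; congr (xi (_, _)).
by apply: (mulgI b); rewrite mulVKg mulgA -bC mulgK.
Qed.

Lemma central_rcomm T : rcomm T -> U \o T = T \o U.
Proof.
move=> [_ [TrC TR]]; rewrite central_right; apply/funext => xi.
have E1 := congr1 (fun f => f (Rb actM act1 phiP b^-1%g xi)) (TrC y^-1%g).
have E2 := congr1 (fun f => f xi) (TR b^-1%g).
by move: E1 E2 => /= -> ->.
Qed.

Lemma centralK : U \o U' = idfun /\ U' \o U = idfun.
Proof.
have [vK Kv] : V y \o V y^-1%g = idfun /\ V y^-1%g \o V y = idfun.
  by rewrite !(V_M actM act1 act_mul phiP) mulgV mulVg (V1 actM act1 act_mul phiP).
have [tK Kt] : Tr b \o Tr b^-1%g = idfun /\ Tr b^-1%g \o Tr b = idfun.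
  by rewrite !trans_M mulgV mulVg trans1.
split.
  by rewrite -[LHS]/(V y \o (Tr b \o Tr b^-1%g) \o V y^-1%g) tK -[RHS]vK.
by rewrite -[LHS]/(Tr b^-1%g \o (V y^-1%g \o V y) \o Tr b) Kv -[RHS]Kt.
Qed.

Lemma central_rcomm' T : rcomm T -> U' \o T = T \o U'.
Proof.
move=> rT; have [K K'] := centralK.
rewrite -[LHS]/((U' \o T) \o idfun) -K -[LHS]/(U' \o (T \o U) \o U').
by rewrite -central_rcomm // -[LHS]/((U' \o U) \o T \o U') K'.
Qed.

Lemma central_adjoint : is_adjoint U U'.
Proof.
by apply: is_adjoint_comp; [exact: V_adjoint|exact: trans_adjoint].
Qed.

Lemma central_A : A U /\ A U'.
Proof.
split; first exact: (crossed_W actM act1 act_mul phiP).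
exact: (cstar_mul cA) (@crossed_trans R G F act phi _) (@crossed_V R G F act phi _).
Qed.

Lemma central_e0 k : iter k U e0 = ebasis R (b ^+ k, y ^+ k)%g.
Proof.
elim: k => [|k IHk] //; rewrite [LHS]/= IHk; apply: ell2P => -[g x].
rewrite centralE !basisE !expgS; congr (_%:R); congr (nat_of_bool _).
rewrite !xpair_eqE; congr (_ && _); apply/eqP/eqP => [<-|->];
  by rewrite ?mulVKg ?mulKg.
Qed.

Lemma tau_central k : (0 < k)%N -> iter k U e0 (1, 1)%g = 0.
Proof.
move=> k0; rewrite central_e0 basisE xpair_eqE andbC.
by case: eqP => [/esym /(y_free k0)|].
Qed.

Lemma tau_adj S S' : is_adjoint S S' -> tau S = 0 -> tau S' = 0.
Proof.
move=> SS'; rewrite /tau -!inner_basis => S0.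
by rewrite inner_conj -SS' S0 conjc0.
Qed.

Lemma rcomm_A T : A T -> rcomm T.
Proof. exact: (rcomm_crossed actM act1 act_mul phiP). Qed.

Lemma iter_isometry k : l2norm (iter k U e0) = 1.
Proof. by rewrite central_e0 l2norm_basis. Qed.

Definition central_ideal : set op := [set T | A T /\
  forall e : R, 0 < e -> exists2 S, A S & opbd (T - ((U - idfun) \o S)) e].

Lemma central_sub_rcomm T : rcomm T -> (U - idfun) \o T = T \o (U - idfun).
Proof.
move=> rT; apply/funext => xi; rewrite -[RHS]/(T (U xi - xi)) (linB rT.1.1).
by have := congr1 (fun f => f xi) (central_rcomm rT) => /= <-.
Qed.

Lemma AD : A (U - idfun).
Proof. exact: (cstar_sub cA central_A.1 A1). Qed.

Lemma central_ideal_closed : closed_ideal A central_ideal.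
Proof.
have bD : bounded_op (U - idfun) by exact: (cstar_bounded cA AD).
have [d d0 Dd] := bounded_opbd bD.
split.
- by move=> T [].
- split; first exact: (cstar_zero cA).
  move=> e e_gt0; exists 0; first exact: (cstar_zero cA).
  have -> : (0 : op) - ((U - idfun) \o 0) = 0.
    apply/funext => xi; rewrite -[LHS]/(0 - (U - idfun) (0 : H)) (lin0 bD.1).
    exact: subrr.
  exact: opbd_le (ltW e_gt0) (@opbd0 _ _).
- move=> a S T [AS aS] [AT aT]; split; first exact: (cstar_lin cA).
  move=> e e_gt0; have e2 : 0 < e / 2 by lra.
  have f0 : 0 < e / 2 / (normc a + 1) by rewrite divr_gt0 ?ltr_wpDl ?normc_ge0.
  have [S1 AS1 S1e] := aS _ f0; have [T1 AT1 T1e] := aT _ e2.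
  exists (a *: S1 + T1); first exact: (cstar_lin cA).
  have -> : a *: S + T - ((U - idfun) \o (a *: S1 + T1)) =
      a *: (S - ((U - idfun) \o S1)) + (T - ((U - idfun) \o T1)).
    have -> : (U - idfun) \o (a *: S1 + T1) =
        a *: ((U - idfun) \o S1) + ((U - idfun) \o T1).
      by apply/funext => xi; exact: bD.1.
    move: (_ \o S1) (_ \o T1) => P Q; by rewrite scalerBr opprD addrACA.
  apply: opbd_le (opbdD (opbdZ a S1e) T1e).
  have a1 : 0 < normc a + 1 by rewrite ltr_wpDl ?normc_ge0.
  have : normc a * (e / 2 / (normc a + 1)) <= e / 2.
    by rewrite mulrCA ler_piMr ?(ltW e2) // ler_pdivrMr // mul1r lerDl.
  lra.
- move=> S T AS [AT aT]; split; first exact: (cstar_mul cA).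
  move=> e e_gt0; have bS := cstar_bounded cA AS.
  have [c c0 Sc] := bounded_opbd bS.
  have f0 : 0 < e / (c + 1) by rewrite divr_gt0 ?ltr_wpDl.
  have [T1 AT1 T1e] := aT _ f0; exists (S \o T1); first exact: (cstar_mul cA).
  have -> : (S \o T) - ((U - idfun) \o (S \o T1)) = S \o (T - ((U - idfun) \o T1)).
    rewrite -[X in _ - X]/(((U - idfun) \o S) \o T1) (central_sub_rcomm (rcomm_A AS)).
    by apply/funext => xi; rewrite -[RHS]/(S (T xi - (U - idfun) (T1 xi))) (linB bS.1).
  apply: opbd_le (opbd_comp c0 Sc T1e).
  by rewrite mulrCA ler_piMr ?(ltW e_gt0) // ler_pdivrMr ?ltr_wpDl // mul1r lerDl.
- move=> S T [AS aS] AT; split; first exact: (cstar_mul cA).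
  move=> e e_gt0; have bT := cstar_bounded cA AT.
  have [c c0 Tc] := bounded_opbd bT.
  have f0 : 0 < e / (c + 1) by rewrite divr_gt0 ?ltr_wpDl.
  have [S1 AS1 S1e] := aS _ f0; exists (S1 \o T); first exact: (cstar_mul cA).
  have -> : (S \o T) - ((U - idfun) \o (S1 \o T)) = (S - ((U - idfun) \o S1)) \o T by [].
  apply: opbd_le (opbd_comp (ltW f0) S1e Tc).
  by rewrite -mulrA ler_piMr ?(ltW e_gt0) // ler_pdivrMl ?ltr_wpDl // mulr1 lerDl.
- apply/norm_closedP; first by move=> T [/(cstar_bounded cA)].
  move=> T bT aT; have /norm_closedP W0 := cstar_closed cA; split.
    apply: W0 (cstar_bounded cA) _ bT _ => e e_gt0.
    by have [S [AS _] Se] := aT e e_gt0; exists S.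
  move=> e e_gt0; have e2 : 0 < e / 2 by lra.
  have [S [AS aS] Se] := aT _ e2; have [S1 AS1 S1e] := aS _ e2.
  exists S1 => //; rewrite -(subrK S T) -addrA.
  by apply: opbd_le (opbdD Se S1e); lra.
Qed.

(* Unit vectors that are almost fixed by U show that the ideal is proper.     *)
Lemma central_ideal_proper : ~ central_ideal idfun.
Proof.
move=> [_ aI]; have h0 : (0 : R) < 1 / 2 by lra.
have [S AS Se] := aI _ h0.
have bS := cstar_bounded cA AS; have [c c0 Sc] := bounded_opbd bS.
(* With [xi] the sum of the first [N] iterates of [e0], the approximate inverse [S] of U - 1 would
   force the norm of [xi] below [4 * c], whereas its square is at least [N]. *)
pose N := (Num.bound ((4 * c) ^+ 2)).+1.
pose xi : H := \sum_(i < N) iter i U e0.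
have xiN : N%:R <= l2norm xi ^+ 2.
  have -> : xi = \sum_(i < N) ebasis R ((b ^+ i, y ^+ i)%g : G * F).
    by apply: eq_bigr => i _; exact: central_e0.
  apply: l2norm_sum_basis => i j [_].
  wlog ij : i j / (i <= j)%N => [W0 e|e].
    by have [/W0|/ltnW /W0 W1] := leqP i j; [exact|apply/esym/W1].
  apply/val_inj/eqP; rewrite eqn_leq ij leqNgt /=; apply/negP => lt.
  apply: (@y_free (j - i)%N); first by rewrite subn_gt0.
  by apply: (mulgI (y ^+ i)%g); rewrite -expgnDr subnKC // mulg1.
have Dxi : (U - idfun) xi = iter N U e0 - e0.
  rewrite -[LHS]/(U xi - xi) /xi (lin_sum (cstar_bounded cA central_A.1).1).
  elim: N {xi xiN} => [|k IHk]; first by rewrite !big_ord0 subrr subrr.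
  by rewrite !big_ord_recr /= opprD addrACA IHk addrC addrA subrK.
have D2 : l2norm ((U - idfun) xi) <= 2.
  rewrite Dxi; apply: le_trans (l2normD _ _) _.
  by rewrite l2normN iter_isometry l2norm_basis.
have xi4 : l2norm xi <= 4 * c.
  have := Se xi.
  have -> : (idfun - ((U - idfun) \o S)) xi = xi - S ((U - idfun) xi).
    have := congr1 (fun f => f xi) (central_sub_rcomm (rcomm_A AS)) => /= <-.
    by [].
  have := l2norm_dist xi (S ((U - idfun) xi)) 0; rewrite !subr0.
  have := Sc ((U - idfun) xi).
  have : c * l2norm ((U - idfun) xi) <= c * 2 by rewrite ler_wpM2l.
  lra.
have h1 : (N%:R : R) <= (4 * c) ^+ 2.
  apply: le_trans xiN _; rewrite ler_pXn2r // nnegrE ?l2norm_ge0 //.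
  by rewrite mulr_ge0.
have h2 := archi_boundP (sqr_ge0 (4 * c)).
have h3 : ((Num.bound ((4 * c) ^+ 2))%:R : R) <= N%:R by rewrite ler_nat.
by have := lt_le_trans h2 (le_trans h3 h1); rewrite ltxx.
Qed.

Lemma not_simple : ~ simple_cstar A.
Proof.
move=> /(_ _ central_ideal_closed) [E|E]; last first.
  by apply: central_ideal_proper; rewrite E; exact: A1.
have : central_ideal (U - idfun).
  split; first exact: AD.
  move=> e e_gt0; exists idfun; first exact: A1.
  have -> : (U - idfun) - ((U - idfun) \o idfun) = 0 by exact: subrr.
  exact: opbd_le (ltW e_gt0) (@opbd0 _ _).
rewrite E => /(congr1 (fun f : op => f e0 (1, 1)%g)).
rewrite -[LHS]/(U e0 (1, 1)%g - e0 (1, 1)%g) (tau_central (isT : 0 < 1)%N).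
rewrite basisE eqxx sub0r -[RHS]/(0 : C) => /eqP.
by rewrite oppr_eq0 oner_eq0.
Qed.

Let half : C := Complex 2^-1 0.

Lemma half2 : half + half = 1. Proof. exact: half_half. Qed.

(** The canonical trace weighted by the central element 1 + (U + U')/2, which is positive because it
    is half the product of 1 + U and its adjoint. It takes the value 1/2 at [U'], where [tau]
    vanishes. *)
Definition tau2 (T : op) : C := tau T + half * (tau (U \o T) + tau (U' \o T)).

Lemma tau2_state : tracial_state A tau2.
Proof.
have [AU AU'] := central_A.
have bU := cstar_bounded cA AU; have bU' := cstar_bounded cA AU'.
have [K K'] := centralK.
split.
- move=> a S T AS AT; rewrite /tau2.
  have -> : U \o (a *: S + T) = a *: (U \o S) + (U \o T) by apply/funext => xi; exact: bU.1.
  have -> : U' \o (a *: S + T) = a *: (U' \o S) + (U' \o T) by apply/funext => xi; exact: bU'.1.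
  by rewrite !tau_lin; ring.
- move=> S T AS AT ST.
  pose S2 := (idfun + U') \o S; pose T2 := T \o (idfun + U).
  have AS2 : A S2 by apply: (cstar_mul cA) => //; exact: (cstar_add cA A1 AU').
  have AT2 : A T2 by apply: (cstar_mul cA) => //; exact: (cstar_add cA A1 AU).
  have ST2 : is_adjoint S2 T2.
    apply: is_adjoint_comp ST; apply: adjointD (@adjoint_id R _) _.
    exact: is_adjoint_sym central_adjoint.
  have := tau_pos AS2 AT2 ST2.
  have bT := cstar_bounded cA AT.
  have -> : T2 \o S2 = 1 *: (T \o S) + (1 *: (T \o S) + (1 *: (U \o (T \o S)) + (U' \o (T \o S)))).
    apply/funext => xi.
    rewrite -[LHS]/(T ((S xi + U' (S xi)) + U (S xi + U' (S xi)))).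
    rewrite -[RHS]/(1 *: T (S xi) + (1 *: T (S xi) + (1 *: U (T (S xi)) + U' (T (S xi))))).
    rewrite (linD bU.1) !scale1r.
    have -> : U (U' (S xi)) = S xi by have := congr1 (fun f => f (S xi)) K.
    have := congr1 (fun f => f (S xi)) (central_rcomm (rcomm_A AT)) => /= ->.
    have := congr1 (fun f => f (S xi)) (central_rcomm' (rcomm_A AT)) => /= ->.
    rewrite !(linD bT.1).
    by apply: ell2P => q; rewrite !ell2D; ring.
  rewrite !tau_lin !mul1r /tau2 => pos.
  have -> : tau (T \o S) + half * (tau (U \o (T \o S)) + tau (U' \o (T \o S))) =
    half * (tau (T \o S) + (tau (T \o S) + (tau (U \o (T \o S)) + tau (U' \o (T \o S))))).
    by rewrite -[X in X + _ = _]mul1r -half2; ring.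
  by apply: mulr_ge0 => //; rewrite lecE /= eqxx; lra.
- rewrite /tau2 tau_id -[U \o idfun]/U -[U' \o idfun]/U'.
  have U0 : tau U = 0 by exact: (tau_central (isT : 0 < 1)%N).
  by rewrite U0 (tau_adj central_adjoint U0) addr0 mulr0 addr0.
- move=> S T AS AT; rewrite /tau2 (tau_trace actM act1 act_mul phiP AS AT).
  have trc Z : A Z -> Z \o T = T \o Z -> tau (Z \o (S \o T)) = tau (Z \o (T \o S)).
    move=> AZ ZT; rewrite -[Z \o (S \o T)]/((Z \o S) \o T).
    rewrite (tau_trace actM act1 act_mul phiP (cstar_mul cA AZ AS) AT).
    by rewrite -[T \o _]/((T \o Z) \o S) -ZT.
  by rewrite (trc U) ?(trc U') //; [exact/central_rcomm'/rcomm_A|exact/central_rcomm/rcomm_A].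
Qed.

Lemma not_unique_trace : ~ unique_tracial_state A.
Proof.
have [AU AU'] := central_A; have [K K'] := centralK.
move=> [psi tpsi uniq].
have E1 := uniq _ (tau_state actM act1 act_mul phiP) _ AU'.
have E2 := uniq _ tau2_state _ AU'.
have U0 : tau U = 0 by exact: (tau_central (isT : 0 < 1)%N).
have U'0 := tau_adj central_adjoint U0.
have UU0 : tau (U' \o U') = 0.
  apply: (tau_adj (is_adjoint_comp central_adjoint central_adjoint)).
  exact: (tau_central (isT : 0 < 2)%N).
move: E2; rewrite /tau2 -E1 U'0 UU0 K tau_id add0r addr0 mulr1 => -[/eqP].
by rewrite invr_eq0 pnatr_eq0.
Qed.

Lemma not_factor : ~ Defs.factor M.
Proof.
have MU : M U by exact: (vn_W actM act1 act_mul phiP).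
move=> /(_ U MU) []; first split.
- exact: (W_bounded actM act1 act_mul phiP).
- by move=> S /(rcomm_vn actM act1 act_mul phiP) rS; exact: central_rcomm.
move=> c UE; have := congr1 (fun f : op => f e0 (1, 1)%g) UE.
rewrite (tau_central (isT : 0 < 1)%N) -[RHS]/(c * e0 (1, 1)%g) basisE eqxx mulr1 => c0.
have := iter_isometry 1; rewrite [iter _ _ _]/= UE -c0 scale0r l2norm0 => /esym/eqP.
by rewrite oner_eq0.
Qed.

End CentralUnitary.

(** * Averaging over the free generators and over a braid generator *)

Section BraidAveraging.
Variable n : nat.
Hypothesis n2 : (2 <= n)%N.
Local Notation B := (braid_group n).
Local Notation F := (free_group n).
Variables (R : realType) (phi : B -> F -> R[i]).
Hypothesis phiP : cocycle (@artin n) phi.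
Local Notation C := R[i].
Local Notation H := (ell2 R (B * F)%type).
Local Notation op := (H -> H).
Local Notation act := (@artin n).
Local Notation V := (V act phi).
Local Notation Tr := (@Tr R B F).
Local Notation W := (W act phi).

Let actM : forall (a b : B) x, act (a * b)%g x = act a (act b x) := @artinM n.
Let act1 : forall x, act 1%g x = x := @artin1 n.
Let act_mul : forall (a : B) x y, act a (x * y)%g = (act a x * act a y)%g :=
  @artin_multiplicative n.

(** Brings the images of generators under braids within reach of the ping-pong lemma [lead_conj]. *)
Lemma artin_conj_gen (b : B) (j : 'I_n) : exists u (k : 'I_n),
  artin b (fg_gen j) = (u * fg_gen k * u^-1)%g.
Proof.
have sgV_hi i : (i < n.-1)%N -> artin (sg n i)^-1%g (xg n i.+1) = xg n i.
  by move=> lt; apply: (@artin_inj _ (sg n i)); rewrite artinKV artin_sg_lo.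
have sgV_lo i : (i < n.-1)%N ->
    artin (sg n i)^-1%g (xg n i) = (xg n i * xg n i.+1 * (xg n i)^-1)%g.
  move=> lt; apply: (@artin_inj _ (sg n i)); rewrite artinKV !artinMg artinV.
  by rewrite artin_sg_lo // artin_sg_hi // !mulgA mulgV mul1g mulgK.
have step (s : B) : (forall k : 'I_n, exists u (k' : 'I_n),
      artin s (fg_gen k) = (u * fg_gen k' * u^-1)%g) ->
    forall b : B, (exists u (k : 'I_n), artin b (fg_gen j) = (u * fg_gen k * u^-1)%g) ->
    exists u (k : 'I_n), artin (s * b)%g (fg_gen j) = (u * fg_gen k * u^-1)%g.
  move=> sP b0 [u [k E]]; have [v [k' E']] := sP k.
  exists (artin s u * v)%g, k'; rewrite artinM /= E !artinMg artinV E' invgM.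
  by rewrite !mulgA.
have triv (k : 'I_n) : fg_gen k = (1 * fg_gen k * 1^-1)%g by rewrite invg1 mulg1 mul1g.
have mk i m : (i < n)%N -> (exists u, m = u * xg n i * u^-1)%g ->
    exists u (k : 'I_n), m = (u * fg_gen k * u^-1)%g.
  by move=> lt [u ->]; exists u, (Ordinal lt); rewrite -xg_ord.
have ltS (i : 'I_n.-1) : (i.+1 < n)%N by have := ltn_ord i; lia.
move: b; apply: pres_ind => [|i b|i b].
- by exists 1%g, j; rewrite artin1 -triv.
- apply: step => k; rewrite -/(br_gen i) -sg_ord -xg_ord.
  have [->|ki] := eqVneq (k : nat) i.
    by apply: (mk i.+1) => //; exists 1%g; rewrite artin_sg_lo // invg1 mulg1 mul1g.
  have [->|ki1] := eqVneq (k : nat) i.+1.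
    apply: (mk i); first exact: ltnW.
    by exists (xg n i.+1)^-1%g; rewrite artin_sg_hi // invgK.
  by exists 1%g, k; rewrite artin_sg_id // xg_ord -triv.
- apply: step => k; rewrite -/(br_gen i) -sg_ord -xg_ord.
  have [->|ki] := eqVneq (k : nat) i.
    by apply: (mk i.+1) => //; exists (xg n i); rewrite sgV_lo.
  have [->|ki1] := eqVneq (k : nat) i.+1.
    apply: (mk i); first exact: ltnW.
    by exists 1%g; rewrite sgV_hi // invg1 mulg1 mul1g.
  exists 1%g, k; rewrite -[X in artin _ X = _](@artin_sg_id n i) // artinVK.
  by rewrite xg_ord -triv.
Qed.

Lemma lead_genX j m (v : F) : lead j (fg_gen j ^+ m * v)%g = m%:Z + lead j v.
Proof.
elim: m => [|m IHm]; first by rewrite mul1g add0r.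
rewrite expgS -mulgA -[X in lead j (X * _)%g]/(lgen (j, true)) lead_lgen IHm.
by rewrite intS addrA.
Qed.

Lemma lead_genV j m (v : F) : lead j ((fg_gen j ^+ m)^-1 * v)%g = lead j v - m%:Z.
Proof.
apply/eqP; rewrite eq_sym subr_eq addrC -lead_genX.
by rewrite mulgA mulgV mul1g.
Qed.

(** Read through [act g x], the unitary [V] is plain left translation up to a phase. Take as target
    the leading power of the j-th generator and as source the leading power of the k-th one after
    removing [u]. The powers of [z] and of the j-th generator shift these by [i], and [lead_conj] is
    exactly the condition of [powers_estimate]. *)
Lemma powers_twisted (j : 'I_n) (z : F) (c : nat -> C) N (xi : H) :
  (forall i, normc (c i) = 1) ->
  (exists u (k : 'I_n), z = (u * fg_gen k * u^-1)%g) -> z <> fg_gen j ->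
  l2norm (\sum_(i < N) c i *: V (fg_gen j ^+ i * (z ^+ i)^-1)%g xi) <=
  2 * Num.sqrt N%:R * l2norm xi.
Proof.
move=> c1 [u [k zE]] zj; have [|s [m pp]] := @lead_conj n j k u.
  by rewrite -zE.
pose y i := (fg_gen j ^+ i * (z ^+ i)^-1)%g.
have yE i v : (u^-1 * ((y i)^-1 * v) = fg_gen k ^+ i * (u^-1 * ((fg_gen j ^+ i)^-1 * v)))%g.
  have zX : (z ^+ i = u * fg_gen k ^+ i * u^-1)%g.
    elim: i => [|i IHi]; first by rewrite mulg1 mulgV.
    by rewrite !expgS IHi zE !mulgA mulgVK.
  by rewrite /y invgM invgK zX !mulgA mulVg mul1g.
apply: (@powers_estimate R (B * F)%type int N (fun i xi => c i *: V (y i) xi)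
  (fun i q => c i * phi q.1^-1%g (y i))
  (fun i q => (q.1, (act q.1^-1%g (y i))^-1 * q.2)%g) _ _ _
  (fun q => lead k (u^-1 * act q.1 q.2)%g) (fun q => lead j (act q.1 q.2))
  (fun i => s + (i : nat)%:Z) (fun i => m + (i : nat)%:Z)).
- by move=> i eta q; rewrite ell2Z (VE' actM act1 act_mul phiP) mulrA.
- by move=> i q; rewrite normcM c1 (normc_phi phiP) mulr1.
- by move=> i; exact: V_bij.
- by move=> i i' /addrI [] /val_inj.
- by move=> i i' /addrI [] /val_inj.
move=> i [g x] /= tq; rewrite act_mul artinV artinKV yE lead_genX addrC; congr (_ + _).
apply/eqP/negPn/negP => /pp; rewrite mulgA mulgV mul1g lead_genV => E.
by move/eqP: tq; apply; rewrite -E subrK.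
Qed.

Local Notation upair := (@upair R B F act phi).

Definition conj_gen (j : 'I_n) N : op -> op :=
  avg (fun i => V (fg_gen j ^+ i)%g) (fun i => V (fg_gen j ^+ i)^-1%g) N.

Lemma conj_gen_avg j N Phi : avg_map upair Phi -> avg_map upair (fun T => conj_gen j N (Phi T)).
Proof. by apply: avg_map_step => i; left; exists (fg_gen j ^+ i)%g. Qed.

Lemma conj_gen_lin j N a S T :
  conj_gen j N (a *: S + T) = a *: conj_gen j N S + conj_gen j N T.
Proof.
exact: (avg_map_lin actM act1 act_mul phiP (conj_gen_avg j N (avg_map_id _))).
Qed.

Lemma conj_gen_opbd j N T c : opbd T c -> opbd (conj_gen j N T) c.
Proof.
exact: (avg_map_opbd actM act1 act_mul phiP (conj_gen_avg j N (avg_map_id _))).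
Qed.

(* The condition on q says that it commutes with the first m generators in    *)
(* the semidirect product.                                                    *)
Definition fixing (m : nat) : set op := [set W q | q in
  [set q | q != (1, 1)%g /\ forall k : 'I_n, (k < m)%N ->
    (q.1 * artin q.2 (fg_gen k) * q.1^-1)%g = fg_gen k]].

(** For [h] the i-th power of a generator x_j, the left factor is x_j^i z^-i with z the conjugate of
    x_j by [(y, b)]. So conjugation only rescales [W (y, b)] when z = x_j, and otherwise yields the
    family of [powers_twisted]. *)
Lemma V_conj_W h (y : F) (b : B) : V h \o W (y, b) \o V h^-1%g =
  phi b h^-1%g *: (V (h * y * artin b h^-1 * y^-1)%g \o W (y, b)).
Proof.
have vm := V_M actM act1 act_mul phiP.
have tv := trans_V actM act1 act_mul phiP b h^-1%g.
apply/funext => xi.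
transitivity (V h (V y ((Tr b \o V h^-1%g) xi))) => //; rewrite tv.
transitivity (V h (V y (phi b h^-1%g *: V (artin b h^-1%g) (Tr b xi)))) => //.
rewrite (linZ (V_bounded actM act1 act_mul phiP _).1) (linZ (V_bounded actM act1 act_mul phiP _).1).
transitivity (phi b h^-1%g *: (V (h * y * artin b h^-1 * y^-1)%g \o V y) (Tr b xi)) => //.
rewrite vm mulgVK; congr (_ *: _).
by transitivity ((V h \o (V y \o V (artin b h^-1)%g)) (Tr b xi)) => //; rewrite !vm mulgA.
Qed.

Lemma sqrt_small (e : R) : 0 < e -> exists N0 : nat, forall N, (N0 <= N)%N ->
  N.+1%:R^-1 * (2 * Num.sqrt N.+1%:R) <= e.
Proof.
move=> e0; exists (Num.bound (4 / e ^+ 2)) => N leN.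
have N0 : (0 : R) < N.+1%:R by rewrite ltr0n.
have r0 : 0 < Num.sqrt (N.+1%:R : R) by rewrite sqrtr_gt0.
have r2 : Num.sqrt (N.+1%:R : R) ^+ 2 = N.+1%:R by rewrite sqr_sqrtr // ltW.
move: (Num.sqrt _) r0 r2 => r r0 r2.
have e2 : 0 < e ^+ 2 by rewrite exprn_gt0.
have : 4 / e ^+ 2 <= N.+1%:R.
  have b := archi_boundP (ltW (divr_gt0 (ltr0Sn R 3) e2)).
  apply: le_trans (ltW b) _; rewrite ler_nat; exact: leqW.
rewrite ler_pdivrMr // ler_pdivrMl // -r2 => h.
have h2 : 2 <= e * r.
  rewrite -(@ler_pXn2r _ 2) // ?nnegrE ?mulr_ge0 ?(ltW e0) ?(ltW r0) //.
  by rewrite exprMn [e ^+ 2 * _]mulrC (_ : 2 ^+ 2 = 4 :> R) //; ring.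
have := ler_wpM2l (ltW r0) h2; rewrite expr2; nra.
Qed.

(** Either the unitary commutes with the j-th generator up to phase and its average is a multiple of
    itself, which is kept, or the average has norm O(1/sqrt N). The threshold on [N] lets one
    average serve all terms of a combination. *)
Lemma kill_term (j : 'I_n) T (e : R) : fixing j T -> 0 < e ->
  exists N0 : nat, forall N, (N0 <= N)%N ->
  exists2 S, lspan (fixing j.+1) S & opbd (conj_gen j N T - S) e.
Proof.
move=> [[y b] /= [q1 fx] <-] e0.
pose z := (y * artin b (fg_gen j) * y^-1)%g.
have zX i : (fg_gen j ^+ i * y * artin b (fg_gen j ^+ i)^-1 * y^-1 =
    fg_gen j ^+ i * (z ^+ i)^-1)%g.
  rewrite artinV artinX -!mulgA; congr (_ * _)%g.
  suff -> : (z ^+ i = y * artin b (fg_gen j) ^+ i * y^-1)%g by rewrite !invgM invgK mulgA.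
  elim: i => [|i IHi]; first by rewrite mulg1 mulgV.
  by rewrite !expgS IHi /z !mulgA mulgVK.
pose c i := phi b (fg_gen j ^+ i)^-1%g.
have cE N xi : conj_gen j N (W (y, b)) xi = (N.+1%:R^-1 : C) *:
    \sum_(i < N.+1) c i *: V (fg_gen j ^+ i * (z ^+ i)^-1)%g (W (y, b) xi).
  rewrite /conj_gen avgE; congr (_ *: _); apply: eq_bigr => i _.
  rewrite -zX; have := congr1 (fun f => f xi) (V_conj_W (fg_gen j ^+ i)%g y b).
  by [].
have [zj|/eqP zj] := eqVneq z (fg_gen j).
  exists 0%N => N _; exists ((N.+1%:R^-1 * \sum_(i < N.+1) c i) *: W (y, b)).
    apply/lspanZ/lspan_sub; exists (y, b) => //; split=> // k.
    rewrite ltnS leq_eqVlt => /orP[/eqP kj|]; last exact: fx.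
    by have -> : k = j by apply: val_inj.
  have -> : conj_gen j N (W (y, b)) = (N.+1%:R^-1 * \sum_(i < N.+1) c i) *: W (y, b).
    apply/funext => xi; rewrite cE -[RHS]/(_ *: W (y, b) xi) -scalerA; congr (_ *: _).
    rewrite scaler_suml; apply: eq_bigr => i _; congr (_ *: _).
    by rewrite zj mulgV (V1 actM act1 act_mul phiP).
  rewrite subrr; exact: opbd_le (ltW e0) (@opbd0 _ _).
have [N0 small] := sqrt_small e0; exists N0 => N leN.
exists 0; first exact: lspan0.
rewrite subr0 => xi; rewrite cE l2normZ normc_natV.
have zc : exists u (k : 'I_n), z = (u * fg_gen k * u^-1)%g.
  have [u [k E]] := artin_conj_gen b j; exists (y * u)%g, k.
  by rewrite /z E invgM !mulgA.
have := powers_twisted N.+1 (W (y, b) xi) (fun i => normc_phi phiP b (fg_gen j ^+ i)^-1%g) zc zj.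
rewrite (W_isometry actM act1 act_mul phiP) => le1.
have N0' : (0 : R) <= N.+1%:R^-1 by rewrite invr_ge0.
apply: le_trans (ler_wpM2l N0' le1) _.
by rewrite mulrA ler_wpM2r ?l2norm_ge0 // small.
Qed.

Lemma kill_stage (j : 'I_n) T : lspan (fixing j) T -> forall e : R, 0 < e ->
  exists N0 : nat, forall N, (N0 <= N)%N ->
  exists2 S, lspan (fixing j.+1) S & opbd (conj_gen j N T - S) e.
Proof.
elim=> [|a T1 T2 fT1 _ IH] e e0.
  exists 0%N => N _; exists 0; first exact: lspan0.
  have := conj_gen_lin j N (-1) 0 0; rewrite scaler0 addr0 scaleN1r addNr => ->.
  rewrite subr0; exact: opbd_le (ltW e0) (@opbd0 _ _).
have e2 : 0 < e / 2 by lra.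
have a1 : 0 < normc a + 1 by rewrite ltr_wpDl ?normc_ge0.
have f0 : 0 < e / 2 / (normc a + 1) by rewrite divr_gt0.
have [N1 H1] := kill_term fT1 f0; have [N2 H2] := IH _ e2.
exists (maxn N1 N2) => N; rewrite geq_max => /andP[/H1[S1 lS1 le1] /H2[S2 lS2 le2]].
exists (a *: S1 + S2); first by apply: lspanD => //; exact: lspanZ.
have -> : conj_gen j N (a *: T1 + T2) - (a *: S1 + S2) =
    a *: (conj_gen j N T1 - S1) + (conj_gen j N T2 - S2).
  rewrite conj_gen_lin; move: (conj_gen j N T1) (conj_gen j N T2) => P Q.
  by rewrite scalerBr opprD addrACA.
apply: opbd_le (opbdD (opbdZ a le1) le2).
have : normc a * (e / 2 / (normc a + 1)) <= e / 2.
  by rewrite mulrCA ler_piMr ?(ltW e2) // ler_pdivrMr // mul1r lerDl.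
lra.
Qed.

(** After stage [n] only unitaries whose index centralizes the whole free group remain; errors of
    earlier stages survive because averaging is contractive and do not grow. *)
Lemma kill_generators T : lspan (offdiag act phi) T -> forall m, (m <= n)%N ->
  forall e : R, 0 < e -> exists2 Phi, avg_map upair Phi &
  exists2 S, lspan (fixing m) S & opbd (Phi T - S) e.
Proof.
move=> lT; elim=> [|m IHm] mn e e0.
  exists id; first exact: avg_map_id.
  exists T; last by rewrite subrr; exact: opbd_le (ltW e0) (@opbd0 _ _).
  move: lT; apply: lspan_mono => _ [q q1 <-]; apply: lspan_sub.
  by exists q.
have e2 : 0 < e / 2 by lra.
have [Phi PhiP [S lS le1]] := IHm (ltnW mn) _ e2.
have [N0 H0] := @kill_stage (Ordinal mn) S lS _ e2.
have [S' lS' le2] := H0 N0 (leqnn _).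
exists (fun T => conj_gen (Ordinal mn) N0 (Phi T)); first exact: conj_gen_avg.
exists S' => //.
have -> : conj_gen (Ordinal mn) N0 (Phi T) - S' =
   conj_gen (Ordinal mn) N0 (Phi T - S) + (conj_gen (Ordinal mn) N0 S - S').
  have -> : Phi T - S = (-1) *: S + Phi T by rewrite scaleN1r addrC.
  rewrite conj_gen_lin scaleN1r.
  move: (conj_gen _ _ (Phi T)) (conj_gen _ _ S) => P Q.
  by rewrite [- Q + P]addrC addrA subrK.
by apply: opbd_le (opbdD (conj_gen_opbd _ _ le1) le2); lra.
Qed.

Hypothesis nt : nontorsion (mu phi).

Definition conj_sg N : op -> op :=
  avg (fun i => Tr (sg n 0 ^+ i)%g) (fun i => Tr (sg n 0 ^+ i)^-1%g) N.

Lemma conj_sg_avg N Phi : avg_map upair Phi -> avg_map upair (fun T => conj_sg N (Phi T)).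
Proof. by apply: avg_map_step => i; right; exists (sg n 0 ^+ i)%g. Qed.

Lemma conj_sg_lin N a S T :
  conj_sg N (a *: S + T) = a *: conj_sg N S + conj_sg N T.
Proof.
exact: (avg_map_lin actM act1 act_mul phiP (conj_sg_avg N (avg_map_id _))).
Qed.

Lemma geometric_small (z : C) (e : R) : normc z = 1 -> z != 1 -> 0 < e ->
  exists N0 : nat, forall N, (N0 <= N)%N ->
  normc (N.+1%:R^-1 * \sum_(i < N.+1) z ^+ i) <= e.
Proof.
move=> z1 zn1 e0; have zn0 : z - 1 != 0 by rewrite subr_eq0.
have d0 : 0 < normc (z - 1).
  rewrite lt_def normc_ge0 andbT; apply: contra_neq zn0; exact: eq0_normc.
have ed : 0 < e * normc (z - 1) by rewrite mulr_gt0.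
exists (Num.bound (2 / (e * normc (z - 1)))) => N leN.
have sE : \sum_(i < N.+1) z ^+ i = (z ^+ N.+1 - 1) / (z - 1).
  by apply: (canRL (mulfK zn0)); rewrite mulrC -subrX1.
have zX k : normc (z ^+ k) = 1.
  by elim: k => [|k IHk]; [exact: normc1|rewrite exprS normcM z1 IHk mul1r].
rewrite sE normcM normc_natV normcM normcV.
have le2 : normc (z ^+ N.+1 - 1) <= 2.
  by apply: le_trans (le_normcD _ _) _; rewrite normcN zX normc1.
have N0' : (0 : R) < N.+1%:R by rewrite ltr0n.
rewrite mulrA ler_pdivrMr // ler_pdivrMl //.
have b := archi_boundP (ltW (divr_gt0 (ltr0Sn R 1) ed)).
have : 2 / (e * normc (z - 1)) <= N.+1%:R.
  apply: le_trans (ltW b) _; rewrite ler_nat; exact: leqW.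
by rewrite ler_pdivrMr // => /(le_trans le2).
Qed.

(** Conjugation by the i-th power of the first braid generator multiplies such a unitary by the i-th
    power of [phi (sg n 0) y], which differs from 1 by [nontorsion_center]; the average is a
    normalized geometric sum. *)
Lemma kill_center_term T (e : R) : fixing n T -> 0 < e ->
  exists N0 : nat, forall N, (N0 <= N)%N -> opbd (conj_sg N T) e.
Proof.
move=> [[y b] /= [q1 fx] <-] e0.
have fx' j : (y * artin b (xg n j) * y^-1)%g = xg n j.
  have [jn|jn] := ltnP j n; last by rewrite xg_out // artin1e mulg1 mulgV.
  by have := fx (Ordinal jn) jn; rewrite -xg_ord.
have [bC yfix yn1] := nontorsion_center n2 phiP nt fx' q1.
pose c := phi (sg n 0) y.
have [N0 small] := geometric_small (normc_phi phiP _ _) yn1 e0.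
exists N0 => N leN xi.
have phiX0 i : phi (sg n 0 ^+ i)%g y = c ^+ i.
  elim: i => [|i IHi]; first by rewrite (cocycle1 act1 phiP).
  by rewrite expgS (cocycle_mul phiP) yfix IHi exprS.
have -> : conj_sg N (W (y, b)) xi = (N.+1%:R^-1 * \sum_(i < N.+1) c ^+ i) *: W (y, b) xi.
  rewrite /conj_sg avgE -scalerA; congr (_ *: _).
  rewrite scaler_suml; apply: eq_bigr => i _.
  set s := (sg n 0 ^+ i)%g.
  have tv := trans_V actM act1 act_mul phiP s y.
  transitivity ((Tr s \o V y) ((Tr b \o Tr s^-1%g) xi)) => //.
  rewrite tv trans_M phiX0 yfix.
  transitivity (c ^+ i *: V y ((Tr s \o Tr (b * s^-1)%g) xi)) => //.
  by rewrite trans_M mulgA bC mulgK.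
rewrite l2normZ (W_isometry actM act1 act_mul phiP) ler_wpM2r ?l2norm_ge0 //.
exact: small.
Qed.

Lemma kill_center T : lspan (fixing n) T -> forall e : R, 0 < e ->
  exists N0 : nat, forall N, (N0 <= N)%N -> opbd (conj_sg N T) e.
Proof.
elim=> [|a T1 T2 fT1 _ IH] e e0.
  exists 0%N => N _.
  have := conj_sg_lin N (-1) 0 0; rewrite scaler0 addr0 scaleN1r addNr => ->.
  exact: opbd_le (ltW e0) (@opbd0 _ _).
have e2 : 0 < e / 2 by lra.
have a1 : 0 < normc a + 1 by rewrite ltr_wpDl ?normc_ge0.
have f0 : 0 < e / 2 / (normc a + 1) by rewrite divr_gt0.
have [N1 H1] := kill_center_term fT1 f0; have [N2 H2] := IH _ e2.
exists (maxn N1 N2) => N; rewrite geq_max => /andP[/H1 le1 /H2 le2].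
rewrite conj_sg_lin; apply: opbd_le (opbdD (opbdZ a le1) le2).
have : normc a * (e / 2 / (normc a + 1)) <= e / 2.
  by rewrite mulrCA ler_piMr ?(ltW e2) // ler_pdivrMr // mul1r lerDl.
lra.
Qed.

Lemma kill_offdiag T : lspan (offdiag act phi) T -> forall e : R, 0 < e ->
  exists2 Phi, avg_map upair Phi & opbd (Phi T) e.
Proof.
move=> lT e e0; have e2 : 0 < e / 2 by lra.
have [Phi PhiP [S lS le1]] := kill_generators lT (leqnn n) e2.
have [N0 H0] := kill_center lS e2; have le2 := H0 N0 (leqnn _).
have PP := conj_sg_avg N0 PhiP.
exists (fun T => conj_sg N0 (Phi T)) => //.
have -> : conj_sg N0 (Phi T) = conj_sg N0 (Phi T - S) + conj_sg N0 S.
  have -> : Phi T - S = (-1) *: S + Phi T by rewrite scaleN1r addrC.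
  rewrite conj_sg_lin scaleN1r; move: (conj_sg _ (Phi T)) (conj_sg _ S) => P Q.
  by rewrite [- Q + P]addrC subrK.
have lo := avg_map_opbd actM act1 act_mul phiP (conj_sg_avg N0 (avg_map_id _)) le1.
by apply: opbd_le (opbdD lo le2); lra.
Qed.

End BraidAveraging.

(** * The equivalences for the deformed braid group actions *)

Lemma boundaryX_neq1 n m : (2 <= n)%N -> (0 < m)%N -> (boundary n ^+ m)%g <> 1%g.
Proof.
move=> n2 m0 e; have n0 : (0 < n)%N by lia.
pose j0 : 'I_n := Ordinal n0.
pose f : free_group n -> free_group n := fg_lift (fun=> fg_gen j0).
have fM : multiplicative_map f by exact: fg_liftM.
have fX k : (k < n)%N -> f (xg n k) = fg_gen j0.
  by move=> lt; rewrite -[k]/(val (Ordinal lt)) xg_ord [LHS]fg_lift_gen.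
have fx k : (k <= n)%N -> f (xprod n k) = (fg_gen j0 ^+ k)%g.
  elim: k => [|k IHk] kn; first by rewrite xprod0 (multiplicative1 fM).
  by rewrite xprodS fM IHk ?(ltnW kn) // fX // expgSr.
have := congr1 f e; rewrite (multiplicativeX fM) (multiplicative1 fM) /boundary fx //.
rewrite -expgnA => /(congr1 (lead j0)).
rewrite -[(_ ^+ _)%g]mulg1 lead_genX => /(canRL (addrK _)).
by rewrite subrr => -[] /eqP; rewrite muln_eq0 => /orP[] /eqP; lia.
Qed.

Theorem theorem4p2 (R : realType) (n : nat)
    (phi : braid_group n -> free_group n -> R[i]) :
  (2 <= n)%N ->
  cocycle (@artin n) phi ->
  let mu := \prod_(j < n.-1) \prod_(k < n) phi (br_gen j) (fg_gen k) in
  let alpha_phi := deformed_action (@artin n) phi in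
  let A := reduced_crossed_product alpha_phi (cstar_reduced R (free_group n)) in
  let M := vn_crossed_product alpha_phi (vn_group R (free_group n)) in
  [<-> nontorsion mu;
       simple_cstar A;
       unique_tracial_state A;
       factor M].
Proof.
move=> n2 phiP mu0 alpha_phi A M.
have actM := @artinM n; have act1 := @artin1 n; have act_mul := @artin_multiplicative n.
have kill : nontorsion mu0 -> forall S, lspan (offdiag (@artin n) phi) S ->
    forall e : R, 0 < e ->
    exists2 Phi, avg_map (@upair _ _ _ (@artin n) phi) Phi & opbd (Phi S) e.
  by move=> nt S lS; exact: kill_offdiag.
(* A power of the boundary word and the same power of the full twist meet all the assumptions made
   on a central unitary of infinite order. *)
have center : ~ nontorsion mu0 -> exists y b,
  [/\ forall x, artin b x = (y^-1 * x * y)%g, forall a, artin a y = y,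
      forall a : braid_group n, (a * b = b * a)%g, forall x, phi b x = 1
    & (forall a, phi a y = 1) /\ forall m, (0 < m)%N -> (y ^+ m)%g <> 1%g].
  move=> nnt; have [m m0 [h1 h2]] := torsion_center n2 phiP nnt.
  exists (boundary n ^+ m)%g, (full_twist n ^+ m)%g; split=> //.
  - exact: artin_full_twistX.
  - by move=> a; rewrite artinX artin_boundary.
  - move=> a; apply: artin_ext => x; rewrite !artinM /= !artin_full_twistX // !artinMg artinV.
    by rewrite artinX artin_boundary.
  - split=> // k k0; rewrite -expgnA; apply: boundaryX_neq1 => //.
    by rewrite muln_gt0 m0.
(* Each later link of the cycle passes through the first condition: a property that fails for
   torsion parameters implies it, and the averaging argument then gives the next property. *)
have to_nt (P : Prop) : (~ nontorsion mu0 -> ~ P) -> P -> nontorsion mu0.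
  by move=> nP p; apply: contrapT => /nP; apply.
split=> [nt|].
  exact: (crossed_simple actM act1 act_mul phiP (kill nt)).
split=> [/to_nt nt|].
  apply: (crossed_unique_trace actM act1 act_mul phiP); apply: kill; apply: nt.
  move=> /center [y [b [h1 h2 h3 h4 [h5 h6]]]].
  exact: (not_simple actM act1 act_mul phiP h1 h2 h3 h4 h5 h6).
split=> [/to_nt nt|/to_nt nt].
  apply: (crossed_factor actM act1 act_mul phiP); apply: kill; apply: nt.
  move=> /center [y [b [h1 h2 h3 h4 [h5 h6]]]].
  exact: (not_unique_trace actM act1 act_mul phiP h1 h2 h3 h4 h5 h6).
apply: nt => /center [y [b [h1 h2 h3 h4 [h5 h6]]]].
exact: (not_factor actM act1 act_mul phiP h1 h2 h3 h4 h5 h6).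
Qed.
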